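(* Suppose that the solution $u$ belongs to $C^2(0,2L)$ and satisfies, for a fixed $\sigma\in(0,\frac{\alpha}{2}]$, $$|u^{(\ell)}(x)|\lesssim[x(2L-x)]^{\sigma-\ell},\qquad x\in(0,2L),\ \ell=0,1,2 .$$ Let $\{U_i\}$ denote the numerical solution of the fast collocation scheme $\mathcal{L}_h[U]_i=f(x_i)$, $1\le i\le N-1$, $U_0=U_N=0$, on the symmetric graded grid with grading parameter $\kappa\ge1$. Then, for sufficiently small $\epsilon$, $$\max_{1\le i\le N-1}|u(x_i)-U_i|\lesssim\begin{cases}N^{-\kappa\sigma}+\epsilon, & \kappa(1+\sigma)<2,\\ N^{-\kappa\sigma}\ln N+\epsilon, & \kappa(1+\sigma)=2,\\ N^{-\min\{\kappa\sigma,\,2-\alpha\}}+\epsilon, & \kappa(1+\sigma)>2.\end{cases}$$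
   Context: Standing assumptions: $\alpha\in(0,1)$, $L>0$, $(a,b)=(0,2L)$, $N$ is an even positive integer, $\kappa\ge1$ is a fixed constant. $A\lesssim B$ means $A\le cB$ with a constant $c>0$ independent of $N$, of the grid index $i$, and of $\epsilon$ and the SOE parameters (it may depend on $\alpha,\sigma,\kappa,L,u$). ''For sufficiently small $\epsilon$'' means: there is $\epsilon_0>0$ such that the bound holds for all $0<\epsilon\le\epsilon_0$. Model problem: $u:\mathbb{R}\to\mathbb{R}$ satisfies $(-\Delta)^{\alpha/2}u=f$ in $(0,2L)$ and $u=0$ in $(-\infty,0]\cup[2L,\infty)$, where $(-\Delta)^{\alpha/2}u(x)=C_\alpha\,\mathrm{P.V.}\int_{\mathbb{R}}\frac{u(x)-u(y)}{|x-y|^{1+\alpha}}\,dy$ and $C_\alpha=\frac{\alpha2^{\alpha-1}\Gamma(\frac{1+\alpha}{2})}{\pi^{1/2}\Gamma(1-\frac{\alpha}{2})}$. Symmetric graded grid: $x_i=L(2i/N)^\kappa$ for $0\le i\le N/2$, and $x_i=2L-L(2-2i/N)^\kappa$ for $N/2+1\le i\le N$; $h_i=x_i-x_{i-1}$. $\phi_j$ ($1\le j\le N-1$) is the continuous piecewise linear hat function with $\phi_j(x_k)=\delta_{jk}$, zero outside $[x_{j-1},x_{j+1}]$; for $v=(v_0,\dots,v_N)$ with $v_0=v_N=0$, $\Pi_hv=\sum_{j=1}^{N-1}v_j\phi_j$ on $\mathbb{R}$. SOE approximation with tolerance $\epsilon>0$: positive numbers $\lambda_s,\theta_s$ ($1\le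 s\le N_e$) with $\big|x^{-1-\alpha}-\sum_{s=1}^{N_e}\theta_se^{-\lambda_sx}\big|\le\epsilon$ for all $x\in[\Delta x,X]$, where $0<\Delta x\le\min_jh_j$, $X\ge2L$. Fast collocation operator: $$\mathcal{L}_h[v]_i=C_\alpha\Big\{-\frac{1}{1-\alpha}\Big(h_i^{-\alpha}v_{i-1}-\frac{h_i^{-\alpha}+h_{i+1}^{-\alpha}}{\alpha}v_i+h_{i+1}^{-\alpha}v_{i+1}\Big)-\sum_{s=1}^{N_e}\theta_s\int_{-\infty}^{x_{i-1}}e^{-\lambda_s(x_i-y)}\Pi_hv(y)\,dy-\sum_{s=1}^{N_e}\theta_s\int_{x_{i+1}}^{+\infty}e^{-\lambda_s(y-x_i)}\Pi_hv(y)\,dy\Big\}.$$ *)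

(* Defs.v *)
(* Stdlib real numbers with Coquelicot. *)
From Stdlib Require Import Reals Arith.
From Coquelicot Require Import Coquelicot.
Open Scope R_scope.

(* x^p for x >= 0 and p > 0, with 0^p = 0.  [Rpower] alone would not do at the
   end points of the grid, since [Rpower 0 p = 1]. *)
Definition rpow0 (x p : R) : R := if Rlt_dec 0 x then Rpower x p else 0.

Definition Gamma_fun (z : R) : R :=
  RInt_gen (fun t => Rpower t (z - 1) * exp (- t))
           (at_right 0) (Rbar_locally p_infty).

Definition C_frac (alpha : R) : R :=
  alpha * Rpower 2 (alpha - 1) * Gamma_fun ((1 + alpha) / 2)
  / (sqrt PI * Gamma_fun (1 - alpha / 2)).

(* P.V. of the integral of g over the real line, with singularity at x, is l. *)
Definition is_PV_RInt (g : R -> R) (x l : R) : Prop :=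
  exists Il Ir : R -> R,
    (forall eta, 0 < eta ->
       is_RInt_gen g (Rbar_locally m_infty) (at_point (x - eta)) (Il eta)) /\
    (forall eta, 0 < eta ->
       is_RInt_gen g (at_point (x + eta)) (Rbar_locally p_infty) (Ir eta)) /\
    filterlim (fun eta => Il eta + Ir eta) (at_right 0) (locally l).

Definition is_frac_laplacian (alpha : R) (u : R -> R) (x l : R) : Prop :=
  exists p : R,
    is_PV_RInt (fun y => (u x - u y) / Rpower (Rabs (x - y)) (1 + alpha)) x p /\
    l = C_frac alpha * p.

(* [ex_derive_n u 2 x] alone does not imply that u is differentiable. *)
Definition C2_on (u : R -> R) (a b : R) : Prop :=
  forall x, a < x < b ->
    (forall k, (k <= 2)%nat -> ex_derive_n u k x) /\
    continuous (Derive_n u 2) x.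

Definition grid (L kappa : R) (N i : nat) : R :=
  if (i <=? N / 2)%nat then L * rpow0 (2 * INR i / INR N) kappa
  else 2 * L - L * rpow0 (2 - 2 * INR i / INR N) kappa.

(* Used for i >= 1 only. *)
Definition mesh (L kappa : R) (N i : nat) : R :=
  grid L kappa N i - grid L kappa N (i - 1).

Definition hat (L kappa : R) (N j : nat) (y : R) : R :=
  let x := grid L kappa N in
  if Rle_dec y (x (j - 1)%nat) then 0
  else if Rle_dec y (x j) then (y - x (j - 1)%nat) / (x j - x (j - 1)%nat)
  else if Rle_dec y (x (j + 1)%nat)
       then (x (j + 1)%nat - y) / (x (j + 1)%nat - x j)
  else 0.

(* A grid vector (v_0, ..., v_N) is given by a function on nat, whose values
   beyond N are never used. *)
Definition interp (L kappa : R) (N : nat) (v : nat -> R) (y : R) : R :=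
  sum_n_m (fun j => v j * hat L kappa N j y) 1 (N - 1).

Definition is_SOE (alpha eps dx X : R) (Ne : nat) (lambda theta : nat -> R)
  : Prop :=
  (forall s, (1 <= s <= Ne)%nat -> 0 < lambda s /\ 0 < theta s) /\
  (forall x, dx <= x <= X ->
     Rabs (Rpower x (- 1 - alpha)
           - sum_n_m (fun s => theta s * exp (- lambda s * x)) 1 Ne) <= eps).

Definition fast_op (alpha L kappa : R) (N Ne : nat) (lambda theta : nat -> R)
    (v : nat -> R) (i : nat) : R :=
  let x := grid L kappa N in
  let h := mesh L kappa N in
  C_frac alpha *
  ( - (1 / (1 - alpha)) *
      ( Rpower (h i) (- alpha) * v (i - 1)%nat
        - (Rpower (h i) (- alpha) + Rpower (h (i + 1)%nat) (- alpha)) / alpha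
          * v i
        + Rpower (h (i + 1)%nat) (- alpha) * v (i + 1)%nat )
    - sum_n_m (fun s => theta s *
        RInt_gen (fun y => exp (- lambda s * (x i - y)) * interp L kappa N v y)
                 (Rbar_locally m_infty) (at_point (x (i - 1)%nat))) 1 Ne
    - sum_n_m (fun s => theta s *
        RInt_gen (fun y => exp (- lambda s * (y - x i)) * interp L kappa N v y)
                 (at_point (x (i + 1)%nat)) (Rbar_locally p_infty)) 1 Ne ).

(* Main.v *)
From Stdlib Require Import Reals Lra Lia Arith Classical.
From Coquelicot Require Import Coquelicot.
Require Import Defs.
Open Scope R_scope.

(** The error is estimated by consistency and stability, with the grid written as
    [2 * M] cells and [K t = t^(-1-alpha)].

    Stability.  After division by [C_frac], which is positive ([C_frac_pos]), the
    scheme at a node [x] is the principal value integral of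
    [(v(x) - Pv(y)) * K(|x - y|)] for the piecewise linear interpolant [Pv], except
    that the kernel is replaced by the sum of exponentials outside the two cells
    adjacent to [x] ([two_sided], [fast_op_two_sided]).  Where [|v|] attains its
    maximum [m], all contributions of the interior can be dropped, and the
    exterior, on which [Pv] vanishes, leaves
    [m * (x^(-alpha) + (2 L - x)^(-alpha)) / alpha], up to [2 * L * eps * m].
    Thus a residual of size [R * bdist(x)^(-alpha)] forces [|v| <= 2 * alpha * R]
    ([two_sided_stability]), [bdist] being the distance to the boundary.

    Consistency.  The residual of [u] is the integral of [D * K], with
    [D = u - Pu], plus a term of order [eps] ([truncation_error],
    [side_kernel_diff]).  It has to be at most [E * bdist(x)^(-alpha)], where [E] is
    the claimed rate.  With [tau = 1/M] the cells next to [x] have length about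
    [tau * bdist(x)^(1-1/kappa)] ([adjacent_mesh_bounds]), so that
    [|D| <= C * tau^2 * bdist^(sigma-2/kappa)] off the two boundary cells, where
    [|D| <= C * x_1^sigma]; moreover [D] vanishes linearly at the nodes
    ([interpolation_error_bounds]).  Take [x] in the left half.  The part of the
    integral over points at distance at least [x/2] from the boundary is of order
    [x^(-alpha) * tau^(2-alpha) * (1 + x^(sigma-(2-alpha)/kappa))], and as
    [x >= x_1 = L * tau^kappa] the product of the last two factors is at most a
    constant times [tau^(2-alpha) + tau^(kappa*sigma)] ([local_terms_rate]).  The
    part over [(0, x/2)] is at most a constant times [x^(-1-alpha)] times the
    integral of [|D|] over [(0, x)], that is, of
    [tau^2 * y^(sigma-2/kappa)] apart from the first cell; near the right end
    point the kernel is bounded and the total mass of [D] is enough.  The integral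
    of [|D|] is where [kappa * (1 + sigma) = 2] separates three regimes
    ([mass_subcritical], [mass_critical], [mass_supercritical]).  The right half
    follows by reflection. *)

(** * Powers and weakly singular integrals *)

Lemma Rpower_pos x y : 0 < Rpower x y.
Proof. apply exp_pos. Qed.

Lemma Rpower_anti a b e : e <= 0 -> 0 < a <= b -> Rpower b e <= Rpower a e.
Proof.
  intros He [Ha Hab].
  rewrite <- (Ropp_involutive e), !(Rpower_Ropp _ (- e)).
  apply Rinv_le_contravar; [apply Rpower_pos|].
  apply Rle_Rpower_l; lra.
Qed.

Lemma Rpower_1_base e : Rpower 1 e = 1.
Proof. unfold Rpower. rewrite ln_1, Rmult_0_r. apply exp_0. Qed.

Lemma Rpower_2_ge_1 e : 0 <= e -> 1 <= Rpower 2 e.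
Proof. intros He. rewrite <- (Rpower_1_base e). apply Rle_Rpower_l; lra. Qed.

(** A power is monotone in its base, in one direction or the other; bounding by
    the sum of the two end values avoids a case distinction on the sign of [e]. *)
Lemma Rpower_between z e a b :
  0 < a <= z -> z <= b -> Rpower z e <= Rpower a e + Rpower b e.
Proof.
  intros Ha Hb. assert (Pa := Rpower_pos a e). assert (Pb := Rpower_pos b e).
  destruct (Rle_dec 0 e) as [He | He].
  - assert (Rpower z e <= Rpower b e) by (apply Rle_Rpower_l; lra). lra.
  - assert (Rpower z e <= Rpower a e) by (apply Rpower_anti; lra). lra.
Qed.

Lemma Rpower_small_near_zero c e d : 0 < e -> 0 < d -> 0 <= c ->
  exists eta0, 0 < eta0 /\ forall eta, 0 < eta <= eta0 -> c * Rpower eta e <= d.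
Proof.
  intros He Hd Hc. exists (Rpower (d / (c + 1)) (/ e)). split; [apply Rpower_pos|].
  intros eta [H1 H2].
  assert (H0 : 0 < d / (c + 1)) by (apply Rdiv_lt_0_compat; lra).
  assert (H : Rpower eta e <= d / (c + 1)).
  { replace (d / (c + 1)) with (Rpower (Rpower (d / (c + 1)) (/ e)) e).
    - apply Rle_Rpower_l; lra.
    - rewrite Rpower_mult, Rinv_l, Rpower_1; lra. }
  apply Rle_trans with (c * (d / (c + 1))); [apply Rmult_le_compat_l; lra|].
  apply Rmult_le_reg_r with (c + 1); [lra|]. field_simplify; nra.
Qed.

Lemma is_derive_Rpower e x :
  0 < x -> is_derive (fun t => Rpower t e) x (e * Rpower x (e - 1)).
Proof. intros Hx. apply is_derive_Reals, derivable_pt_lim_power, Hx. Qed.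

Lemma continuous_Rpower e x : 0 < x -> continuous (fun t => Rpower t e) x.
Proof.
  intros Hx. apply (ex_derive_continuous (fun t => Rpower t e)).
  eexists. apply is_derive_Rpower, Hx.
Qed.

Lemma is_RInt_Rpower e a b :
  0 < a -> 0 < b -> e <> 0 ->
  is_RInt (fun t => Rpower t (e - 1)) a b ((Rpower b e - Rpower a e) / e).
Proof.
  intros Ha Hb He.
  assert (Hpos : forall x, Rmin a b <= x -> 0 < x).
  { intros x Hx. generalize (Rmin_glb_lt a b 0 Ha Hb). lra. }
  replace ((Rpower b e - Rpower a e) / e) with
    (minus (Rpower b e / e) (Rpower a e / e))
    by (unfold minus, plus, opp; simpl; field; lra).
  apply (is_RInt_derive (fun t => Rpower t e / e)).
  - intros x Hx.
    replace (Rpower x (e - 1)) with (/ e * (e * Rpower x (e - 1))) by (field; lra).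
    apply (is_derive_ext (fun t => / e * Rpower t e)).
    { intros t. apply Rmult_comm. }
    apply is_derive_scal, is_derive_Rpower, Hpos, Hx.
  - intros x Hx. apply continuous_Rpower, Hpos, Hx.
Qed.

Lemma RInt_Rpower e a b :
  0 < a -> 0 < b -> e <> 0 ->
  RInt (fun t => Rpower t (e - 1)) a b = (Rpower b e - Rpower a e) / e.
Proof. intros. apply is_RInt_unique, is_RInt_Rpower; assumption. Qed.

Lemma ex_RInt_cont (f : R -> R) a b :
  a <= b -> (forall t, a <= t <= b -> continuous f t) -> ex_RInt f a b.
Proof.
  intros Hab Hf. apply (ex_RInt_continuous f).
  rewrite Rmin_left, Rmax_right; assumption.
Qed.

Lemma continuous_Rmult (f g : R -> R) x :
  continuous f x -> continuous g x -> continuous (fun t => f t * g t) x.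
Proof. apply (continuous_mult f g). Qed.

Lemma continuous_Rplus (f g : R -> R) x :
  continuous f x -> continuous g x -> continuous (fun t => f t + g t) x.
Proof. apply (continuous_plus f g). Qed.

Lemma continuous_Rminus (f g : R -> R) x :
  continuous f x -> continuous g x -> continuous (fun t => f t - g t) x.
Proof. apply (continuous_minus f g). Qed.

Lemma continuous_Rabs_fun (f : R -> R) x :
  continuous f x -> continuous (fun t => Rabs (f t)) x.
Proof. intros Hf. apply (continuous_comp f Rabs); [exact Hf | apply continuous_Rabs]. Qed.

Lemma continuous_shift_plus (h : R -> R) x :
  (forall t, continuous h t) -> forall t, continuous (fun t => h (x + t)) t.
Proof.
  intros Hh t. apply (continuous_comp (fun t => x + t) h); [|apply Hh].
  apply continuous_Rplus; [apply continuous_const | apply continuous_id].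
Qed.

Lemma continuous_shift_minus (h : R -> R) x :
  (forall t, continuous h t) -> forall t, continuous (fun t => h (x - t)) t.
Proof.
  intros Hh t. apply (continuous_comp (fun t => x - t) h); [|apply Hh].
  apply continuous_Rminus; [apply continuous_const | apply continuous_id].
Qed.

Lemma RInt_mult_const (f : R -> R) c a b :
  ex_RInt f a b -> RInt (fun t => c * f t) a b = c * RInt f a b.
Proof. intros Hf. apply (RInt_scal f a b c Hf). Qed.

Lemma ex_RInt_mult_const (f : R -> R) c a b :
  ex_RInt f a b -> ex_RInt (fun t => c * f t) a b.
Proof. intros Hf. apply (ex_RInt_scal f a b c Hf). Qed.

Lemma RInt_Rplus (f g : R -> R) a b :
  ex_RInt f a b -> ex_RInt g a b ->
  RInt (fun t => f t + g t) a b = RInt f a b + RInt g a b.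
Proof. intros Hf Hg. apply (RInt_plus f g a b Hf Hg). Qed.

Lemma RInt_Rminus (f g : R -> R) a b :
  ex_RInt f a b -> ex_RInt g a b ->
  RInt (fun t => f t - g t) a b = RInt f a b - RInt g a b.
Proof. intros Hf Hg. apply (RInt_minus f g a b Hf Hg). Qed.

Lemma RInt_split (f : R -> R) a b c :
  a <= b <= c -> (forall t, a <= t <= c -> continuous f t) ->
  RInt f a c = RInt f a b + RInt f b c.
Proof.
  intros H Hf. symmetry. apply (RInt_Chasles f); apply ex_RInt_cont; try lra;
  intros; apply Hf; lra.
Qed.

Lemma RInt_abs_le (f g : R -> R) a b :
  a <= b -> (forall t, a <= t <= b -> continuous f t) ->
  (forall t, a <= t <= b -> continuous g t) ->
  (forall t, a < t < b -> Rabs (f t) <= g t) ->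
  Rabs (RInt f a b) <= RInt g a b.
Proof.
  intros Hab Hf Hg H.
  eapply Rle_trans; [apply abs_RInt_le; [lra | apply ex_RInt_cont; assumption]|].
  apply RInt_le; try assumption; apply ex_RInt_cont; try assumption.
  intros; apply continuous_Rabs_fun; auto.
Qed.

Lemma RInt_nonneg_sub (f : R -> R) a b c d :
  a <= b <= c -> c <= d -> (forall t, a <= t <= d -> continuous f t) ->
  (forall t, a <= t <= d -> 0 <= f t) -> RInt f b c <= RInt f a d.
Proof.
  intros H H' Hf Hp.
  rewrite (RInt_split f a b d), (RInt_split f b c d); try lra;
    try (intros; apply Hf; lra).
  assert (0 <= RInt f a b /\ 0 <= RInt f c d); [|lra].
  split; apply RInt_ge_0; try lra; try (apply ex_RInt_cont; try lra);
    intros; (apply Hf || apply Hp); lra.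
Qed.

(** Three mechanisms tame the kernel [t^(-1-alpha)].  Near the origin one power
    of [t] is gained from [G] vanishing linearly; from [rho] on, the kernel is
    integrable with integral [rho^(-alpha) / alpha], so a pointwise bound is
    enough; beyond [d] the kernel is bounded by its value at [d], and only the
    [L1] norm of [G] matters.  The last mechanism lets [G] be large, provided it
    is so on a short interval away from the singularity. *)
Lemma singular_integral_bound alpha rho l d B1 B2 m eta (G : R -> R) :
  0 < alpha < 1 -> 0 < eta <= rho -> rho <= l -> 0 < d -> 0 <= B1 -> 0 <= B2 ->
  (forall t, continuous G t) ->
  (forall t, 0 <= t <= rho -> Rabs (G t) <= B1 * t) ->
  (forall t, rho <= t <= l -> t < d -> Rabs (G t) <= B2) ->
  RInt (fun t => Rabs (G t)) 0 l <= m ->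
  Rabs (RInt (fun t => Rpower t (- 1 - alpha) * G t) eta l) <=
  B1 * Rpower rho (1 - alpha) / (1 - alpha) + B2 * Rpower rho (- alpha) / alpha
  + Rpower d (- 1 - alpha) * m.
Proof.
  intros Ha Heta Hl Hd HB1 HB2 HG H1 H2 Hm.
  assert (HK : forall t e, eta <= t -> continuous (fun t => Rpower t e) t).
  { intros; apply continuous_Rpower; lra. }
  assert (HKG : forall t, eta <= t -> continuous (fun t => Rpower t (- 1 - alpha) * G t) t).
  { intros; apply continuous_Rmult; auto. }
  assert (HGa : forall t, continuous (fun t => Rabs (G t)) t).
  { intros; apply continuous_Rabs_fun; auto. }
  rewrite (RInt_split _ eta rho l) by (try lra; intros; apply HKG; lra).
  eapply Rle_trans; [apply Rabs_triang|].
  rewrite Rplus_assoc; apply Rplus_le_compat.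
  - apply Rle_trans with (RInt (fun t => B1 * Rpower t (1 - alpha - 1)) eta rho).
    + apply RInt_abs_le; try lra.
      * intros; apply HKG; lra.
      * intros; apply continuous_Rmult; [apply continuous_const | apply HK; lra].
      * intros t Ht. rewrite Rabs_mult, (Rabs_pos_eq (Rpower _ _)) by (left; apply Rpower_pos).
        replace (1 - alpha - 1) with (-1 - alpha + 1) by ring.
        rewrite Rpower_plus, Rpower_1 by lra.
        assert (Hg := H1 t ltac:(lra)).
        replace (B1 * (Rpower t (-1 - alpha) * t)) with (Rpower t (-1 - alpha) * (B1 * t)) by ring.
        apply Rmult_le_compat_l; [left; apply Rpower_pos | exact Hg].
    + rewrite RInt_mult_const by (eexists; apply is_RInt_Rpower; lra).
      rewrite RInt_Rpower by lra. unfold Rdiv.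
      rewrite Rmult_assoc. apply Rmult_le_compat_l; [lra|].
      apply Rmult_le_compat_r; [left; apply Rinv_0_lt_compat; lra|].
      generalize (Rpower_pos eta (1 - alpha)); lra.
  - apply Rle_trans with (RInt (fun t => B2 * Rpower t (- alpha - 1)
                                  + Rpower d (- 1 - alpha) * Rabs (G t)) rho l).
    + apply RInt_abs_le; try lra.
      * intros; apply HKG; lra.
      * intros; apply continuous_Rplus; apply continuous_Rmult;
          try apply continuous_const; auto. apply HK; lra.
      * intros t Ht. rewrite Rabs_mult, (Rabs_pos_eq (Rpower _ _)) by (left; apply Rpower_pos).
        replace (- alpha - 1) with (-1 - alpha) by ring.
        assert (P1 := Rpower_pos t (-1 - alpha)). assert (P2 := Rpower_pos d (-1 - alpha)).
        assert (P3 := Rabs_pos (G t)).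
        destruct (Rlt_dec t d) as [Htd | Htd].
        -- assert (Hg := H2 t ltac:(lra) Htd).
           assert (0 <= Rpower d (-1 - alpha) * Rabs (G t)) by (apply Rmult_le_pos; lra).
           assert (Rpower t (-1 - alpha) * Rabs (G t) <= Rpower t (-1 - alpha) * B2)
             by (apply Rmult_le_compat_l; lra). lra.
        -- assert (Rpower t (-1 - alpha) <= Rpower d (-1 - alpha)) by (apply Rpower_anti; lra).
           assert (0 <= B2 * Rpower t (-1 - alpha)) by (apply Rmult_le_pos; lra).
           assert (Rpower t (-1 - alpha) * Rabs (G t) <= Rpower d (-1 - alpha) * Rabs (G t))
             by (apply Rmult_le_compat_r; lra). lra.
    + assert (E1 : ex_RInt (fun t => Rpower t (- alpha - 1)) rho l)
        by (eexists; apply is_RInt_Rpower; lra).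
      assert (E2 : ex_RInt (fun t => Rabs (G t)) rho l)
        by (apply ex_RInt_cont; auto).
      rewrite RInt_Rplus by (apply ex_RInt_mult_const; assumption).
      rewrite (RInt_mult_const _ B2) by exact E1.
      rewrite (RInt_mult_const _ (Rpower d _)) by exact E2.
      rewrite RInt_Rpower by lra.
      apply Rplus_le_compat.
      * replace (B2 * ((Rpower l (- alpha) - Rpower rho (- alpha)) / - alpha))
          with (B2 * (Rpower rho (- alpha) - Rpower l (- alpha)) / alpha) by (field; lra).
        apply Rmult_le_compat_r; [left; apply Rinv_0_lt_compat; lra|].
        apply Rmult_le_compat_l; [lra|]. generalize (Rpower_pos l (- alpha)); lra.
      * apply Rmult_le_compat_l; [left; apply Rpower_pos|].
        eapply Rle_trans; [|exact Hm].
        apply RInt_nonneg_sub; try lra; auto. intros; apply Rabs_pos.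
Qed.

(** * One-sided form of the operators *)

Lemma is_RInt_translate (h : R -> R) x a b l :
  is_RInt h a b l -> is_RInt (fun y => h (y - x)) (x + a) (x + b) l.
Proof.
  intros H.
  apply (is_RInt_ext (fun y => scal 1 (h (1 * y + - x)))).
  { intros y _. change (1 * h (1 * y + - x) = h (y - x)).
    rewrite Rmult_1_l. f_equal. ring. }
  apply (is_RInt_comp_lin h 1 (- x) (x + a) (x + b)).
  replace (1 * (x + a) + - x) with a by ring.
  replace (1 * (x + b) + - x) with b by ring. exact H.
Qed.

Lemma is_RInt_mirror (h : R -> R) x a b l :
  is_RInt h a b l -> is_RInt (fun y => h (x - y)) (x - b) (x - a) l.
Proof.
  intros H.
  apply (is_RInt_ext (fun y => opp (scal (-1) (h (-1 * y + x))))).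
  { intros y _. change (- (-1 * h (-1 * y + x)) = h (x - y)).
    replace (-1 * y + x) with (x - y) by ring. ring. }
  rewrite <- (opp_opp l). apply (is_RInt_opp (fun y => scal (-1) (h (-1 * y + x)))).
  apply (is_RInt_comp_lin h (-1) x (x - b) (x - a)).
  replace (-1 * (x - b) + x) with b by ring.
  replace (-1 * (x - a) + x) with a by ring. apply is_RInt_swap, H.
Qed.

Lemma is_RInt_gen_right (f F : R -> R) a b0 l :
  (forall b, b0 < b -> is_RInt f a b (F b)) ->
  filterlim F (Rbar_locally p_infty) (locally l) ->
  is_RInt_gen f (at_point a) (Rbar_locally p_infty) l.
Proof.
  intros HF Hl P HP. specialize (Hl P HP).
  unfold filtermapi.
  apply (Filter_prod _ _ _ (fun x => x = a) (fun b => b0 < b /\ P (F b))).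
  - reflexivity.
  - apply filter_and; [exists b0; auto | exact Hl].
  - intros x y -> [Hy HPy]. exists (F y). split; [apply HF, Hy | exact HPy].
Qed.

Lemma is_RInt_gen_left (f F : R -> R) a b0 l :
  (forall b, b < b0 -> is_RInt f b a (F b)) ->
  filterlim F (Rbar_locally m_infty) (locally l) ->
  is_RInt_gen f (Rbar_locally m_infty) (at_point a) l.
Proof.
  intros HF Hl P HP. specialize (Hl P HP).
  unfold filtermapi.
  apply (Filter_prod _ _ _ (fun b => b < b0 /\ P (F b)) (fun x => x = a)).
  - apply filter_and; [exists b0; auto | exact Hl].
  - reflexivity.
  - intros x y [Hy HPy] ->. exists (F x). split; [apply HF, Hy | exact HPy].
Qed.

Lemma Rpower_lim_infty e :
  e < 0 -> filterlim (fun b => Rpower b e) (Rbar_locally p_infty) (locally 0).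
Proof.
  intros He. apply (is_lim_spec (fun b => Rpower b e) p_infty 0).
  intros eps. exists (Rpower eps (/ e)). intros x Hx.
  assert (H0 := Rpower_pos eps (/ e)).
  rewrite Rminus_0_r, Rabs_pos_eq by (left; apply Rpower_pos).
  replace (pos eps) with (Rpower (Rpower eps (/ e)) e).
  - rewrite <- (Ropp_involutive e), !(Rpower_Ropp _ (- e)).
    apply Rinv_lt_contravar; [apply Rmult_lt_0_compat; apply Rpower_pos|].
    apply Rlt_Rpower_l; rewrite ?Ropp_involutive; lra.
  - rewrite Rpower_mult. replace (/ e * e) with 1 by (field; lra).
    apply Rpower_1, cond_pos.
Qed.

Lemma filterlim_minus_Rpower (F : (R -> Prop) -> Prop) {FF : Filter F} (phi : R -> R) T c e :
  e < 0 -> filterlim phi F (Rbar_locally p_infty) ->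
  filterlim (fun b => T - c * Rpower (phi b) e) F (locally T).
Proof.
  intros He Hphi.
  replace (locally T) with (locally (T - c * 0)) by (f_equal; ring).
  apply (filterlim_comp _ _ _ (fun b => Rpower (phi b) e) (fun z => T - c * z) _ (locally 0)).
  - apply (filterlim_comp _ _ _ phi (fun b => Rpower b e) _ (Rbar_locally p_infty));
      [exact Hphi | apply Rpower_lim_infty; lra].
  - apply (continuous_Rminus (fun _ => T) (fun z => c * z) 0); [apply continuous_const|].
    apply (continuous_Rmult (fun _ => c)); [apply continuous_const | apply continuous_id].
Qed.

(** One of the two halves of the collocation operator divided by [C_frac], in
    the distance [t] from the node.  Let [G] be affine on [[0, rho]] with
    [G 0 = v0], [G rho = v1], and let [k t = t^(-1-alpha)].  Then this is the
    integral of [(v0 - G t) * k t] over [(0, infinity)] for a [G] vanishing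
    beyond [l]: the part over [(0, rho)] and the integral of [v0 * k] over
    [(rho, infinity)] add up to the first term.  The kernel is left free on
    [[rho, l]], to be replaced by a sum of exponentials. *)
Definition side (alpha rho l v0 v1 : R) (k G : R -> R) : R :=
  Rpower rho (- alpha) * (v0 / alpha - v1) / (1 - alpha)
  - RInt (fun t => k t * G t) rho l.

(** The integral of [(v0 - g t) * t^(-1-alpha)] over [(eta, infinity)], for [g]
    vanishing beyond [l]; the term in [v0] is integrated in closed form. *)
Definition trunc_side (alpha l v0 : R) (g : R -> R) (eta : R) : R :=
  v0 * Rpower eta (- alpha) / alpha
  - RInt (fun t => Rpower t (- 1 - alpha) * g t) eta l.

Lemma is_RInt_kernel alpha a b :
  0 < alpha -> 0 < a -> 0 < b ->
  is_RInt (fun t => Rpower t (- 1 - alpha)) a b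
    ((Rpower a (- alpha) - Rpower b (- alpha)) / alpha).
Proof.
  intros H Ha Hb.
  replace ((Rpower a (- alpha) - Rpower b (- alpha)) / alpha)
    with ((Rpower b (- alpha) - Rpower a (- alpha)) / (- alpha)) by (field; lra).
  replace (- 1 - alpha) with (- alpha - 1) by ring.
  apply is_RInt_Rpower; lra.
Qed.

Lemma trunc_side_is_RInt alpha l v0 (g : R -> R) eta b :
  0 < alpha -> 0 < eta <= l -> l < b -> (forall t, continuous g t) ->
  (forall t, l <= t -> g t = 0) ->
  is_RInt (fun t => (v0 - g t) * Rpower t (- 1 - alpha)) eta b
    (trunc_side alpha l v0 g eta - v0 / alpha * Rpower b (- alpha)).
Proof.
  intros Ha Heta Hb Hg Hg0.
  replace (trunc_side alpha l v0 g eta - v0 / alpha * Rpower b (- alpha)) with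
    (v0 * ((Rpower eta (- alpha) - Rpower b (- alpha)) / alpha)
     - RInt (fun t => Rpower t (- 1 - alpha) * g t) eta b).
  - apply (is_RInt_ext (fun t => v0 * Rpower t (- 1 - alpha) - Rpower t (- 1 - alpha) * g t)).
    { intros; change (v0 * Rpower x (- 1 - alpha) - Rpower x (- 1 - alpha) * g x
                      = (v0 - g x) * Rpower x (- 1 - alpha)); ring. }
    apply (is_RInt_minus (fun t => v0 * Rpower t (- 1 - alpha))
             (fun t => Rpower t (- 1 - alpha) * g t)).
    + apply (is_RInt_scal (fun t => Rpower t (- 1 - alpha))), is_RInt_kernel; lra.
    + apply (RInt_correct (fun t => Rpower t (- 1 - alpha) * g t)), ex_RInt_cont; [lra|].
      intros; apply continuous_Rmult; [apply continuous_Rpower; lra | apply Hg].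
  - rewrite (RInt_split _ eta l b); [|lra|].
    + rewrite (RInt_ext _ (fun _ => 0) l b).
      * rewrite RInt_const. unfold trunc_side, scal; simpl; unfold mult; simpl. field. lra.
      * intros x Hx. rewrite Rmin_left in Hx by lra.
        rewrite Hg0 by lra. apply Rmult_0_r.
    + intros; apply continuous_Rmult; [apply continuous_Rpower; lra | apply Hg].
Qed.

Lemma trunc_side_right alpha x X (u : R -> R) eta :
  0 < alpha -> 0 < eta <= X - x -> (forall t, continuous u t) ->
  (forall t, X <= t -> u t = 0) ->
  is_RInt_gen (fun y => (u x - u y) / Rpower (Rabs (x - y)) (1 + alpha))
    (at_point (x + eta)) (Rbar_locally p_infty)
    (trunc_side alpha (X - x) (u x) (fun t => u (x + t)) eta).
Proof.
  intros Ha Heta Hu Hu0.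
  apply (is_RInt_gen_right _ (fun b => trunc_side alpha (X - x) (u x) (fun t => u (x + t)) eta
           - u x / alpha * Rpower (b - x) (- alpha)) _ X).
  - intros b Hb.
    apply (is_RInt_ext (fun y => (u x - u (x + (y - x))) * Rpower (y - x) (- 1 - alpha))).
    { intros y Hy. rewrite Rmin_left in Hy by lra.
      rewrite Rabs_left by lra. replace (x + (y - x)) with y by ring.
      replace (- (x - y)) with (y - x) by ring.
      replace (- 1 - alpha) with (- (1 + alpha)) by ring.
      rewrite Rpower_Ropp. reflexivity. }
    replace b with (x + (b - x)) at 1 by ring.
    apply (is_RInt_translate (fun t => (u x - u (x + t)) * Rpower t (- 1 - alpha))).
    apply (trunc_side_is_RInt alpha (X - x) (u x) (fun t => u (x + t))); try lra.
    + intros t. apply (continuous_comp (fun t => x + t) u); [|apply Hu].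
      apply continuous_Rplus; [apply continuous_const | apply continuous_id].
    + intros; apply Hu0; lra.
  - apply (filterlim_minus_Rpower _ (fun b => b - x)); [lra|].
    intros P [M HM]. exists (M + x). intros y Hy. apply HM. lra.
Qed.

Lemma trunc_side_left alpha x (u : R -> R) eta :
  0 < alpha -> 0 < eta <= x -> (forall t, continuous u t) ->
  (forall t, t <= 0 -> u t = 0) ->
  is_RInt_gen (fun y => (u x - u y) / Rpower (Rabs (x - y)) (1 + alpha))
    (Rbar_locally m_infty) (at_point (x - eta))
    (trunc_side alpha x (u x) (fun t => u (x - t)) eta).
Proof.
  intros Ha Heta Hu Hu0.
  apply (is_RInt_gen_left _ (fun b => trunc_side alpha x (u x) (fun t => u (x - t)) eta
           - u x / alpha * Rpower (x - b) (- alpha)) _ 0).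
  - intros b Hb.
    apply (is_RInt_ext (fun y => (u x - u (x - (x - y))) * Rpower (x - y) (- 1 - alpha))).
    { intros y Hy. rewrite Rmax_right in Hy by lra.
      rewrite Rabs_right by lra. replace (x - (x - y)) with y by ring.
      replace (- 1 - alpha) with (- (1 + alpha)) by ring.
      rewrite Rpower_Ropp. reflexivity. }
    replace b with (x - (x - b)) at 1 by ring.
    apply (is_RInt_mirror (fun t => (u x - u (x - t)) * Rpower t (- 1 - alpha))).
    apply (trunc_side_is_RInt alpha x (u x) (fun t => u (x - t))); try lra.
    + intros t. apply (continuous_comp (fun t => x - t) u); [|apply Hu].
      apply continuous_Rminus; [apply continuous_const | apply continuous_id].
    + intros; apply Hu0; lra.
  - apply (filterlim_minus_Rpower _ (fun b => x - b)); [lra|].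
    intros P [M HM]. exists (x - M). intros y Hy. apply HM. lra.
Qed.

(** * Maximum principle and truncation error on one side *)

(** The discrete maximum principle, for one side.  At a maximum [m] the
    neighbouring value [v1] and the values of [G] can be replaced by [m]; then
    the integral of [m * t^(-1-alpha)] over [(l, infinity)] remains.  It comes
    from the exterior of the interval, where the function is zero. *)
Lemma side_lower_bound alpha rho l m v1 eps (k G : R -> R) :
  0 < alpha < 1 -> 0 < rho <= l -> 0 <= m ->
  v1 <= m -> (forall t, continuous k t) -> (forall t, continuous G t) ->
  (forall t, rho <= t <= l -> 0 <= k t <= Rpower t (- 1 - alpha) + eps) ->
  (forall t, rho <= t <= l -> Rabs (G t) <= m) ->
  m * (Rpower l (- alpha) / alpha - eps * (l - rho)) <= side alpha rho l m v1 k G.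
Proof.
  intros Ha Hl Hm Hv Hk HG Hk1 HG1.
  assert (HI : RInt (fun t => k t * G t) rho l <=
     m * ((Rpower rho (- alpha) - Rpower l (- alpha)) / alpha + eps * (l - rho))).
  { apply Rle_trans with (RInt (fun t => m * (Rpower t (- 1 - alpha) + eps)) rho l).
    - eapply Rle_trans; [apply Rle_abs|]. apply RInt_abs_le; try lra.
      + intros; apply continuous_Rmult; auto.
      + intros; apply continuous_Rmult; [apply continuous_const|].
        apply continuous_Rplus; [apply continuous_Rpower; lra | apply continuous_const].
      + intros t Ht. rewrite Rabs_mult, Rmult_comm.
        specialize (Hk1 t ltac:(lra)). specialize (HG1 t ltac:(lra)).
        rewrite (Rabs_pos_eq (k t)) by lra.
        apply Rmult_le_compat; try lra; try apply Rabs_pos.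
    - right. apply is_RInt_unique.
      apply (is_RInt_scal (fun t => Rpower t (- 1 - alpha) + eps)).
      apply (is_RInt_plus (fun t => Rpower t (- 1 - alpha)) (fun _ => eps)).
      + apply is_RInt_kernel; lra.
      + rewrite Rmult_comm. apply (is_RInt_const rho l eps). }
  unfold side.
  assert (P := Rpower_pos rho (- alpha)).
  assert (Rpower rho (- alpha) * (m / alpha) <= Rpower rho (- alpha) * (m / alpha - v1) / (1 - alpha)).
  { unfold Rdiv at 2. rewrite Rmult_assoc. apply Rmult_le_compat_l; [lra|].
    apply Rmult_le_reg_r with (1 - alpha); [lra|].
    rewrite Rmult_assoc, Rinv_l, Rmult_1_r by lra.
    replace (m / alpha * (1 - alpha)) with (m / alpha - m) by (field; lra). lra. }
  replace (m * (Rpower l (- alpha) / alpha - eps * (l - rho))) with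
    (Rpower rho (- alpha) * (m / alpha) - m * ((Rpower rho (- alpha) - Rpower l (- alpha)) / alpha + eps * (l - rho)))
    by (field; lra).
  lra.
Qed.

Lemma side_kernel_diff alpha rho l v0 v1 eps m (k1 k2 G : R -> R) :
  rho <= l ->
  (forall t, rho <= t <= l -> continuous k1 t) ->
  (forall t, rho <= t <= l -> continuous k2 t) -> (forall t, continuous G t) ->
  (forall t, rho <= t <= l -> Rabs (k1 t - k2 t) <= eps) ->
  (forall t, rho <= t <= l -> Rabs (G t) <= m) ->
  Rabs (side alpha rho l v0 v1 k1 G - side alpha rho l v0 v1 k2 G) <= eps * m * (l - rho).
Proof.
  intros Hl H1 H2 HG Hk Hm. unfold side.
  match goal with |- Rabs ?a <= _ => replace a with
    (- (RInt (fun t => k1 t * G t) rho l - RInt (fun t => k2 t * G t) rho l)) by ring end.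
  rewrite Rabs_Ropp, <- RInt_Rminus by
    (apply ex_RInt_cont; [exact Hl | intros; apply continuous_Rmult; auto]).
  rewrite Rmult_comm.
  apply abs_RInt_le_const; [exact Hl | |].
  - apply ex_RInt_cont; [exact Hl|]. intros; apply continuous_Rminus; apply continuous_Rmult; auto.
  - intros t Ht. rewrite <- Rmult_minus_distr_r, Rabs_mult.
    apply Rmult_le_compat; try apply Rabs_pos; auto.
Qed.

(** The two expressions differ by the error [g - G] weighted by the kernel, and by
    the contribution of the affine piece on [(0, eta)], which tends to zero with
    [eta] because [alpha < 1]. *)
Lemma trunc_side_eq alpha rho l v0 v1 (g G : R -> R) eta :
  0 < alpha < 1 -> 0 < eta <= rho -> rho <= l ->
  (forall t, continuous g t) -> (forall t, continuous G t) ->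
  (forall t, 0 <= t <= rho -> G t = v0 - (v0 - v1) / rho * t) ->
  trunc_side alpha l v0 g eta
  - side alpha rho l v0 v1 (fun t => Rpower t (- 1 - alpha)) G =
  - RInt (fun t => Rpower t (- 1 - alpha) * (g t - G t)) eta l
  - (v0 - v1) / rho * Rpower eta (1 - alpha) / (1 - alpha).
Proof.
  intros Ha He Hl Hg HG Hlin.
  assert (HK : forall (h : R -> R) t, eta <= t -> (forall t, continuous h t) ->
            continuous (fun t => Rpower t (- 1 - alpha) * h t) t).
  { intros; apply continuous_Rmult; [apply continuous_Rpower; lra | auto]. }
  assert (HD : RInt (fun t => Rpower t (- 1 - alpha) * (g t - G t)) eta l
     = RInt (fun t => Rpower t (- 1 - alpha) * g t) eta l
       - RInt (fun t => Rpower t (- 1 - alpha) * G t) eta l).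
  { rewrite <- RInt_Rminus by (apply ex_RInt_cont; [lra | intros; apply HK; auto; lra]).
    apply RInt_ext. intros. apply Rmult_minus_distr_l. }
  rewrite HD, (RInt_split (fun t => Rpower t (- 1 - alpha) * G t) eta rho l)
    by (try lra; intros; apply HK; auto; lra).
  assert (HN : RInt (fun t => Rpower t (- 1 - alpha) * G t) eta rho =
    v0 * ((Rpower eta (- alpha) - Rpower rho (- alpha)) / alpha)
    - (v0 - v1) / rho * ((Rpower rho (1 - alpha) - Rpower eta (1 - alpha)) / (1 - alpha))).
  { apply is_RInt_unique.
    apply (is_RInt_ext (fun t => v0 * Rpower t (- 1 - alpha)
             - (v0 - v1) / rho * Rpower t (1 - alpha - 1))).
    - intros t Ht. rewrite Rmin_left, Rmax_right in Ht by lra.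
      rewrite Hlin by lra.
      replace (1 - alpha - 1) with (-1 - alpha + 1) by ring.
      rewrite Rpower_plus, Rpower_1 by lra.
      match goal with |- ?a = ?b => change (@eq R a b) end. ring.
    - apply (is_RInt_minus (fun t => v0 * Rpower t (- 1 - alpha))
         (fun t => (v0 - v1) / rho * Rpower t (1 - alpha - 1))).
      + apply (is_RInt_scal (fun t => Rpower t (- 1 - alpha))), is_RInt_kernel; lra.
      + apply (is_RInt_scal (fun t => Rpower t (1 - alpha - 1))), is_RInt_Rpower; lra. }
  rewrite HN. unfold trunc_side, side.
  replace (Rpower rho (1 - alpha)) with (rho * Rpower rho (- alpha)).
  2:{ replace (1 - alpha) with (1 + - alpha) by ring. rewrite Rpower_plus, Rpower_1 by lra. reflexivity. }
  field. repeat split; lra.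
Qed.

(** Both one-sided integrals in the definition of the principal value are unique,
    hence equal to [trunc_side]; a bound that is uniform in [eta] up to a
    vanishing term survives the limit. *)
Lemma PV_close alpha x X u p S B c eta0 :
  0 < alpha < 1 -> 0 < x < X -> (forall t, continuous u t) ->
  (forall t, t <= 0 \/ X <= t -> u t = 0) ->
  is_PV_RInt (fun y => (u x - u y) / Rpower (Rabs (x - y)) (1 + alpha)) x p ->
  0 <= c -> 0 < eta0 ->
  (forall eta, 0 < eta <= x -> eta <= X - x -> eta <= eta0 ->
     Rabs (trunc_side alpha x (u x) (fun t => u (x - t)) eta
           + trunc_side alpha (X - x) (u x) (fun t => u (x + t)) eta - S)
     <= B + c * Rpower eta (1 - alpha)) ->
  Rabs (p - S) <= B.
Proof.
  intros Ha Hx Hu Hu0 (Il & Ir & HIl & HIr & Hlim) Hc Heta0 H.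
  destruct (Rle_dec (Rabs (p - S)) B) as [|Hn]; [assumption|exfalso].
  set (d := (Rabs (p - S) - B) / 2). assert (Hd : 0 < d) by (unfold d; lra).
  destruct (Rpower_small_near_zero c (1 - alpha) (d / 2)) as (e1 & He1 & H1); try lra.
  specialize (Hlim (ball p (mkposreal d Hd)) (locally_ball p (mkposreal d Hd))).
  destruct Hlim as [[e2 He2] H2].
  set (eta := Rmin (Rmin (Rmin x (X - x)) eta0) (Rmin e1 (e2 / 2))).
  assert (Heta : 0 < eta) by (unfold eta; repeat apply Rmin_glb_lt; lra).
  assert (Hle : eta <= x /\ eta <= X - x /\ eta <= eta0 /\ eta <= e1 /\ eta < e2).
  { unfold eta.
    generalize (Rmin_l (Rmin (Rmin x (X - x)) eta0) (Rmin e1 (e2 / 2)))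
      (Rmin_r (Rmin (Rmin x (X - x)) eta0) (Rmin e1 (e2 / 2)))
      (Rmin_l (Rmin x (X - x)) eta0) (Rmin_r (Rmin x (X - x)) eta0)
      (Rmin_l x (X - x)) (Rmin_r x (X - x)) (Rmin_l e1 (e2 / 2)) (Rmin_r e1 (e2 / 2)).
    intros. repeat split; lra. }
  assert (Hb : ball p d (Il eta + Ir eta)).
  { apply (H2 eta); [|exact Heta].
    change (Rabs (eta - 0) < e2). rewrite Rminus_0_r, Rabs_pos_eq; lra. }
  change (Rabs (Il eta + Ir eta - p) < d) in Hb.
  assert (El : Il eta = trunc_side alpha x (u x) (fun t => u (x - t)) eta).
  { rewrite <- (is_RInt_gen_unique _ _ (HIl eta Heta)).
    apply (is_RInt_gen_unique (Fa := Rbar_locally m_infty) (Fb := at_point (x - eta))).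
    apply trunc_side_left; try lra; auto. }
  assert (Er : Ir eta = trunc_side alpha (X - x) (u x) (fun t => u (x + t)) eta).
  { rewrite <- (is_RInt_gen_unique _ _ (HIr eta Heta)).
    apply (is_RInt_gen_unique (Fa := at_point (x + eta)) (Fb := Rbar_locally p_infty)).
    apply trunc_side_right; try lra; auto. }
  specialize (H eta ltac:(lra) ltac:(lra) ltac:(lra)).
  specialize (H1 eta ltac:(lra)).
  rewrite <- El, <- Er in H.
  assert (Ht := Rabs_triang (Il eta + Ir eta - S) (p - (Il eta + Ir eta))).
  replace (Il eta + Ir eta - S + (p - (Il eta + Ir eta))) with (p - S) in Ht by ring.
  rewrite (Rabs_minus_sym p (Il eta + Ir eta)) in Ht. unfold d in *. lra.
Qed.

(** The truncation error of piecewise linear collocation with the exact kernel is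
    the interpolation error [u - P] integrated against the kernel.  It suffices to
    bound the integral over [t >= eta] independently of [eta]. *)
Lemma truncation_error alpha x X rho1 rho2 v1 v2 u P p B1 B2 :
  0 < alpha < 1 -> 0 < rho1 <= x -> 0 < rho2 <= X - x ->
  (forall t, continuous u t) -> (forall t, continuous P t) ->
  (forall t, t <= 0 \/ X <= t -> u t = 0) ->
  (forall t, 0 <= t <= rho1 -> P (x - t) = u x - (u x - v1) / rho1 * t) ->
  (forall t, 0 <= t <= rho2 -> P (x + t) = u x - (u x - v2) / rho2 * t) ->
  is_PV_RInt (fun y => (u x - u y) / Rpower (Rabs (x - y)) (1 + alpha)) x p ->
  (forall eta, 0 < eta <= rho1 ->
     Rabs (RInt (fun t => Rpower t (- 1 - alpha) * (u (x - t) - P (x - t))) eta x) <= B1) ->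
  (forall eta, 0 < eta <= rho2 ->
     Rabs (RInt (fun t => Rpower t (- 1 - alpha) * (u (x + t) - P (x + t))) eta (X - x)) <= B2) ->
  Rabs (p - (side alpha rho1 x (u x) v1 (fun t => Rpower t (- 1 - alpha)) (fun t => P (x - t))
           + side alpha rho2 (X - x) (u x) v2 (fun t => Rpower t (- 1 - alpha)) (fun t => P (x + t))))
  <= B1 + B2.
Proof.
  intros Ha H1 H2 Hu HP Hu0 HP1 HP2 HPV HB1 HB2.
  set (c1 := (u x - v1) / rho1 / (1 - alpha)). set (c2 := (u x - v2) / rho2 / (1 - alpha)).
  apply (PV_close alpha x X u p _ _ (Rabs c1 + Rabs c2) (Rmin rho1 rho2)); try lra; auto.
  { generalize (Rabs_pos c1) (Rabs_pos c2); lra. }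
  { apply Rmin_glb_lt; lra. }
  intros eta He1 He2 He3.
  assert (He4 : eta <= rho1) by (generalize (Rmin_l rho1 rho2); lra).
  assert (He5 : eta <= rho2) by (generalize (Rmin_r rho1 rho2); lra).
  match goal with |- Rabs (?a + ?b - (?c + ?d)) <= _ =>
    replace (a + b - (c + d)) with ((a - c) + (b - d)) by ring end.
  rewrite (trunc_side_eq alpha rho1 x _ _ _ _ eta), (trunc_side_eq alpha rho2 (X - x) _ _ _ _ eta);
    try lra; auto; try (apply continuous_shift_minus || apply continuous_shift_plus); auto.
  specialize (HB1 eta ltac:(lra)). specialize (HB2 eta ltac:(lra)).
  set (I1 := RInt _ eta x) in *. set (I2 := RInt _ eta (X - x)) in *.
  set (r := Rpower eta (1 - alpha)).
  replace (- I1 - (u x - v1) / rho1 * r / (1 - alpha) + (- I2 - (u x - v2) / rho2 * r / (1 - alpha)))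
    with ((- I1 + - I2) + (- (c1 * r) + - (c2 * r))) by (unfold c1, c2; field; repeat split; lra).
  assert (Hr : 0 < r) by apply Rpower_pos.
  eapply Rle_trans; [apply Rabs_triang|].
  apply Rplus_le_compat.
  - eapply Rle_trans; [apply Rabs_triang|]. rewrite !Rabs_Ropp. lra.
  - eapply Rle_trans; [apply Rabs_triang|]. rewrite !Rabs_Ropp, !Rabs_mult, (Rabs_pos_eq r) by lra.
    lra.
Qed.

(** * Positivity of the normalizing constant *)

Lemma nonneg_integral_to_zero (f : R -> R) M :
  (forall t, 0 < t -> continuous f t) -> (forall t, 0 < t -> 0 <= f t) ->
  (forall a, 0 < a <= 1 -> RInt f a 1 <= M) ->
  exists l, RInt f (1 / 2) 1 <= l /\ is_RInt_gen f (at_right 0) (at_point 1) l.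
Proof.
  intros Hc Hp HM.
  destruct (completeness (fun v => exists a, 0 < a <= 1 /\ v = RInt f a 1)) as [l [Hub Hlub]].
  - exists M. intros v (a & Ha & ->). apply HM, Ha.
  - exists (RInt f 1 1), 1. split; [lra | reflexivity].
  - exists l. split; [apply Hub; exists (1 / 2); split; [lra | reflexivity]|].
    intros P [[e He] HP].
    assert (exists a, 0 < a <= 1 /\ l - e < RInt f a 1) as (a & Ha & Hla).
    { destruct (classic (exists a, 0 < a <= 1 /\ l - e < RInt f a 1)) as [|Hn]; [assumption|].
      exfalso. assert (l <= l - e); [|lra]. apply Hlub.
      intros v (a & Ha & ->). apply Rnot_lt_le. intros Hlt. apply Hn. exists a. auto. }
    apply (Filter_prod _ _ _ (fun y => 0 < y <= a) (fun y => y = 1)); [|reflexivity|].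
    + exists (mkposreal a (proj1 Ha)). intros y Hy Hy0.
      change (Rabs (y - 0) < a) in Hy. rewrite Rminus_0_r, Rabs_pos_eq in Hy; lra.
    + intros x y Hx ->. exists (RInt f x 1). split.
      * apply (RInt_correct f), ex_RInt_cont; [simpl; lra|]. intros; apply Hc; simpl in *; lra.
      * apply HP. change (Rabs (RInt f x 1 - l) < e).
        assert (RInt f x 1 <= l) by (apply Hub; exists x; split; [lra | reflexivity]).
        assert (RInt f a 1 <= RInt f x 1).
        { apply RInt_nonneg_sub; try lra; intros; (apply Hc || apply Hp); lra. }
        apply Rabs_def1; lra.
Qed.

Lemma nonneg_integral_to_infty (f : R -> R) M :
  (forall t, 1 <= t -> continuous f t) -> (forall t, 1 <= t -> 0 <= f t) ->
  (forall b, 1 <= b -> RInt f 1 b <= M) ->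
  exists l, 0 <= l /\ is_RInt_gen f (at_point 1) (Rbar_locally p_infty) l.
Proof.
  intros Hc Hp HM.
  destruct (completeness (fun v => exists b, 1 <= b /\ v = RInt f 1 b)) as [l [Hub Hlub]].
  - exists M. intros v (b & Hb & ->). apply HM, Hb.
  - exists (RInt f 1 1), 1. split; [lra | reflexivity].
  - exists l. split.
    { apply Hub. exists 1. split; [lra|]. symmetry. apply (RInt_point 1 f). }
    intros P [[e He] HP].
    assert (exists b, 1 <= b /\ l - e < RInt f 1 b) as (b & Hb & Hlb).
    { destruct (classic (exists b, 1 <= b /\ l - e < RInt f 1 b)) as [|Hn]; [assumption|].
      exfalso. assert (l <= l - e); [|lra]. apply Hlub.
      intros v (b & Hb & ->). apply Rnot_lt_le. intros Hlt. apply Hn. exists b. auto. }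
    apply (Filter_prod _ _ _ (fun y => y = 1) (fun y => b < y)); [reflexivity| |].
    + exists b. auto.
    + intros x y -> Hy. exists (RInt f 1 y). split.
      * apply (RInt_correct f), ex_RInt_cont; [simpl; lra|]. intros; apply Hc; simpl in *; lra.
      * apply HP. change (Rabs (RInt f 1 y - l) < e).
        assert (RInt f 1 y <= l) by (apply Hub; exists y; split; [lra | reflexivity]).
        assert (RInt f 1 b <= RInt f 1 y).
        { apply RInt_nonneg_sub; try lra; intros; (apply Hc || apply Hp); lra. }
        apply Rabs_def1; lra.
Qed.

Lemma continuous_exp_scal c t : continuous (fun t => exp (c * t)) t.
Proof.
  apply (continuous_comp (fun t => c * t) exp); [|apply continuous_exp].
  apply continuous_Rmult; [apply continuous_const | apply continuous_id].
Qed.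

(** [RInt_gen] is meaningful only for a convergent integral.  Near zero the
    integrand is dominated by [t^(z-1)], with integral [1/z] over [(0, 1)];
    for [t >= 1] it is dominated by [exp (-t)], as [z <= 1]. *)
Lemma Gamma_fun_pos z : 0 < z <= 1 -> 0 < Gamma_fun z.
Proof.
  intros Hz.
  set (g := fun t => Rpower t (z - 1) * exp (- t)).
  assert (Hc : forall t, 0 < t -> continuous g t).
  { intros t Ht. apply (continuous_ext (fun t => Rpower t (z - 1) * exp (-1 * t))).
    { intros y. unfold g. do 2 f_equal. ring. }
    apply continuous_Rmult; [apply continuous_Rpower, Ht | apply continuous_exp_scal]. }
  assert (Hp : forall t, 0 < g t).
  { intros t. apply Rmult_lt_0_compat; [apply Rpower_pos | apply exp_pos]. }
  destruct (nonneg_integral_to_zero g (/ z)) as (l1 & H1 & I1); auto.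
  { intros; left; apply Hp. }
  { intros a Ha. apply Rle_trans with (RInt (fun t => Rpower t (z - 1)) a 1).
    - apply RInt_le; [lra | | |].
      + apply ex_RInt_cont; [lra|]. intros; apply Hc; lra.
      + eexists; apply is_RInt_Rpower; lra.
      + intros t Ht. unfold g. rewrite <- (Rmult_1_r (Rpower t (z - 1))) at 2.
        apply Rmult_le_compat_l; [left; apply Rpower_pos|].
        rewrite <- exp_0. left; apply exp_increasing; lra.
    - rewrite RInt_Rpower by lra. unfold Rdiv. rewrite <- (Rmult_1_l (/ z)) at 2.
      apply Rmult_le_compat_r; [left; apply Rinv_0_lt_compat; lra|].
      unfold Rpower at 1. rewrite ln_1, Rmult_0_r, exp_0.
      generalize (Rpower_pos a z); lra. }
  destruct (nonneg_integral_to_infty g 1) as (l2 & H2 & I2).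
  { intros; apply Hc; lra. }
  { intros; left; apply Hp. }
  { intros b Hb.
    apply Rle_trans with (RInt (fun t => exp (-1 * t)) 1 b).
    - apply RInt_le; [lra | | |].
      + apply ex_RInt_cont; [lra|]. intros; apply Hc; lra.
      + apply ex_RInt_cont; [lra|]. intros; apply continuous_exp_scal.
      + intros t Ht. unfold g. replace (-1 * t) with (- t) by ring.
        rewrite <- (Rmult_1_l (exp (- t))) at 2.
        apply Rmult_le_compat_r; [left; apply exp_pos|].
        apply Rle_trans with (Rpower 1 (z - 1)); [apply Rpower_anti; lra|].
        unfold Rpower. rewrite ln_1, Rmult_0_r, exp_0. lra.
    - assert (HI : is_RInt (fun t => exp (-1 * t)) 1 b (minus (- exp (-1 * b)) (- exp (-1 * 1)))).
      { apply (is_RInt_derive (fun t => - exp (-1 * t))).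
        - intros t _. auto_derive; [trivial | ring].
        - intros; apply continuous_exp_scal. }
      rewrite (is_RInt_unique _ _ _ _ HI).
      change (- exp (-1 * b) + - - exp (-1 * 1) <= 1).
      assert (exp (-1 * 1) < exp 0) by (apply exp_increasing; lra).
      rewrite exp_0 in H. generalize (exp_pos (-1 * b)). lra. }
  unfold Gamma_fun. fold g.
  rewrite (is_RInt_gen_unique (Fa := at_right 0) (Fb := Rbar_locally p_infty) g (plus l1 l2)).
  - assert (0 < RInt g (1 / 2) 1).
    { apply RInt_gt_0; [lra | auto|]. intros; apply Hc; lra. }
    change (0 < l1 + l2). lra.
  - apply (is_RInt_gen_Chasles (Fa := at_right 0) (Fc := Rbar_locally p_infty) g 1); assumption.
Qed.

(** Both the differential equation and the scheme carry this factor; it has to be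
    non-zero for them to be compared. *)
Lemma C_frac_pos alpha : 0 < alpha < 1 -> 0 < C_frac alpha.
Proof.
  intros Ha. unfold C_frac.
  assert (H1 := Gamma_fun_pos ((1 + alpha) / 2) ltac:(lra)).
  assert (H2 := Gamma_fun_pos (1 - alpha / 2) ltac:(lra)).
  assert (H3 := Rpower_pos 2 (alpha - 1)).
  assert (H4 : 0 < sqrt PI) by (apply sqrt_lt_R0, PI_RGT_0).
  apply Rdiv_lt_0_compat; repeat apply Rmult_lt_0_compat; lra.
Qed.

(** * The graded grid *)

Lemma rpow0_pos_eq x p : 0 < x -> rpow0 x p = Rpower x p.
Proof. intros H. unfold rpow0. destruct (Rlt_dec 0 x); lra. Qed.

Lemma rpow0_0 p : rpow0 0 p = 0.
Proof. unfold rpow0. destruct (Rlt_dec 0 0); lra. Qed.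

Lemma rpow0_1 p : rpow0 1 p = 1.
Proof. rewrite rpow0_pos_eq by lra. unfold Rpower. rewrite ln_1, Rmult_0_r. apply exp_0. Qed.

(** Lower bound: [r^kappa <= r * s^(kappa-1)].  Upper bound: the mean value
    theorem, the derivative being increasing. *)
Lemma rpow0_increment kappa r s :
  1 <= kappa -> 0 <= r < s ->
  (s - r) * Rpower s (kappa - 1) <= rpow0 s kappa - rpow0 r kappa
    <= kappa * (s - r) * Rpower s (kappa - 1).
Proof.
  intros Hk Hrs. rewrite (rpow0_pos_eq s) by lra.
  assert (Hsplit : forall z, 0 < z -> Rpower z kappa = z * Rpower z (kappa - 1)).
  { intros z Hz. replace kappa with (1 + (kappa - 1)) at 1 by ring.
    rewrite Rpower_plus, Rpower_1 by lra. reflexivity. }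
  assert (P := Rpower_pos s (kappa - 1)).
  destruct (Req_dec r 0) as [-> | Hr].
  - rewrite rpow0_0, Hsplit by lra.
    assert (1 * (s * Rpower s (kappa - 1)) <= kappa * (s * Rpower s (kappa - 1))).
    { apply Rmult_le_compat_r; [|lra]. left; apply Rmult_lt_0_compat; lra. }
    split; lra.
  - rewrite (rpow0_pos_eq r) by lra. split.
    + rewrite !Hsplit by lra.
      assert (Rpower r (kappa - 1) <= Rpower s (kappa - 1)) by (apply Rle_Rpower_l; lra).
      assert (r * Rpower r (kappa - 1) <= r * Rpower s (kappa - 1)) by (apply Rmult_le_compat_l; lra).
      lra.
    + destruct (MVT_gen (fun t => Rpower t kappa) r s (fun t => kappa * Rpower t (kappa - 1)))
        as (c & Hc & Heq).
      * intros x Hx. rewrite Rmin_left in Hx by lra. apply is_derive_Rpower; lra.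
      * intros x Hx. rewrite Rmin_left in Hx by lra.
        apply continuity_pt_filterlim, (continuous_Rpower kappa x); lra.
      * rewrite Rmin_left, Rmax_right in Hc by lra. rewrite Heq.
        assert (Rpower c (kappa - 1) <= Rpower s (kappa - 1)) by (apply Rle_Rpower_l; lra).
        replace (kappa * (s - r) * Rpower s (kappa - 1))
          with (kappa * Rpower s (kappa - 1) * (s - r)) by ring.
        apply Rmult_le_compat_r; [lra|]. apply Rmult_le_compat_l; lra.
Qed.

Lemma INR_double M : INR (2 * M) = 2 * INR M.
Proof. rewrite mult_INR. simpl. lra. Qed.

Lemma half_double M : (2 * M / 2)%nat = M.
Proof. rewrite Nat.mul_comm. apply Nat.div_mul. lia. Qed.

Lemma grid_left L kappa M i :
  (1 <= M)%nat -> (i <= M)%nat -> grid L kappa (2 * M) i = L * rpow0 (INR i / INR M) kappa.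
Proof.
  intros HM Hi. unfold grid. rewrite half_double.
  rewrite (proj2 (Nat.leb_le i M) Hi). do 2 f_equal.
  assert (0 < INR M) by (apply lt_0_INR; lia). rewrite INR_double. field. lra.
Qed.

Lemma grid_mid L kappa M : (1 <= M)%nat -> grid L kappa (2 * M) M = L.
Proof.
  intros HM. rewrite grid_left by lia.
  assert (0 < INR M) by (apply lt_0_INR; lia).
  replace (INR M / INR M) with 1 by (field; lra). rewrite rpow0_1. ring.
Qed.

(** Estimates near the left end point are transported to the right one by this
    symmetry. *)
Lemma grid_mirror L kappa M i :
  (1 <= M)%nat -> (i <= 2 * M)%nat ->
  grid L kappa (2 * M) (2 * M - i) = 2 * L - grid L kappa (2 * M) i.
Proof.
  intros HM.
  assert (0 < INR M) by (apply lt_0_INR; lia).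
  assert (Hl : forall k, (k < M)%nat ->
     grid L kappa (2 * M) (2 * M - k) = 2 * L - grid L kappa (2 * M) k).
  { intros k Hk. rewrite (grid_left L kappa M k) by lia. unfold grid. rewrite half_double.
    rewrite (proj2 (Nat.leb_gt (2 * M - k) M)) by lia. do 3 f_equal.
    rewrite minus_INR, INR_double by lia. field. lra. }
  intros Hi. destruct (Nat.lt_total i M) as [Hlt | [-> | Hgt]].
  - apply Hl, Hlt.
  - replace (2 * M - M)%nat with M by lia. rewrite grid_mid by lia. ring.
  - assert (E := Hl (2 * M - i)%nat ltac:(lia)).
    replace (2 * M - (2 * M - i))%nat with i in E by lia. lra.
Qed.

Lemma grid_first L kappa M : (1 <= M)%nat -> grid L kappa (2 * M) 0 = 0.
Proof.
  intros HM. rewrite grid_left by lia. simpl. unfold Rdiv. rewrite Rmult_0_l, rpow0_0. ring.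
Qed.

Lemma grid_last L kappa M : (1 <= M)%nat -> grid L kappa (2 * M) (2 * M) = 2 * L.
Proof.
  intros HM. replace (2 * M)%nat with (2 * M - 0)%nat at 2 by lia.
  rewrite grid_mirror, grid_first by lia. ring.
Qed.

Lemma mesh_mirror L kappa M j :
  (1 <= M)%nat -> (1 <= j <= 2 * M)%nat ->
  mesh L kappa (2 * M) (2 * M + 1 - j) = mesh L kappa (2 * M) j.
Proof.
  intros HM Hj. unfold mesh.
  replace (2 * M + 1 - j)%nat with (2 * M - (j - 1))%nat by lia.
  replace (2 * M - (j - 1) - 1)%nat with (2 * M - j)%nat by lia.
  rewrite !grid_mirror by lia. ring.
Qed.

Lemma mesh_left_bounds L kappa M j :
  0 < L -> 1 <= kappa -> (1 <= j <= M)%nat ->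
  L * / INR M * Rpower (INR j / INR M) (kappa - 1) <= mesh L kappa (2 * M) j
    <= kappa * L * / INR M * Rpower (INR j / INR M) (kappa - 1).
Proof.
  intros HL Hk Hj. assert (0 < INR M) by (apply lt_0_INR; lia).
  assert (Hi : 0 < / INR M) by (apply Rinv_0_lt_compat; lra).
  unfold mesh. rewrite !grid_left by lia.
  assert (Hs : INR j / INR M - INR (j - 1) / INR M = / INR M).
  { rewrite minus_INR by lia. simpl. field. lra. }
  assert (0 <= INR (j - 1) / INR M) by (apply Rmult_le_pos; [apply pos_INR | lra]).
  destruct (rpow0_increment kappa (INR (j - 1) / INR M) (INR j / INR M)) as [H1 H2]; try lra.
  rewrite Hs in H1, H2. split; rewrite <- Rmult_minus_distr_l.
  - rewrite Rmult_assoc. apply Rmult_le_compat_l; lra.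
  - replace (kappa * L * / INR M * Rpower (INR j / INR M) (kappa - 1))
      with (L * (kappa * / INR M * Rpower (INR j / INR M) (kappa - 1))) by ring.
    apply Rmult_le_compat_l; lra.
Qed.

Lemma mesh_pos L kappa M j :
  0 < L -> 1 <= kappa -> (1 <= M)%nat -> (1 <= j <= 2 * M)%nat ->
  0 < mesh L kappa (2 * M) j.
Proof.
  intros HL Hk HM.
  assert (Hl : forall k, (1 <= k <= M)%nat -> 0 < mesh L kappa (2 * M) k).
  { intros k Hkk. eapply Rlt_le_trans; [|apply mesh_left_bounds; assumption].
    assert (0 < INR M) by (apply lt_0_INR; lia).
    repeat apply Rmult_lt_0_compat; try apply Rinv_0_lt_compat; try apply Rpower_pos; lra. }
  intros Hj. destruct (le_lt_dec j M) as [Hle | Hlt].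
  - apply Hl; lia.
  - rewrite <- mesh_mirror by lia. apply Hl; lia.
Qed.

Lemma grid_lt L kappa M i j :
  0 < L -> 1 <= kappa -> (1 <= M)%nat -> (i < j <= 2 * M)%nat ->
  grid L kappa (2 * M) i < grid L kappa (2 * M) j.
Proof.
  intros HL Hk HM [Hij Hj]. induction Hij as [|j Hij IH].
  - assert (H := mesh_pos L kappa M (S i) HL Hk HM ltac:(lia)).
    unfold mesh in H. replace (S i - 1)%nat with i in H by lia. lra.
  - assert (H := mesh_pos L kappa M (S j) HL Hk HM ltac:(lia)).
    unfold mesh in H. replace (S j - 1)%nat with j in H by lia.
    specialize (IH ltac:(lia)). lra.
Qed.

Lemma grid_le L kappa M i j :
  0 < L -> 1 <= kappa -> (1 <= M)%nat -> (i <= j <= 2 * M)%nat ->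
  grid L kappa (2 * M) i <= grid L kappa (2 * M) j.
Proof.
  intros HL Hk HM Hij. destruct (Nat.eq_dec i j) as [-> | Hne]; [lra|].
  left. apply grid_lt; auto; lia.
Qed.

Lemma grid_cell L kappa M y :
  0 < L -> 1 <= kappa -> (1 <= M)%nat -> 0 <= y <= 2 * L ->
  exists j, (1 <= j <= 2 * M)%nat /\
    grid L kappa (2 * M) (j - 1) <= y <= grid L kappa (2 * M) j.
Proof.
  intros HL Hk HM Hy.
  assert (H : forall k, (k <= 2 * M)%nat -> y <= grid L kappa (2 * M) k ->
    (1 <= k)%nat -> exists j, (1 <= j <= 2 * M)%nat /\
    grid L kappa (2 * M) (j - 1) <= y <= grid L kappa (2 * M) j).
  { induction k as [|k IH]; [lia|]. intros Hk2 Hyk _.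
    destruct (Rle_dec (grid L kappa (2 * M) k) y) as [Hle | Hgt].
    - exists (S k). replace (S k - 1)%nat with k by lia. split; [lia | lra].
    - apply IH; [lia | lra |].
      destruct k; [|lia]. rewrite grid_first in Hgt by lia. lra. }
  apply (H (2 * M)%nat); [lia | rewrite grid_last by lia; lra | lia].
Qed.

Definition bdist (L y : R) : R := Rmin y (2 * L - y).

Lemma bdist_mirror L y : bdist L (2 * L - y) = bdist L y.
Proof. unfold bdist. replace (2 * L - (2 * L - y)) with y by ring. apply Rmin_comm. Qed.

Lemma bdist_left L y : y <= L -> bdist L y = y.
Proof. intros H. unfold bdist. apply Rmin_left. lra. Qed.

Lemma bdist_right L y : L <= y -> bdist L y = 2 * L - y.
Proof. intros H. unfold bdist. apply Rmin_right. lra. Qed.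

Lemma bdist_pos L t : 0 < t < 2 * L -> 0 < bdist L t <= L.
Proof. intros H. unfold bdist, Rmin. destruct (Rle_dec t (2 * L - t)); lra. Qed.

(** * Piecewise linear interpolation *)

Lemma sum_zero (f : nat -> R) m : (forall k, (1 <= k <= m)%nat -> f k = 0) -> sum_n_m f 1 m = 0.
Proof.
  intros H. rewrite (sum_n_m_ext_loc f (fun _ => 0)) by exact H.
  apply (sum_n_m_const_zero (G := R_AbelianMonoid) 1 m).
Qed.

Lemma sum_last (f : nat -> R) m : sum_n_m f 1 (S m) = sum_n_m f 1 m + f (S m).
Proof. apply (sum_n_Sm f 1 m). lia. Qed.

Lemma sum_single (v : nat -> R) a m c :
  @eq R (sum_n_m (fun k => v k * (if (k =? a)%nat then c else 0)) 1 m)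
    (if ((1 <=? a) && (a <=? m))%nat%bool then v a * c else 0).
Proof.
  induction m as [|m IH].
  - rewrite sum_zero by lia. destruct a; reflexivity.
  - rewrite sum_last, IH.
    destruct (Nat.eqb_spec (S m) a); destruct (Nat.leb_spec 1 a);
      destruct (Nat.leb_spec a m); destruct (Nat.leb_spec a (S m)); simpl; subst; try lia; lra.
Qed.

(** On a cell only the hat functions of its two end points are non-zero, and they
    are the two barycentric coordinates. *)
Lemma hat_cell L kappa M k j y :
  0 < L -> 1 <= kappa -> (1 <= M)%nat -> (1 <= k <= 2 * M - 1)%nat -> (1 <= j <= 2 * M)%nat ->
  grid L kappa (2 * M) (j - 1) <= y <= grid L kappa (2 * M) j ->
  hat L kappa (2 * M) k y =
    (if (k =? j - 1)%nat then 1 - (y - grid L kappa (2 * M) (j - 1)) / mesh L kappa (2 * M) j else 0)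
    + (if (k =? j)%nat then (y - grid L kappa (2 * M) (j - 1)) / mesh L kappa (2 * M) j else 0).
Proof.
  intros HL Hk HM Hkk Hj Hy.
  assert (Hmono := fun a b => grid_lt L kappa M a b HL Hk HM).
  assert (Hmono' := fun a b => grid_le L kappa M a b HL Hk HM).
  unfold hat, mesh. set (x := grid L kappa (2 * M)) in *.
  assert (Hh := Hmono (j - 1)%nat j ltac:(lia)).
  assert (H1 := Hmono (k - 1)%nat k ltac:(lia)). assert (H2 := Hmono k (k + 1)%nat ltac:(lia)).
  destruct (Nat.eqb_spec k (j - 1)) as [E1 | E1]; destruct (Nat.eqb_spec k j) as [E2 | E2]; try lia.
  - subst k. replace (j - 1 + 1)%nat with j in * by lia.
    destruct (Rle_dec y (x (j - 1 - 1)%nat)); [lra|].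
    destruct (Rle_dec y (x (j - 1)%nat)).
    + replace y with (x (j - 1)%nat) by lra. field; split; lra.
    + destruct (Rle_dec y (x j)); [|lra]. field; lra.
  - subst k. destruct (Rle_dec y (x (j - 1)%nat)).
    + replace y with (x (j - 1)%nat) by lra. field; lra.
    + destruct (Rle_dec y (x j)); [|lra]. field; lra.
  - rewrite Rplus_0_l.
    assert (Hc : (k < j - 1 \/ j < k)%nat) by lia. destruct Hc as [Hc | Hc].
    + assert (H3 := Hmono' (k + 1)%nat (j - 1)%nat ltac:(lia)).
      destruct (Rle_dec y (x (k - 1)%nat)); [lra|].
      destruct (Rle_dec y (x k)); [lra|].
      destruct (Rle_dec y (x (k + 1)%nat)); [|lra].
      replace y with (x (k + 1)%nat) by lra. field; lra.
    + assert (H3 := Hmono' j (k - 1)%nat ltac:(lia)).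
      destruct (Rle_dec y (x (k - 1)%nat)); [lra|]. lra.
Qed.

(** In the first and in the last cell one of the two end points carries no hat
    function; there [v 0 = 0] or [v N = 0] makes the formula right. *)
Lemma interp_cell L kappa M v j y :
  0 < L -> 1 <= kappa -> (1 <= M)%nat -> (1 <= j <= 2 * M)%nat ->
  v 0%nat = 0 -> v (2 * M)%nat = 0 ->
  grid L kappa (2 * M) (j - 1) <= y <= grid L kappa (2 * M) j ->
  interp L kappa (2 * M) v y =
    v (j - 1)%nat + (v j - v (j - 1)%nat) / mesh L kappa (2 * M) j
                    * (y - grid L kappa (2 * M) (j - 1)).
Proof.
  intros HL Hk HM Hj Hv0 HvN Hy. unfold interp.
  set (r := (y - grid L kappa (2 * M) (j - 1)) / mesh L kappa (2 * M) j).
  rewrite (sum_n_m_ext_loc _ (fun k => plus (v k * (if (k =? j - 1)%nat then 1 - r else 0))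
       (v k * (if (k =? j)%nat then r else 0)))).
  - rewrite sum_n_m_plus, !sum_single.
    assert (E1 : (if ((1 <=? j - 1) && (j - 1 <=? 2 * M - 1))%nat%bool
                  then v (j - 1)%nat * (1 - r) else 0) = v (j - 1)%nat * (1 - r)).
    { destruct (Nat.leb_spec 1 (j - 1)); destruct (Nat.leb_spec (j - 1) (2 * M - 1));
        simpl; try lia; try reflexivity.
      - replace (j - 1)%nat with 0%nat by lia. rewrite Hv0; ring. }
    assert (E2 : (if ((1 <=? j) && (j <=? 2 * M - 1))%nat%bool
                  then v j * r else 0) = v j * r).
    { destruct (Nat.leb_spec 1 j); destruct (Nat.leb_spec j (2 * M - 1));
        simpl; try lia; try reflexivity.
      - replace j with (2 * M)%nat by lia. rewrite HvN; ring. }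
    rewrite E1, E2.
    change (v (j - 1)%nat * (1 - r) + v j * r = v (j - 1)%nat + (v j - v (j - 1)%nat) / mesh L kappa (2 * M) j
                    * (y - grid L kappa (2 * M) (j - 1))).
    unfold r. field. assert (H := mesh_pos L kappa M j HL Hk HM Hj). lra.
  - intros k Hkk. rewrite (hat_cell L kappa M k j) by (auto; lia). fold r.
    match goal with |- ?a = plus ?b ?c => change (a = b + c) end. ring.
Qed.

Lemma interp_outside L kappa M v y :
  0 < L -> 1 <= kappa -> (1 <= M)%nat -> y <= 0 \/ 2 * L <= y ->
  interp L kappa (2 * M) v y = 0.
Proof.
  intros HL Hk HM Hy. unfold interp. apply sum_zero. intros k Hkk.
  assert (H1 := grid_lt L kappa M (k - 1) k HL Hk HM ltac:(lia)).
  assert (H2 := grid_lt L kappa M k (k + 1) HL Hk HM ltac:(lia)).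
  assert (H3 := grid_le L kappa M (k + 1) (2 * M) HL Hk HM ltac:(lia)).
  assert (H4 := grid_le L kappa M 0 (k - 1) HL Hk HM ltac:(lia)).
  rewrite grid_last in H3 by lia. rewrite grid_first in H4 by lia.
  unfold hat. set (x := grid L kappa (2 * M)) in *.
  destruct (Rle_dec y (x (k - 1)%nat)); [ring|].
  destruct (Rle_dec y (x k)); [lra|].
  destruct (Rle_dec y (x (k + 1)%nat)); [|ring].
  replace y with (x (k + 1)%nat) by lra. field; lra.
Qed.

Lemma continuous_Rmin_fun (f g : R -> R) t :
  continuous f t -> continuous g t -> continuous (fun t => Rmin (f t) (g t)) t.
Proof.
  intros Hf Hg.
  apply (continuous_ext (fun t => (f t + g t - Rabs (f t - g t)) * / 2)).
  { intros y. unfold Rmin. destruct (Rle_dec (f y) (g y)).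
    - rewrite Rabs_left1 by lra. lra.
    - rewrite Rabs_right by lra. lra. }
  apply continuous_Rmult; [|apply continuous_const].
  apply continuous_Rminus; [apply continuous_Rplus; auto|].
  apply continuous_Rabs_fun, continuous_Rminus; auto.
Qed.

(** [hat] is the positive part of the minimum of its two affine pieces. *)
Lemma hat_continuous L kappa M k t :
  0 < L -> 1 <= kappa -> (1 <= M)%nat -> (1 <= k <= 2 * M - 1)%nat ->
  continuous (hat L kappa (2 * M) k) t.
Proof.
  intros HL Hk HM Hkk.
  assert (H1 := grid_lt L kappa M (k - 1) k HL Hk HM ltac:(lia)).
  assert (H2 := grid_lt L kappa M k (k + 1) HL Hk HM ltac:(lia)).
  unfold hat. set (x := grid L kappa (2 * M)) in *.
  set (a := x (k - 1)%nat) in *. set (b := x k) in *. set (c := x (k + 1)%nat) in *.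
  apply (continuous_ext (fun y => - Rmin (- 0) (- Rmin ((y - a) * / (b - a)) ((c - y) * / (c - b))))).
  { intros y. match goal with |- ?a = ?b => change (@eq R a b) end.
    assert (Hab : 0 < / (b - a)) by (apply Rinv_0_lt_compat; lra).
    assert (Hbc : 0 < / (c - b)) by (apply Rinv_0_lt_compat; lra).
    assert (E1 : (b - a) * / (b - a) = 1) by (field; lra).
    assert (E2 : (c - b) * / (c - b) = 1) by (field; lra).
    unfold Rdiv.
    destruct (Rle_dec y a); [|destruct (Rle_dec y b); [|destruct (Rle_dec y c)]].
    - rewrite (Rmin_left ((y - a) * / (b - a))) by nra. rewrite Rmin_left by nra. ring.
    - rewrite (Rmin_left ((y - a) * / (b - a))) by nra. rewrite Rmin_right by nra. ring.
    - rewrite (Rmin_right ((y - a) * / (b - a))) by nra. rewrite Rmin_right by nra. ring.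
    - rewrite (Rmin_right ((y - a) * / (b - a))) by nra. rewrite Rmin_left by nra. ring. }
  assert (Hneg : forall (f : R -> R), continuous f t -> continuous (fun y => - f y) t).
  { intros f Hf. apply (continuous_opp f t Hf). }
  apply Hneg, continuous_Rmin_fun; [apply continuous_const|].
  apply Hneg, continuous_Rmin_fun; apply continuous_Rmult; try apply continuous_const;
    apply continuous_Rminus; try apply continuous_const; apply continuous_id.
Qed.

Lemma continuous_sum (f : nat -> R -> R) m t :
  (forall k, (1 <= k <= m)%nat -> continuous (f k) t) ->
  continuous (fun y => sum_n_m (fun k => f k y) 1 m) t.
Proof.
  induction m as [|m IH]; intros Hf.
  - apply (continuous_ext (fun _ => 0)); [|apply continuous_const].
    intros y. symmetry. apply sum_zero. lia.
  - apply (continuous_ext (fun y => sum_n_m (fun k => f k y) 1 m + f (S m) y)).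
    + intros y. symmetry. apply (sum_last (fun k => f k y)).
    + apply continuous_Rplus; [apply IH; intros; apply Hf; lia | apply Hf; lia].
Qed.

Lemma interp_continuous L kappa M v t :
  0 < L -> 1 <= kappa -> (1 <= M)%nat -> continuous (interp L kappa (2 * M) v) t.
Proof.
  intros HL Hk HM. unfold interp. apply (continuous_sum (fun k y => v k * hat L kappa (2 * M) k y)).
  intros k Hkk. apply continuous_Rmult; [apply continuous_const | apply hat_continuous; assumption].
Qed.

Lemma interp_bounded L kappa M v m y :
  0 < L -> 1 <= kappa -> (1 <= M)%nat -> v 0%nat = 0 -> v (2 * M)%nat = 0 ->
  (forall j, (j <= 2 * M)%nat -> Rabs (v j) <= m) ->
  Rabs (interp L kappa (2 * M) v y) <= m.
Proof.
  intros HL Hk HM Hv0 HvN Hm.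
  assert (0 <= m) by (eapply Rle_trans; [apply Rabs_pos | apply (Hm 0%nat); lia]).
  destruct (Rle_dec y 0); [rewrite interp_outside, Rabs_R0 by auto; lra|].
  destruct (Rle_dec (2 * L) y); [rewrite interp_outside, Rabs_R0 by auto; lra|].
  destruct (grid_cell L kappa M y) as (j & Hj & Hy); try lra; auto.
  rewrite (interp_cell L kappa M v j y) by auto.
  assert (Hh := mesh_pos L kappa M j HL Hk HM Hj).
  assert (A1 := Hm (j - 1)%nat ltac:(lia)). assert (A2 := Hm j ltac:(lia)).
  set (r := (y - grid L kappa (2 * M) (j - 1)) / mesh L kappa (2 * M) j).
  replace (v (j - 1)%nat + _) with (v (j - 1)%nat * (1 - r) + v j * r) by (unfold r; field; lra).
  assert (0 <= r <= 1).
  { unfold r, mesh in *. split.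
    - apply Rmult_le_pos; [lra | left; apply Rinv_0_lt_compat; lra].
    - apply Rmult_le_reg_r with (grid L kappa (2 * M) j - grid L kappa (2 * M) (j - 1)); [lra|].
      unfold Rdiv. rewrite Rmult_assoc, Rinv_l by lra. lra. }
  eapply Rle_trans; [apply Rabs_triang|]. rewrite !Rabs_mult.
  rewrite (Rabs_pos_eq (1 - r)), (Rabs_pos_eq r) by lra.
  assert (Rabs (v (j - 1)%nat) * (1 - r) <= m * (1 - r)) by (apply Rmult_le_compat_r; lra).
  assert (Rabs (v j) * r <= m * r) by (apply Rmult_le_compat_r; lra). lra.
Qed.

Lemma interp_minus L kappa N v w y :
  interp L kappa N (fun j => v j - w j) y = interp L kappa N v y - interp L kappa N w y.
Proof.
  unfold interp. generalize (N - 1)%nat as m. induction m as [|m IH].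
  - rewrite !sum_zero by lia. ring.
  - rewrite !sum_last, IH. ring.
Qed.

(** * The fast operator and its stability *)

Lemma is_RInt_zero_tail (F : R -> R) a l b :
  a <= l <= b -> (forall t, continuous F t) -> (forall t, l <= t -> F t = 0) ->
  is_RInt F a b (RInt F a l).
Proof.
  intros H HF H0.
  replace (RInt F a l) with (RInt F a b).
  - apply (RInt_correct F), ex_RInt_cont; [lra | auto].
  - rewrite (RInt_split F a l b) by auto.
    rewrite (RInt_ext F (fun _ => 0) l b).
    + rewrite RInt_const. change (RInt F a l + (b - l) * 0 = RInt F a l). ring.
    + intros t Ht. rewrite Rmin_left in Ht by lra. apply H0; lra.
Qed.

Lemma RInt_gen_left_tail (k P : R -> R) x h :
  h <= x -> (forall t, continuous k t) -> (forall t, continuous P t) ->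
  (forall t, t <= 0 -> P t = 0) ->
  RInt_gen (fun y => k (x - y) * P y) (Rbar_locally m_infty) (at_point (x - h))
  = RInt (fun t => k t * P (x - t)) h x.
Proof.
  intros Hh Hk HP H0.
  apply (is_RInt_gen_unique (Fa := Rbar_locally m_infty) (Fb := at_point (x - h))).
  apply (is_RInt_gen_left _ (fun _ => RInt (fun t => k t * P (x - t)) h x) _ 0);
    [|apply filterlim_const].
  intros b Hb.
  apply (is_RInt_ext (fun y => k (x - y) * P (x - (x - y)))).
  { intros y _. replace (x - (x - y)) with y by ring. reflexivity. }
  replace b with (x - (x - b)) at 1 by ring.
  apply (is_RInt_mirror (fun t => k t * P (x - t))).
  apply is_RInt_zero_tail; [lra | |].
  - intros; apply continuous_Rmult; [apply Hk | apply continuous_shift_minus, HP].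
  - intros t Ht. rewrite H0 by lra. ring.
Qed.

Lemma RInt_gen_right_tail (k P : R -> R) x X h :
  h <= X - x -> (forall t, continuous k t) -> (forall t, continuous P t) ->
  (forall t, X <= t -> P t = 0) ->
  RInt_gen (fun y => k (y - x) * P y) (at_point (x + h)) (Rbar_locally p_infty)
  = RInt (fun t => k t * P (x + t)) h (X - x).
Proof.
  intros Hh Hk HP H0.
  apply (is_RInt_gen_unique (Fa := at_point (x + h)) (Fb := Rbar_locally p_infty)).
  apply (is_RInt_gen_right _ (fun _ => RInt (fun t => k t * P (x + t)) h (X - x)) _ X);
    [|apply filterlim_const].
  intros b Hb.
  apply (is_RInt_ext (fun y => k (y - x) * P (x + (y - x)))).
  { intros y _. replace (x + (y - x)) with y by ring. reflexivity. }
  replace b with (x + (b - x)) at 1 by ring.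
  apply (is_RInt_translate (fun t => k t * P (x + t))).
  apply is_RInt_zero_tail; [lra | |].
  - intros; apply continuous_Rmult; [apply Hk | apply continuous_shift_plus, HP].
  - intros t Ht. rewrite H0 by lra. ring.
Qed.

Definition soe (Ne : nat) (lambda theta : nat -> R) (t : R) : R :=
  sum_n_m (fun s => theta s * exp (- lambda s * t)) 1 Ne.

Lemma soe_continuous Ne lambda theta t : continuous (soe Ne lambda theta) t.
Proof.
  unfold soe. apply (continuous_sum (fun s y => theta s * exp (- lambda s * y))).
  intros k _. apply continuous_Rmult; [apply continuous_const | apply continuous_exp_scal].
Qed.

Lemma soe_nonneg Ne lambda theta t :
  (forall s, (1 <= s <= Ne)%nat -> 0 < lambda s /\ 0 < theta s) ->
  0 <= soe Ne lambda theta t.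
Proof.
  unfold soe. induction Ne as [|n IH]; intros H.
  - rewrite sum_zero by lia. lra.
  - rewrite sum_last. apply Rplus_le_le_0_compat; [apply IH; intros; apply H; lia|].
    apply Rmult_le_pos; [left; apply H; lia | left; apply exp_pos].
Qed.

Lemma soe_integral Ne lambda theta (G : R -> R) a b :
  a <= b -> (forall t, continuous G t) ->
  sum_n_m (fun s => theta s * RInt (fun t => exp (- lambda s * t) * G t) a b) 1 Ne
  = RInt (fun t => soe Ne lambda theta t * G t) a b.
Proof.
  intros Hab HG. induction Ne as [|n IH].
  - rewrite sum_zero by lia. rewrite (RInt_ext _ (fun _ => 0)).
    + rewrite RInt_const. change (0 = (b - a) * 0). ring.
    + intros t _. unfold soe. rewrite sum_zero by lia. apply Rmult_0_l.
  - rewrite sum_last, IH, <- RInt_mult_const, <- RInt_Rplus.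
    + apply RInt_ext. intros t _. unfold soe. rewrite sum_last.
      match goal with |- ?a = ?b => change (@eq R a b) end. ring.
    + apply ex_RInt_cont; [exact Hab|].
      intros; apply continuous_Rmult; [apply soe_continuous | apply HG].
    + apply ex_RInt_cont; [exact Hab|].
      intros; apply continuous_Rmult; [apply continuous_const|].
      apply continuous_Rmult; [apply continuous_exp_scal | apply HG].
    + apply ex_RInt_cont; [exact Hab|].
      intros; apply continuous_Rmult; [apply continuous_exp_scal | apply HG].
Qed.

Definition two_sided (alpha L kappa : R) (N : nat) (k : R -> R) (v : nat -> R) (i : nat) : R :=
  let x := grid L kappa N in
  side alpha (mesh L kappa N i) (x i) (v i) (v (i - 1)%nat) k
    (fun t => interp L kappa N v (x i - t))
  + side alpha (mesh L kappa N (i + 1)) (2 * L - x i) (v i) (v (i + 1)%nat) k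
    (fun t => interp L kappa N v (x i + t)).

Lemma interior_node L kappa M i :
  0 < L -> 1 <= kappa -> (1 <= M)%nat -> (1 <= i <= 2 * M - 1)%nat ->
  0 < mesh L kappa (2 * M) i <= grid L kappa (2 * M) i /\
  0 < mesh L kappa (2 * M) (i + 1) <= 2 * L - grid L kappa (2 * M) i.
Proof.
  intros HL Hk HM Hi.
  assert (H1 := mesh_pos L kappa M i HL Hk HM ltac:(lia)).
  assert (H2 := mesh_pos L kappa M (i + 1) HL Hk HM ltac:(lia)).
  assert (H3 := grid_le L kappa M 0 (i - 1) HL Hk HM ltac:(lia)).
  assert (H4 := grid_le L kappa M (i + 1) (2 * M) HL Hk HM ltac:(lia)).
  rewrite grid_first in H3 by lia. rewrite grid_last in H4 by lia.
  unfold mesh in *. replace (i + 1 - 1)%nat with i in * by lia. lra.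
Qed.

(** The improper integrals reduce to bounded intervals, because the interpolant
    vanishes outside [(0, 2 * L)]; the sum over [s] then enters the integral. *)
Lemma fast_op_two_sided alpha L kappa M Ne lambda theta v i :
  0 < alpha < 1 -> 0 < L -> 1 <= kappa -> (1 <= M)%nat -> (1 <= i <= 2 * M - 1)%nat ->
  fast_op alpha L kappa (2 * M) Ne lambda theta v i =
  C_frac alpha * two_sided alpha L kappa (2 * M) (soe Ne lambda theta) v i.
Proof.
  intros Ha HL Hk HM Hi.
  destruct (interior_node L kappa M i HL Hk HM Hi) as [H1 H2].
  assert (HP := fun t => interp_continuous L kappa M v t HL Hk HM).
  assert (HP0 := fun y => interp_outside L kappa M v y HL Hk HM).
  unfold fast_op, two_sided, side. cbv zeta. f_equal.
  rewrite <- !soe_integral by (try lra; first [apply continuous_shift_minus | apply continuous_shift_plus]; exact HP).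
  rewrite (sum_n_m_ext (fun s => theta s * RInt_gen
    (fun y => exp (- lambda s * (grid L kappa (2 * M) i - y)) * interp L kappa (2 * M) v y)
    (Rbar_locally m_infty) (at_point (grid L kappa (2 * M) (i - 1))))
    (fun s => theta s * RInt (fun t => exp (- lambda s * t) *
        interp L kappa (2 * M) v (grid L kappa (2 * M) i - t))
        (mesh L kappa (2 * M) i) (grid L kappa (2 * M) i))).
  2:{ intros s. f_equal.
      replace (grid L kappa (2 * M) (i - 1)) with
        (grid L kappa (2 * M) i - mesh L kappa (2 * M) i) by (unfold mesh; ring).
      apply (RInt_gen_left_tail (fun t => exp (- lambda s * t))); try lra; auto.
      intros; apply continuous_exp_scal. }
  rewrite (sum_n_m_ext (fun s => theta s * RInt_gen
    (fun y => exp (- lambda s * (y - grid L kappa (2 * M) i)) * interp L kappa (2 * M) v y)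
    (at_point (grid L kappa (2 * M) (i + 1))) (Rbar_locally p_infty))
    (fun s => theta s * RInt (fun t => exp (- lambda s * t) *
        interp L kappa (2 * M) v (grid L kappa (2 * M) i + t))
        (mesh L kappa (2 * M) (i + 1)) (2 * L - grid L kappa (2 * M) i))).
  2:{ intros s. f_equal.
      replace (grid L kappa (2 * M) (i + 1)) with
        (grid L kappa (2 * M) i + mesh L kappa (2 * M) (i + 1))
        by (unfold mesh; replace (i + 1 - 1)%nat with i by lia; ring).
      apply (RInt_gen_right_tail (fun t => exp (- lambda s * t))); try lra; auto.
      intros; apply continuous_exp_scal. }
  match goal with |- _ * ?b - ?c - ?d = _ =>
    generalize c d end. intros c d.
  unfold Rdiv. field. lra.
Qed.

(** Linearity is needed for the error equation: the operator applied to the error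
    is the difference of its values at the solution and at its approximation. *)
Lemma two_sided_minus alpha L kappa M k v w i :
  0 < alpha < 1 -> 0 < L -> 1 <= kappa -> (1 <= M)%nat -> (1 <= i <= 2 * M - 1)%nat ->
  (forall t, 0 < t -> continuous k t) ->
  two_sided alpha L kappa (2 * M) k (fun j => v j - w j) i =
  two_sided alpha L kappa (2 * M) k v i - two_sided alpha L kappa (2 * M) k w i.
Proof.
  intros Ha HL Hk HM Hi Hkc.
  destruct (interior_node L kappa M i HL Hk HM Hi) as [H1 H2].
  assert (HP := fun v t => interp_continuous L kappa M v t HL Hk HM).
  unfold two_sided, side. cbv zeta.
  assert (HS : forall (f g h : R -> R) a b, 0 < a <= b ->
     (forall t, continuous f t) -> (forall t, continuous g t) ->
     (forall t, h t = f t - g t) ->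
     RInt (fun t => k t * h t) a b = RInt (fun t => k t * f t) a b - RInt (fun t => k t * g t) a b).
  { intros f g h a b Hab Hf Hg Hh.
    rewrite <- RInt_Rminus by (apply ex_RInt_cont; [lra | intros; apply continuous_Rmult; auto; apply Hkc; lra]).
    apply RInt_ext. intros t _. rewrite Hh. apply Rmult_minus_distr_l. }
  rewrite (HS (fun t => interp L kappa (2 * M) v (grid L kappa (2 * M) i - t))
              (fun t => interp L kappa (2 * M) w (grid L kappa (2 * M) i - t))
              (fun t => interp L kappa (2 * M) (fun j => v j - w j) (grid L kappa (2 * M) i - t)));
    try (apply continuous_shift_minus, HP); [|lra | intros; apply interp_minus].
  rewrite (HS (fun t => interp L kappa (2 * M) v (grid L kappa (2 * M) i + t))
              (fun t => interp L kappa (2 * M) w (grid L kappa (2 * M) i + t))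
              (fun t => interp L kappa (2 * M) (fun j => v j - w j) (grid L kappa (2 * M) i + t)));
    try (apply continuous_shift_plus, HP); [|lra | intros; apply interp_minus].
  field. lra.
Qed.

Lemma argmax_abs (v : nat -> R) n :
  exists i, (i <= n)%nat /\ forall j, (j <= n)%nat -> Rabs (v j) <= Rabs (v i).
Proof.
  induction n as [|n (i & Hi & H)].
  - exists 0%nat. split; [lia|]. intros j Hj. replace j with 0%nat by lia. lra.
  - destruct (Rle_dec (Rabs (v (S n))) (Rabs (v i))) as [Hle | Hgt].
    + exists i. split; [lia|]. intros j Hj.
      destruct (Nat.eq_dec j (S n)) as [-> | Hne]; [lra | apply H; lia].
    + exists (S n). split; [lia|]. intros j Hj.
      destruct (Nat.eq_dec j (S n)) as [-> | Hne]; [lra|].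
      specialize (H j ltac:(lia)). lra.
Qed.

Lemma kernel_bounds_of_SOE alpha eps dx X Ne lambda theta :
  is_SOE alpha eps dx X Ne lambda theta ->
  forall t, dx <= t <= X ->
    0 <= soe Ne lambda theta t <= Rpower t (- 1 - alpha) + eps /\
    Rabs (soe Ne lambda theta t - Rpower t (- 1 - alpha)) <= eps.
Proof.
  intros [Hpos Happ] t Ht. specialize (Happ t Ht). fold (soe Ne lambda theta t) in Happ.
  rewrite Rabs_minus_sym in Happ. repeat split; try assumption.
  - apply soe_nonneg, Hpos.
  - apply Rabs_le_between in Happ. lra.
Qed.

(** At a node [x] where the maximum is attained, the exterior contributes [m] times
    [(x^(-alpha) + (2 * L - x)^(-alpha)) / alpha]; replacing the kernel costs at
    most [2 * L * eps * m]. *)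
Lemma two_sided_max alpha L kappa M k eps v i m :
  0 < alpha < 1 -> 0 < L -> 1 <= kappa -> (1 <= M)%nat -> (1 <= i <= 2 * M - 1)%nat ->
  (forall t, continuous k t) -> 0 <= eps ->
  (forall t, mesh L kappa (2 * M) i <= t <= 2 * L \/ mesh L kappa (2 * M) (i + 1) <= t <= 2 * L ->
     0 <= k t <= Rpower t (- 1 - alpha) + eps) ->
  v 0%nat = 0 -> v (2 * M)%nat = 0 ->
  (forall j, (j <= 2 * M)%nat -> Rabs (v j) <= m) -> v i = m ->
  m * ((Rpower (grid L kappa (2 * M) i) (- alpha)
        + Rpower (2 * L - grid L kappa (2 * M) i) (- alpha)) / alpha - 2 * L * eps)
  <= two_sided alpha L kappa (2 * M) k v i.
Proof.
  intros Ha HL Hk HM Hi Hkc Heps Hkb Hv0 HvN Hm Hvi.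
  destruct (interior_node L kappa M i HL Hk HM Hi) as [H1 H2].
  assert (HP := fun v t => interp_continuous L kappa M v t HL Hk HM).
  assert (Hb := fun y => interp_bounded L kappa M v m y HL Hk HM Hv0 HvN Hm).
  assert (Hm0 : 0 <= m) by (eapply Rle_trans; [apply Rabs_pos | apply (Hm i); lia]).
  assert (A1 : v (i - 1)%nat <= m) by (eapply Rle_trans; [apply Rle_abs | apply Hm; lia]).
  assert (A2 : v (i + 1)%nat <= m) by (eapply Rle_trans; [apply Rle_abs | apply Hm; lia]).
  unfold two_sided. cbv zeta. rewrite Hvi.
  assert (S1 := side_lower_bound alpha (mesh L kappa (2 * M) i) (grid L kappa (2 * M) i) m
     (v (i - 1)%nat) eps k (fun t => interp L kappa (2 * M) v (grid L kappa (2 * M) i - t))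
     Ha H1 Hm0 A1 Hkc (continuous_shift_minus _ _ (HP v)) (fun t Ht => Hkb t ltac:(lra)) (fun t _ => Hb _)).
  assert (S2 := side_lower_bound alpha (mesh L kappa (2 * M) (i + 1)) (2 * L - grid L kappa (2 * M) i) m
     (v (i + 1)%nat) eps k (fun t => interp L kappa (2 * M) v (grid L kappa (2 * M) i + t))
     Ha H2 Hm0 A2 Hkc (continuous_shift_plus _ _ (HP v)) (fun t Ht => Hkb t ltac:(lra)) (fun t _ => Hb _)).
  set (x := grid L kappa (2 * M) i) in *. set (h1 := mesh L kappa (2 * M) i) in *.
  set (h2 := mesh L kappa (2 * M) (i + 1)) in *.
  assert (m * (eps * (x - h1) + eps * (2 * L - x - h2)) <= m * (2 * L * eps)).
  { apply Rmult_le_compat_l; [lra|].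
    rewrite <- Rmult_plus_distr_l, Rmult_comm. apply Rmult_le_compat_r; lra. }
  replace ((Rpower x (- alpha) + Rpower (2 * L - x) (- alpha)) / alpha)
    with (Rpower x (- alpha) / alpha + Rpower (2 * L - x) (- alpha) / alpha) by (field; lra).
  lra.
Qed.

(** Stability in the maximum norm with a weight.  The residual may blow up like
    [bdist^(-alpha)] at the boundary, since this is exactly the rate at which the
    coercivity of [two_sided_max] grows there; the constant grid function is the
    only barrier that is needed.  Half of the coercivity is spent on the
    perturbation of the kernel, hence the condition on [eps]. *)
Lemma two_sided_stability alpha L kappa M k eps v R0 :
  0 < alpha < 1 -> 0 < L -> 1 <= kappa -> (1 <= M)%nat ->
  (forall t, continuous k t) -> 0 <= eps ->
  4 * L * eps <= Rpower L (- alpha) / alpha ->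
  (forall i t, (1 <= i <= 2 * M)%nat -> mesh L kappa (2 * M) i <= t <= 2 * L ->
     0 <= k t <= Rpower t (- 1 - alpha) + eps) ->
  v 0%nat = 0 -> v (2 * M)%nat = 0 ->
  (forall i, (1 <= i <= 2 * M - 1)%nat ->
     Rabs (two_sided alpha L kappa (2 * M) k v i)
       <= R0 * Rpower (bdist L (grid L kappa (2 * M) i)) (- alpha)) ->
  forall i, (1 <= i <= 2 * M - 1)%nat -> Rabs (v i) <= 2 * alpha * R0.
Proof.
  intros Ha HL Hk HM Hkc Heps Hsmall Hkb Hv0 HvN HR.
  destruct (argmax_abs v (2 * M)) as (i & Hi & Hmax).
  intros i0 Hi0. eapply Rle_trans; [apply Hmax; lia|]. clear i0 Hi0.
  assert (HR0 : 0 <= R0).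
  { specialize (HR 1%nat ltac:(lia)).
    assert (P := Rpower_pos (bdist L (grid L kappa (2 * M) 1)) (- alpha)).
    assert (0 <= R0 * Rpower (bdist L (grid L kappa (2 * M) 1)) (- alpha))
      by (eapply Rle_trans; [apply Rabs_pos | exact HR]).
    destruct (Rle_dec 0 R0); [assumption|]. exfalso.
    assert (R0 * Rpower (bdist L (grid L kappa (2 * M) 1)) (- alpha) < 0); [|lra].
    replace 0 with (0 * Rpower (bdist L (grid L kappa (2 * M) 1)) (- alpha)) by ring.
    apply Rmult_lt_compat_r; lra. }
  assert (HR0' : 0 <= 2 * alpha * R0) by (apply Rmult_le_pos; lra).
  destruct (Nat.eq_dec i 0) as [-> | Hi1]; [rewrite Hv0, Rabs_R0; exact HR0'|].
  destruct (Nat.eq_dec i (2 * M)) as [-> | Hi2]; [rewrite HvN, Rabs_R0; exact HR0'|].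
  assert (Hii : (1 <= i <= 2 * M - 1)%nat) by lia.
  destruct (interior_node L kappa M i HL Hk HM Hii) as [H1 H2].
  set (m := Rabs (v i)) in *.
  assert (Hm0 : 0 <= m) by apply Rabs_pos.
  assert (Hkb' : forall t, mesh L kappa (2 * M) i <= t <= 2 * L
                 \/ mesh L kappa (2 * M) (i + 1) <= t <= 2 * L ->
                 0 <= k t <= Rpower t (- 1 - alpha) + eps).
  { intros t [Ht | Ht]; eapply Hkb; try exact Ht; lia. }
  assert (HA : m * ((Rpower (grid L kappa (2 * M) i) (- alpha)
        + Rpower (2 * L - grid L kappa (2 * M) i) (- alpha)) / alpha - 2 * L * eps)
        <= Rabs (two_sided alpha L kappa (2 * M) k v i)).
  { destruct (Rle_dec 0 (v i)) as [Hpos | Hneg].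
    - eapply Rle_trans; [|apply Rle_abs].
      apply two_sided_max; auto. unfold m. rewrite Rabs_pos_eq; auto.
    (* a negative extremum is reduced to a maximum of [-v], written [0 - v] *)
    - assert (E := two_sided_minus alpha L kappa M k (fun _ => 0) v i Ha HL Hk HM Hii (fun t _ => Hkc t)).
      assert (E1 : two_sided alpha L kappa (2 * M) k (fun _ => 0) i = 0).
      { assert (E2 := two_sided_minus alpha L kappa M k (fun _ => 0) (fun _ => 0) i Ha HL Hk HM Hii (fun t _ => Hkc t)).
        cbv beta in E2. rewrite Rminus_0_r in E2. lra. }
      cbv beta in E. rewrite E1 in E.
      rewrite <- Rabs_Ropp. replace (- two_sided alpha L kappa (2 * M) k v i) with
        (two_sided alpha L kappa (2 * M) k (fun j => 0 - v j) i) by lra.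
      eapply Rle_trans; [|apply Rle_abs].
      apply two_sided_max; auto.
      + rewrite Hv0; ring.
      + rewrite HvN; ring.
      + intros j Hj. rewrite Rminus_0_l, Rabs_Ropp. apply Hmax, Hj.
      + unfold m. rewrite Rabs_left; lra. }
  specialize (HR i Hii).
  set (x := grid L kappa (2 * M) i) in *.
  set (d := bdist L x) in *.
  assert (Hd : 0 < d <= L /\ Rpower d (- alpha) <= Rpower x (- alpha) + Rpower (2 * L - x) (- alpha)).
  { unfold d, bdist, Rmin. generalize (Rpower_pos x (- alpha)) (Rpower_pos (2 * L - x) (- alpha)).
    destruct (Rle_dec x (2 * L - x)); intros; lra. }
  destruct Hd as [Hd1 Hd2].
  assert (Hd3 : Rpower L (- alpha) <= Rpower d (- alpha)) by (apply Rpower_anti; lra).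
  set (rd := Rpower d (- alpha)) in *. assert (Hrd : 0 < rd) by apply Rpower_pos.
  assert (Hia : 0 < / alpha) by (apply Rinv_0_lt_compat; lra).
  assert (HB : m * (rd / (2 * alpha)) <= R0 * rd).
  { eapply Rle_trans; [|exact HR]. eapply Rle_trans; [|exact HA].
    apply Rmult_le_compat_l; [lra|].
    assert (Rpower L (- alpha) / alpha <= rd / alpha) by (apply Rmult_le_compat_r; lra).
    assert (rd / alpha <= (Rpower x (- alpha) + Rpower (2 * L - x) (- alpha)) / alpha)
      by (apply Rmult_le_compat_r; lra).
    replace (rd / (2 * alpha)) with (rd / alpha - rd / alpha / 2) by (field; lra). lra. }
  apply Rmult_le_reg_r with (rd / (2 * alpha)).
  { apply Rdiv_lt_0_compat; lra. }
  replace (2 * alpha * R0 * (rd / (2 * alpha))) with (R0 * rd) by (field; lra). exact HB.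
Qed.

(** * Local mesh size and local interpolation error *)

Lemma node_pos L kappa M i :
  0 < L -> 1 <= kappa -> (1 <= M)%nat -> (1 <= i <= 2 * M)%nat ->
  0 < grid L kappa (2 * M) i.
Proof.
  intros HL Hk HM Hi. rewrite <- (grid_first L kappa M HM). apply grid_lt; auto; lia.
Qed.

Lemma node_left_le L kappa M i :
  0 < L -> 1 <= kappa -> (1 <= M)%nat -> (i <= M)%nat -> grid L kappa (2 * M) i <= L.
Proof.
  intros HL Hk HM Hi. rewrite <- (grid_mid L kappa M HM) at 2. apply grid_le; auto; lia.
Qed.

Lemma node_right_ge L kappa M i :
  0 < L -> 1 <= kappa -> (1 <= M)%nat -> (M <= i <= 2 * M)%nat -> L <= grid L kappa (2 * M) i.
Proof.
  intros HL Hk HM Hi. rewrite <- (grid_mid L kappa M HM) at 1. apply grid_le; auto; lia.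
Qed.

Lemma node_eq L kappa M i :
  (1 <= i <= M)%nat -> grid L kappa (2 * M) i = L * Rpower (INR i / INR M) kappa.
Proof.
  intros Hi. rewrite grid_left by lia. rewrite rpow0_pos_eq; [reflexivity|].
  apply Rdiv_lt_0_compat; apply lt_0_INR; lia.
Qed.

(** [L * s^(kappa-1)], the local mesh size up to the factor [1/M], as a power of the
    node [x_i = L * s^kappa]. *)
Lemma node_power L kappa M i :
  0 < L -> 1 <= kappa -> (1 <= i <= M)%nat ->
  L * Rpower (INR i / INR M) (kappa - 1)
  = Rpower L (/ kappa) * Rpower (grid L kappa (2 * M) i) (1 - / kappa).
Proof.
  intros HL Hk Hi. rewrite node_eq by exact Hi.
  rewrite <- Rpower_mult_distr by (try apply Rpower_pos; lra).
  rewrite Rpower_mult, <- Rmult_assoc, <- Rpower_plus.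
  replace (/ kappa + (1 - / kappa)) with 1 by ring.
  rewrite Rpower_1 by lra.
  replace (kappa * (1 - / kappa)) with (kappa - 1) by (field; lra). reflexivity.
Qed.

Lemma first_node_power L kappa M :
  0 < L -> 1 <= kappa -> (1 <= M)%nat ->
  Rpower (grid L kappa (2 * M) 1) (/ kappa) = Rpower L (/ kappa) * / INR M.
Proof.
  intros HL Hk HM. assert (0 < INR M) by (apply lt_0_INR; lia).
  rewrite node_eq by lia.
  rewrite <- Rpower_mult_distr by (try apply Rpower_pos; lra).
  rewrite Rpower_mult, Rinv_r, Rpower_1 by (simpl; try apply Rdiv_lt_0_compat; lra).
  simpl. unfold Rdiv. ring.
Qed.

Lemma node_ratio L kappa M i :
  0 < L -> 1 <= kappa -> (1 <= i)%nat -> (i + 1 <= M)%nat ->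
  grid L kappa (2 * M) (i + 1) <= Rpower 2 kappa * grid L kappa (2 * M) i.
Proof.
  intros HL Hk Hi HiM. rewrite !node_eq by lia.
  assert (H0 : 0 < INR M) by (apply lt_0_INR; lia).
  assert (H1 : 1 <= INR i) by (apply (le_INR 1); lia).
  replace (Rpower 2 kappa * (L * Rpower (INR i / INR M) kappa))
    with (L * (Rpower 2 kappa * Rpower (INR i / INR M) kappa)) by ring.
  assert (Hiv : 0 < / INR M) by (apply Rinv_0_lt_compat; lra).
  rewrite Rpower_mult_distr by (try apply Rdiv_lt_0_compat; lra).
  apply Rmult_le_compat_l; [lra|]. apply Rle_Rpower_l; [lra|].
  rewrite plus_INR. simpl. unfold Rdiv. split.
  - apply Rmult_lt_0_compat; lra.
  - rewrite <- Rmult_assoc. apply Rmult_le_compat_r; lra.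
Qed.

(** The characteristic property of a graded mesh: the cells next to a node [x] have
    length comparable to [bdist(x)^(1 - 1/kappa) / M].  The constants come from
    [rpow0_increment] and from the ratio of consecutive nodes, at most
    [2^kappa]. *)
Lemma adjacent_mesh_bounds L kappa M i j :
  0 < L -> 1 <= kappa -> (1 <= M)%nat -> (1 <= i <= 2 * M - 1)%nat ->
  j = i \/ j = (i + 1)%nat ->
  Rpower L (/ kappa) * (/ INR M * Rpower (bdist L (grid L kappa (2 * M) i)) (1 - / kappa))
    <= mesh L kappa (2 * M) j
    <= kappa * Rpower 2 kappa * Rpower L (/ kappa)
       * (/ INR M * Rpower (bdist L (grid L kappa (2 * M) i)) (1 - / kappa)).
Proof.
  intros HL Hk HM.
  assert (H0 : 0 < INR M) by (apply lt_0_INR; lia).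
  assert (Hiv : 0 < / INR M) by (apply Rinv_0_lt_compat; lra).
  assert (Hq : 0 <= 1 - / kappa).
  { assert (/ kappa <= / 1) by (apply Rinv_le_contravar; lra). lra. }
  assert (P2 := Rpower_2_ge_1 kappa ltac:(lra)).
  assert (PL := Rpower_pos L (/ kappa)).
  assert (Hmain : forall i j, (1 <= i)%nat -> j = i \/ j = (i + 1)%nat -> (j <= M)%nat ->
    Rpower L (/ kappa) * (/ INR M * Rpower (grid L kappa (2 * M) i) (1 - / kappa))
    <= mesh L kappa (2 * M) j
    <= kappa * Rpower 2 kappa * Rpower L (/ kappa)
       * (/ INR M * Rpower (grid L kappa (2 * M) i) (1 - / kappa))).
  { clear i j. intros i j Hi Hj HjM.
    destruct (mesh_left_bounds L kappa M j HL Hk ltac:(lia)) as [B1 B2].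
    replace (L * / INR M * Rpower (INR j / INR M) (kappa - 1))
      with (/ INR M * (L * Rpower (INR j / INR M) (kappa - 1))) in B1 by ring.
    replace (kappa * L * / INR M * Rpower (INR j / INR M) (kappa - 1))
      with (kappa * (/ INR M * (L * Rpower (INR j / INR M) (kappa - 1)))) in B2 by ring.
    rewrite node_power in B1, B2 by (auto; lia).
    assert (Hxi := node_pos L kappa M i HL Hk HM ltac:(lia)).
    assert (Pi := Rpower_pos (grid L kappa (2 * M) i) (1 - / kappa)).
    set (xi := Rpower (grid L kappa (2 * M) i) (1 - / kappa)) in *.
    set (xj := Rpower (grid L kappa (2 * M) j) (1 - / kappa)) in *.
    assert (Hx : xi <= xj <= Rpower 2 kappa * xi).
    { destruct Hj as [-> | ->].
      - fold xi in xj. unfold xj. fold xi. split; [lra|].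
        rewrite <- (Rmult_1_l xi) at 1. apply Rmult_le_compat_r; lra.
      - unfold xi, xj. split.
        + apply Rle_Rpower_l; [lra|]. split; [lra|]. apply grid_le; auto; lia.
        + assert (Hr := node_ratio L kappa M i HL Hk Hi ltac:(lia)).
          apply Rle_trans with (Rpower (Rpower 2 kappa * grid L kappa (2 * M) i) (1 - / kappa)).
          * apply Rle_Rpower_l; [lra|]. split; [apply node_pos; auto; lia | exact Hr].
          * rewrite <- Rpower_mult_distr by lra.
            apply Rmult_le_compat_r; [left; apply Rpower_pos|].
            rewrite <- (Rpower_1 (Rpower 2 kappa)) at 2 by lra.
            apply Rle_Rpower; [lra|].
            assert (0 < / kappa) by (apply Rinv_0_lt_compat; lra). lra. }
    split.
    - eapply Rle_trans; [|exact B1].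
      replace (Rpower L (/ kappa) * (/ INR M * xi)) with (/ INR M * (Rpower L (/ kappa) * xi)) by ring.
      apply Rmult_le_compat_l; [lra|]. apply Rmult_le_compat_l; lra.
    - eapply Rle_trans; [exact B2|].
      replace (kappa * Rpower 2 kappa * Rpower L (/ kappa) * (/ INR M * xi))
        with (kappa * (/ INR M * (Rpower L (/ kappa) * (Rpower 2 kappa * xi)))) by ring.
      do 3 (apply Rmult_le_compat_l; [lra|]). lra. }
  assert (Hhalf : forall i j, (1 <= i <= M)%nat -> j = i \/ j = (i + 1)%nat ->
    Rpower L (/ kappa) * (/ INR M * Rpower (grid L kappa (2 * M) i) (1 - / kappa))
    <= mesh L kappa (2 * M) j
    <= kappa * Rpower 2 kappa * Rpower L (/ kappa)
       * (/ INR M * Rpower (grid L kappa (2 * M) i) (1 - / kappa))).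
  { clear i j. intros i j Hi Hj. destruct (le_lt_dec j M) as [Hle | Hlt].
    - apply Hmain; auto; lia.
    - rewrite <- mesh_mirror by lia. apply Hmain; lia. }
  intros Hi Hj. destruct (le_lt_dec i M) as [Hle | Hlt].
  - rewrite bdist_left by (apply node_left_le; auto).
    apply Hhalf; auto; lia.
  - rewrite bdist_right by (apply node_right_ge; auto; lia).
    rewrite <- grid_mirror by lia.
    rewrite <- mesh_mirror by lia. apply Hhalf; lia.
Qed.

(** A cell that does not touch the boundary is short compared with its distance to
    it, so weights that are powers of [bdist] are almost constant on it. *)
Lemma cell_bdist_ratio L kappa M j y z :
  0 < L -> 1 <= kappa -> (1 <= M)%nat -> (2 <= j <= 2 * M - 1)%nat ->
  grid L kappa (2 * M) (j - 1) <= y <= grid L kappa (2 * M) j ->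
  grid L kappa (2 * M) (j - 1) <= z <= grid L kappa (2 * M) j ->
  0 < bdist L z <= Rpower 2 kappa * bdist L y.
Proof.
  intros HL Hk HM.
  assert (P2 := Rpower_pos 2 kappa).
  assert (Hmain : forall j y z, (2 <= j <= M)%nat ->
    grid L kappa (2 * M) (j - 1) <= y <= grid L kappa (2 * M) j ->
    grid L kappa (2 * M) (j - 1) <= z <= grid L kappa (2 * M) j ->
    0 < bdist L z <= Rpower 2 kappa * bdist L y).
  { clear j y z. intros j y z Hj Hy Hz.
    assert (H1 := node_left_le L kappa M j HL Hk HM ltac:(lia)).
    assert (H2 := node_pos L kappa M (j - 1) HL Hk HM ltac:(lia)).
    assert (H3 := node_ratio L kappa M (j - 1) HL Hk ltac:(lia) ltac:(lia)).
    replace (j - 1 + 1)%nat with j in H3 by lia.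
    rewrite !bdist_left by lra. split; [lra|].
    apply Rle_trans with (Rpower 2 kappa * grid L kappa (2 * M) (j - 1)); [lra|].
    apply Rmult_le_compat_l; lra. }
  intros Hj Hy Hz. destruct (le_lt_dec j M) as [Hle | Hlt].
  - apply (Hmain j); auto; lia.
  - rewrite <- (bdist_mirror L y), <- (bdist_mirror L z).
    apply (Hmain (2 * M + 1 - j)%nat); [lia | |];
    replace (2 * M + 1 - j - 1)%nat with (2 * M - j)%nat by lia;
    replace (2 * M + 1 - j)%nat with (2 * M - (j - 1))%nat by lia;
    rewrite !grid_mirror by lia; lra.
Qed.

(** The error at [y] is a difference of two values of [u'] times the distance of [y]
    to an end point: one value from the secant slope, one from the mean value
    theorem between [y] and that end point.  The linear vanishing at both end
    points is what [singular_integral_bound] asks for near the node. *)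
Lemma linear_interpolation_error (u u1 u2 : R -> R) a b B :
  a < b ->
  (forall t, a <= t <= b -> is_derive u t (u1 t)) ->
  (forall t, a <= t <= b -> is_derive u1 t (u2 t)) ->
  (forall t, a <= t <= b -> Rabs (u2 t) <= B) ->
  forall y, a <= y <= b ->
    let D := u y - (u a + (u b - u a) / (b - a) * (y - a)) in
    Rabs D <= B * (b - a) * (y - a) /\ Rabs D <= B * (b - a) * (b - y).
Proof.
  intros Hab H1 H2 HB y Hy D.
  assert (HB0 : 0 <= B) by (eapply Rle_trans; [apply Rabs_pos | apply (HB a); lra]).
  assert (MVT : forall f f1 p q, a <= p <= b -> a <= q <= b ->
    (forall t, a <= t <= b -> is_derive f t (f1 t)) ->
    exists c, a <= c <= b /\ f q - f p = f1 c * (q - p)).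
  { intros f f1 p q Hp Hq Hf.
    assert (Hr : forall t, Rmin p q <= t <= Rmax p q -> a <= t <= b).
    { intros t Ht. unfold Rmin, Rmax in Ht. destruct (Rle_dec p q); lra. }
    destruct (MVT_gen f p q f1) as (c & Hc & Heq).
    - intros t Ht. apply Hf, Hr. lra.
    - intros t Ht. apply continuity_pt_filterlim, (ex_derive_continuous f).
      exists (f1 t). apply Hf, Hr, Ht.
    - exists c. split; [apply Hr, Hc | exact Heq]. }
  destruct (MVT u u1 a b) as (c & Hc & Ec); try lra; auto.
  assert (Hkey : forall e, a <= e <= b -> D = (u y - u e) - u1 c * (y - e) ->
    Rabs D <= B * (b - a) * Rabs (y - e)).
  { intros e He ED. destruct (MVT u u1 e y) as (c1 & Hc1 & Ec1); try lra; auto.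
    destruct (MVT u1 u2 c c1) as (c2 & Hc2 & Ec2); try lra; auto.
    rewrite ED, Ec1, <- Rmult_minus_distr_r, Ec2, !Rabs_mult.
    apply Rmult_le_compat_r; [apply Rabs_pos|].
    apply Rmult_le_compat; try apply Rabs_pos; auto. apply Rabs_le. lra. }
  assert (Es : (u b - u a) / (b - a) = u1 c) by (rewrite Ec; field; lra).
  split.
  - rewrite <- (Rabs_pos_eq (y - a)) by lra. apply Hkey; [lra|].
    unfold D. rewrite Es. ring.
  - replace (b - y) with (Rabs (y - b)) by (rewrite Rabs_left1; lra). apply Hkey; [lra|].
    unfold D. rewrite Es. lra.
Qed.

(** In a cell touching the boundary the second derivative may be unbounded, and
    [linear_interpolation_error] does not apply.  The size of [w] gives the bound
    [b^sigma], and in the half of the cell away from the singularity the bound on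
    [w'] gives the linear vanishing at [b]. *)
Lemma boundary_interpolation_error (w w1 : R -> R) sigma b C :
  0 < sigma < 1 -> 0 < b -> w 0 = 0 ->
  (forall t, 0 < t <= b -> is_derive w t (w1 t)) ->
  (forall t, 0 < t <= b -> Rabs (w t) <= C * Rpower t sigma) ->
  (forall t, 0 < t <= b -> Rabs (w1 t) <= C * Rpower t (sigma - 1)) ->
  forall t, 0 <= t <= b ->
    Rabs (w t - w b / b * t) <= 2 * C * Rpower b sigma /\
    Rabs (w t - w b / b * t) <= 4 * C * Rpower b (sigma - 1) * (b - t).
Proof.
  intros Hs Hb Hw0 Hd Hw Hw1 t Ht.
  assert (HC : 0 <= C).
  { specialize (Hw b ltac:(lra)). assert (P := Rpower_pos b sigma).
    destruct (Rle_dec 0 C); [assumption|]. exfalso.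
    assert (C * Rpower b sigma < 0); [|generalize (Rabs_pos (w b)); lra].
    replace 0 with (0 * Rpower b sigma) by ring. apply Rmult_lt_compat_r; lra. }
  assert (Pb := Rpower_pos b (sigma - 1)).
  assert (Eb : Rpower b sigma = Rpower b (sigma - 1) * b).
  { rewrite <- (Rpower_1 b) at 3 by lra. rewrite <- Rpower_plus. f_equal; ring. }
  assert (HCb : 0 <= C * Rpower b (sigma - 1)) by (apply Rmult_le_pos; lra).
  assert (Hwt : Rabs (w t) <= C * Rpower b sigma).
  { destruct (Req_dec t 0) as [-> | Hne].
    - rewrite Hw0, Rabs_R0. apply Rmult_le_pos; [lra | left; apply Rpower_pos].
    - eapply Rle_trans; [apply Hw; lra|]. apply Rmult_le_compat_l; [lra|].
      apply Rle_Rpower_l; lra. }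
  assert (Hwb : Rabs (w b) <= C * Rpower b sigma) by (apply Hw; lra).
  assert (H1 : Rabs (w t - w b / b * t) <= 2 * C * Rpower b sigma).
  { unfold Rminus. eapply Rle_trans; [apply Rabs_triang|]. rewrite Rabs_Ropp.
    assert (Rabs (w b / b * t) <= Rabs (w b)).
    { replace (w b / b * t) with (w b * (t / b)) by (field; lra). rewrite Rabs_mult.
      rewrite <- (Rmult_1_r (Rabs (w b))) at 2. apply Rmult_le_compat_l; [apply Rabs_pos|].
      assert (0 <= t / b) by (apply Rmult_le_pos; [lra | left; apply Rinv_0_lt_compat; lra]).
      rewrite Rabs_pos_eq by assumption. apply Rmult_le_reg_r with b; [lra|].
      unfold Rdiv. rewrite Rmult_assoc, Rinv_l; lra. }
    lra. }
  split; [exact H1|].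
  destruct (Rle_dec t (b / 2)) as [Hle | Hgt].
  - eapply Rle_trans; [exact H1|]. rewrite Eb.
    replace (2 * C * (Rpower b (sigma - 1) * b)) with (C * Rpower b (sigma - 1) * (2 * b)) by ring.
    replace (4 * C * Rpower b (sigma - 1) * (b - t)) with (C * Rpower b (sigma - 1) * (4 * (b - t))) by ring.
    apply Rmult_le_compat_l; lra.
  - destruct (MVT_gen w t b w1) as (c & Hc & Ec).
    + intros s Hs'. rewrite Rmin_left, Rmax_right in Hs' by lra. apply Hd. lra.
    + intros s Hs'. rewrite Rmin_left, Rmax_right in Hs' by lra.
      apply continuity_pt_filterlim, (ex_derive_continuous w). exists (w1 s). apply Hd. lra.
    + rewrite Rmin_left, Rmax_right in Hc by lra.
      replace (w t - w b / b * t) with (- (w1 c * (b - t)) + w b / b * (b - t))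
        by (rewrite <- Ec; field; lra).
      eapply Rle_trans; [apply Rabs_triang|]. rewrite Rabs_Ropp, !Rabs_mult, (Rabs_pos_eq (b - t)) by lra.
      rewrite <- Rmult_plus_distr_r. apply Rmult_le_compat_r; [lra|].
      assert (Rabs (w b / b) <= C * Rpower b (sigma - 1)).
      { unfold Rdiv. rewrite Rabs_mult, (Rabs_pos_eq (/ b)) by (left; apply Rinv_0_lt_compat; lra).
        apply Rmult_le_reg_r with b; [lra|]. rewrite Rmult_assoc, Rinv_l by lra. rewrite Eb in Hwb. lra. }
      assert (Rabs (w1 c) <= C * (2 * Rpower b (sigma - 1))).
      { eapply Rle_trans; [apply Hw1; lra|]. apply Rmult_le_compat_l; [lra|].
        apply Rle_trans with (Rpower (/ 2 * b) (sigma - 1)); [apply Rpower_anti; lra|].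
        rewrite <- Rpower_mult_distr by lra. apply Rmult_le_compat_r; [lra|].
        rewrite <- (Rpower_1 2) at 2 by lra.
        replace (/ 2) with (Rpower 2 (Ropp 1)) by (rewrite Rpower_Ropp, Rpower_1; lra).
        rewrite Rpower_mult. apply Rle_Rpower; lra. }
      lra.
Qed.

(** * Interpolation error of the solution *)

(** The product [t * (2 * L - t)] lies between [L * bdist L t] and
    [2 * L * bdist L t], so these bounds are equivalent to those with powers of the
    product as weights; powers of [bdist] are easier to compare along the grid. *)
Record regular (L sigma C : R) (u u1 u2 : R -> R) : Prop := {
  reg_cont : forall t, continuous u t;
  reg_out : forall t, t <= 0 \/ 2 * L <= t -> u t = 0;
  reg_d1 : forall t, 0 < t < 2 * L -> is_derive u t (u1 t);
  reg_d2 : forall t, 0 < t < 2 * L -> is_derive u1 t (u2 t);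
  reg_b0 : forall t, 0 < t < 2 * L -> Rabs (u t) <= C * Rpower (bdist L t) sigma;
  reg_b1 : forall t, 0 < t < 2 * L -> Rabs (u1 t) <= C * Rpower (bdist L t) (sigma - 1);
  reg_b2 : forall t, 0 < t < 2 * L -> Rabs (u2 t) <= C * Rpower (bdist L t) (sigma - 2) }.

(** What is used of the interpolation error [D = u - P]; here [2 * M] is the number
    of cells.  [ie_first], [ie_last] and [ie_inner] measure its size, and
    [ie_near] its linear vanishing at each interior node.  The conditions are
    symmetric about the midpoint, and they no longer mention [u]. *)
Record interp_error (L kappa sigma C : R) (M : nat) (D : R -> R) : Prop := {
  ie_cont : forall t, continuous D t;
  ie_first : forall y, 0 <= y <= grid L kappa (2 * M) 1 ->
     Rabs (D y) <= C * Rpower (grid L kappa (2 * M) 1) sigma;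
  ie_last : forall y, 2 * L - grid L kappa (2 * M) 1 <= y <= 2 * L ->
     Rabs (D y) <= C * Rpower (grid L kappa (2 * M) 1) sigma;
  ie_inner : forall y, grid L kappa (2 * M) 1 <= y <= 2 * L - grid L kappa (2 * M) 1 ->
     Rabs (D y) <= C * (/ INR M) ^ 2 * Rpower (bdist L y) (sigma - 2 / kappa);
  ie_near : forall i, (1 <= i <= 2 * M - 1)%nat ->
     forall y, grid L kappa (2 * M) (i - 1) <= y <= grid L kappa (2 * M) (i + 1) ->
     Rabs (D y) <= C * / INR M * Rpower (bdist L (grid L kappa (2 * M) i)) (sigma - 1 - / kappa)
                   * Rabs (y - grid L kappa (2 * M) i) }.

Lemma interp_error_mirror L kappa sigma C M D :
  (1 <= M)%nat ->
  interp_error L kappa sigma C M D -> interp_error L kappa sigma C M (fun y => D (2 * L - y)).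
Proof.
  intros HM [H0 H1 H2 H3 H4]. split.
  - apply continuous_shift_minus, H0.
  - intros y Hy. apply H2. lra.
  - intros y Hy. apply H1. lra.
  - intros y Hy. rewrite <- bdist_mirror. apply H3. lra.
  - intros i Hi y Hy.
    assert (E := H4 (2 * M - i)%nat ltac:(lia) (2 * L - y)).
    replace (2 * M - i - 1)%nat with (2 * M - (i + 1))%nat in E by lia.
    replace (2 * M - i + 1)%nat with (2 * M - (i - 1))%nat in E by lia.
    rewrite !grid_mirror, bdist_mirror in E by lia.
    rewrite <- (Rabs_Ropp (y - _)).
    replace (- (y - grid L kappa (2 * M) i)) with (2 * L - y - (2 * L - grid L kappa (2 * M) i)) by ring.
    apply E. lra.
Qed.

(** Continuity at the two boundary points is not part of the [C^2] hypothesis: it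
    follows from the decay [bdist^sigma]. *)
Lemma continuous_of_boundary_decay (u : R -> R) L sigma C :
  0 < L -> 0 < sigma -> 0 <= C ->
  (forall t, t <= 0 \/ 2 * L <= t -> u t = 0) ->
  (forall t, 0 < t < 2 * L -> Rabs (u t) <= C * Rpower (bdist L t) sigma) ->
  (forall t, 0 < t < 2 * L -> continuous u t) ->
  forall t, continuous u t.
Proof.
  intros HL Hs HC H0 Hb Hc t.
  destruct (classic (0 < t < 2 * L)) as [Hin | Hout]; [apply Hc, Hin|].
  assert (Ht : t <= 0 \/ 2 * L <= t) by (destruct (Rlt_dec 0 t); destruct (Rlt_dec t (2 * L)); lra).
  intros P [[e He] HP].
  destruct (Rpower_small_near_zero C sigma (e / 2)) as (d & Hd & Hsm); try lra.
  exists (mkposreal d Hd). intros y Hy. apply HP.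
  change (Rabs (y - t) < d) in Hy. change (Rabs (u y - u t) < e).
  rewrite (H0 t Ht), Rminus_0_r.
  destruct (classic (0 < y < 2 * L)) as [Hin | Hn].
  - apply Rle_lt_trans with (e / 2); [|lra].
    eapply Rle_trans; [apply Hb, Hin|]. apply Hsm.
    assert (Hp := bdist_pos L y Hin). split; [lra|].
    apply Rabs_def2 in Hy. unfold bdist in *.
    generalize (Rmin_l y (2 * L - y)) (Rmin_r y (2 * L - y)). lra.
  - rewrite H0, Rabs_R0; [lra|]. destruct (Rlt_dec 0 y); destruct (Rlt_dec y (2 * L)); lra.
Qed.

Lemma regular_of_weighted_bounds (u : R -> R) L sigma :
  0 < L -> 0 < sigma < 1 ->
  (forall x, x <= 0 \/ 2 * L <= x -> u x = 0) ->
  C2_on u 0 (2 * L) ->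
  (exists M : R, 0 < M /\
     forall (l : nat) (x : R), (l <= 2)%nat -> 0 < x < 2 * L ->
       Rabs (Derive_n u l x) <= M * Rpower (x * (2 * L - x)) (sigma - INR l)) ->
  exists C, 0 < C /\ regular L sigma C u (Derive_n u 1) (Derive_n u 2).
Proof.
  intros HL Hs Hext HC2 (B & HB & Hreg).
  set (K0 := Rpower (2 * L) sigma). set (K1 := Rpower L (sigma - 1)).
  set (K2 := Rpower L (sigma - 2)).
  assert (P0 : 0 < K0) by apply Rpower_pos. assert (P1 : 0 < K1) by apply Rpower_pos.
  assert (P2 : 0 < K2) by apply Rpower_pos.
  assert (Hprod : forall t, 0 < t < 2 * L ->
    0 < bdist L t <= L /\ L * bdist L t <= t * (2 * L - t) <= 2 * L * bdist L t).
  { intros t Ht. split; [apply bdist_pos, Ht|].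
    unfold bdist, Rmin. destruct (Rle_dec t (2 * L - t)); nra. }
  set (C := B * (K0 + K1 + K2)).
  assert (HC : 0 < C) by (unfold C; apply Rmult_lt_0_compat; lra).
  assert (Hup : forall k r, 0 < k -> 0 < r -> k <= K0 + K1 + K2 -> B * (k * r) <= C * r).
  { intros k r Hk Hr Hle. unfold C. rewrite <- Rmult_assoc.
    apply Rmult_le_compat_r; [lra|]. apply Rmult_le_compat_l; lra. }
  assert (B0 : forall t, 0 < t < 2 * L -> Rabs (u t) <= C * Rpower (bdist L t) sigma).
  { intros t Ht. destruct (Hprod t Ht) as [Hd Hp].
    assert (E := Hreg 0%nat t ltac:(lia) Ht). simpl in E. rewrite Rminus_0_r in E.
    eapply Rle_trans; [exact E|]. eapply Rle_trans; [|apply (Hup K0); try lra; apply Rpower_pos].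
    apply Rmult_le_compat_l; [lra|]. unfold K0. rewrite Rpower_mult_distr by lra.
    apply Rle_Rpower_l; [lra|]. split; [|lra].
    apply Rmult_lt_0_compat; lra. }
  assert (Bneg : forall l t e K, (l <= 2)%nat -> 0 < t < 2 * L -> e = sigma - INR l -> e < 0 ->
     K = Rpower L e -> K <= K0 + K1 + K2 ->
     Rabs (Derive_n u l t) <= C * Rpower (bdist L t) e).
  { intros l t e K Hl Ht -> He EK HK. destruct (Hprod t Ht) as [Hd Hp].
    assert (0 < K) by (rewrite EK; apply Rpower_pos).
    eapply Rle_trans; [apply Hreg; auto|].
    eapply Rle_trans; [|apply (Hup K); try lra; apply Rpower_pos].
    apply Rmult_le_compat_l; [lra|]. rewrite EK, Rpower_mult_distr by lra.
    apply Rpower_anti; [lra|]. split; [apply Rmult_lt_0_compat; lra | lra]. }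
  assert (D1 : forall t, 0 < t < 2 * L -> is_derive u t (Derive_n u 1 t)).
  { intros t Ht. apply Derive_correct. exact (proj1 (HC2 t Ht) 1%nat ltac:(lia)). }
  exists C. split; [exact HC|]. split.
  - apply (continuous_of_boundary_decay u L sigma C); auto; try lra.
    intros t Ht. apply (ex_derive_continuous u). eexists. apply D1, Ht.
  - exact Hext.
  - exact D1.
  - intros t Ht. apply (Derive_correct (Derive_n u 1)).
    exact (proj1 (HC2 t Ht) 2%nat ltac:(lia)).
  - exact B0.
  - intros t Ht. apply (Bneg 1%nat t _ K1); simpl; auto; try lra; lia.
  - intros t Ht. apply (Bneg 2%nat t _ K2); simpl; auto; try lra; lia.
Qed.

Definition grid_fun (L kappa : R) (M : nat) (u : R -> R) (j : nat) : R :=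
  u (grid L kappa (2 * M) j).

(** Exchanges [z] for [y] inside an interior cell: the weight of [u''] at any point,
    and the length of the cell, in terms of one chosen point of the cell. *)
Lemma cell_control L kappa sigma :
  0 < L -> 1 <= kappa -> sigma <= 2 ->
  exists K, 1 <= K /\ forall M j y z, (1 <= M)%nat -> (2 <= j <= 2 * M - 1)%nat ->
    grid L kappa (2 * M) (j - 1) <= y <= grid L kappa (2 * M) j ->
    grid L kappa (2 * M) (j - 1) <= z <= grid L kappa (2 * M) j ->
    Rpower (bdist L z) (sigma - 2) <= K * Rpower (bdist L y) (sigma - 2) /\
    mesh L kappa (2 * M) j <= K * (/ INR M * Rpower (bdist L y) (1 - / kappa)).
Proof.
  intros HL Hk Hs.
  set (r := Rpower 2 kappa). assert (Hr : 1 <= r) by (apply Rpower_2_ge_1; lra).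
  assert (Hq : 0 <= 1 - / kappa).
  { assert (/ kappa <= / 1) by (apply Rinv_le_contravar; lra). lra. }
  set (K1 := Rpower (/ r) (sigma - 2)).
  set (K2 := kappa * r * Rpower L (/ kappa) * Rpower r (1 - / kappa)).
  assert (P1 : 0 < K1) by apply Rpower_pos.
  assert (PL := Rpower_pos L (/ kappa)). assert (Pr := Rpower_pos r (1 - / kappa)).
  assert (P2 : 0 < K2) by (unfold K2; repeat apply Rmult_lt_0_compat; lra).
  exists (1 + K1 + K2). split; [lra|]. intros M j y z HM Hj Hy Hz.
  assert (Hir : 0 < / r) by (apply Rinv_0_lt_compat; lra).
  split.
  - destruct (cell_bdist_ratio L kappa M j z y HL Hk HM Hj Hz Hy) as [A1 A2].
    destruct (cell_bdist_ratio L kappa M j y z HL Hk HM Hj Hy Hz) as [A3 _].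
    fold r in A2. apply Rle_trans with (K1 * Rpower (bdist L y) (sigma - 2)).
    + unfold K1. rewrite Rpower_mult_distr by lra. apply Rpower_anti; [lra|].
      split; [apply Rmult_lt_0_compat; lra|].
      apply Rmult_le_reg_l with r; [lra|]. rewrite <- Rmult_assoc, Rinv_r; lra.
    + apply Rmult_le_compat_r; [left; apply Rpower_pos | lra].
  - assert (Hxj : grid L kappa (2 * M) (j - 1) <= grid L kappa (2 * M) j <= grid L kappa (2 * M) j).
    { split; [apply grid_le; auto; lia | lra]. }
    destruct (cell_bdist_ratio L kappa M j y _ HL Hk HM Hj Hy Hxj) as [A1 A2]. fold r in A2.
    destruct (cell_bdist_ratio L kappa M j y y HL Hk HM Hj Hy Hy) as [A3 _].
    eapply Rle_trans; [apply (adjacent_mesh_bounds L kappa M j j); auto; lia|]. fold r.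
    assert (0 < / INR M) by (apply Rinv_0_lt_compat, lt_0_INR; lia).
    apply Rle_trans with (K2 * (/ INR M * Rpower (bdist L y) (1 - / kappa))).
    + unfold K2. rewrite (Rmult_assoc _ (Rpower r _)).
      apply Rmult_le_compat_l; [left; repeat apply Rmult_lt_0_compat; lra|].
      rewrite <- Rmult_assoc, (Rmult_comm (Rpower r _)), Rmult_assoc.
      apply Rmult_le_compat_l; [lra|]. rewrite Rpower_mult_distr by lra.
      apply Rle_Rpower_l; lra.
    + apply Rmult_le_compat_r; [|lra]. apply Rmult_le_pos; [lra | left; apply Rpower_pos].
Qed.

(** In an interior cell the error is at most
    [h * |u''| * distance <= (bdist^(1-1/kappa) / M) * bdist^(sigma-2) * distance];
    estimating the distance by [h] once more gives [ie_inner].  The constant [Kb]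
    serves the two boundary cells, [Ki] the others. *)
Lemma interpolation_error_bounds L kappa sigma C u u1 u2 :
  0 < L -> 1 <= kappa -> 0 < sigma < 1 -> 0 < C -> regular L sigma C u u1 u2 ->
  exists K, 0 < K /\ forall M, (1 <= M)%nat ->
    interp_error L kappa sigma K M
      (fun y => u y - interp L kappa (2 * M) (grid_fun L kappa M u) y).
Proof.
  intros HL Hk Hs HC [Hcont Hout Hd1 Hd2 Hb0 Hb1 Hb2].
  destruct (cell_control L kappa sigma HL Hk ltac:(lra)) as (K1 & HK1 & Hcell).
  assert (PL := Rpower_pos L (/ kappa)).
  set (Kb := 4 * C * (1 + Rpower L (/ kappa))).
  assert (HKb : 4 * C <= Kb /\ 4 * C * Rpower L (/ kappa) <= Kb).
  { unfold Kb. rewrite Rmult_plus_distr_l.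
    assert (0 < 4 * C * Rpower L (/ kappa)) by (repeat apply Rmult_lt_0_compat; lra). lra. }
  set (Ki := C * K1 * K1 * K1).
  assert (HKi : 0 < Ki /\ C * K1 * K1 <= Ki).
  { unfold Ki. assert (0 < C * K1 * K1) by (repeat apply Rmult_lt_0_compat; lra). split; [|nra].
    apply Rmult_lt_0_compat; lra. }
  exists (Kb + Ki). split; [lra|]. intros M HM.
  assert (Ht : 0 < / INR M) by (apply Rinv_0_lt_compat, lt_0_INR; lia).
  set (v := grid_fun L kappa M u). set (D := fun y => u y - interp L kappa (2 * M) v y).
  assert (Hv0 : v 0%nat = 0) by (unfold v, grid_fun; rewrite grid_first by lia; apply Hout; lra).
  assert (HvN : v (2 * M)%nat = 0) by (unfold v, grid_fun; rewrite grid_last by lia; apply Hout; lra).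
  assert (HD : forall j y, (1 <= j <= 2 * M)%nat -> grid L kappa (2 * M) (j - 1) <= y <= grid L kappa (2 * M) j ->
     D y = u y - (u (grid L kappa (2 * M) (j - 1)) + (u (grid L kappa (2 * M) j) - u (grid L kappa (2 * M) (j - 1)))
       / (grid L kappa (2 * M) j - grid L kappa (2 * M) (j - 1)) * (y - grid L kappa (2 * M) (j - 1)))).
  { intros j y Hj Hy. unfold D. rewrite (interp_cell L kappa M v j y) by auto. reflexivity. }
  assert (Hx1 := node_pos L kappa M 1 HL Hk HM ltac:(lia)).
  assert (Hx1L := node_left_le L kappa M 1 HL Hk HM HM).
  set (x1 := grid L kappa (2 * M) 1) in *.
  assert (HxN : grid L kappa (2 * M) (2 * M - 1) = 2 * L - x1) by (apply grid_mirror; lia).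
  assert (Hfirst : forall y, 0 <= y <= x1 ->
    Rabs (D y) <= 2 * C * Rpower x1 sigma /\ Rabs (D y) <= 4 * C * Rpower x1 (sigma - 1) * (x1 - y)).
  { intros y Hy. replace (D y) with (u y - u x1 / x1 * y).
    - apply (boundary_interpolation_error u u1); auto; try lra.
      + apply Hout; lra.
      + intros t Ht'. apply Hd1; lra.
      + intros t Ht'. rewrite <- (bdist_left L t) at 2 by lra. apply Hb0; lra.
      + intros t Ht'. rewrite <- (bdist_left L t) at 2 by lra. apply Hb1; lra.
    - rewrite (HD 1%nat); [|lia|]; simpl (1 - 1)%nat; rewrite grid_first by lia; fold x1; [|lra].
      rewrite (Hout 0) by lra. field. lra. }
  assert (Hlast : forall y, 2 * L - x1 <= y <= 2 * L ->
    Rabs (D y) <= 2 * C * Rpower x1 sigma /\ Rabs (D y) <= 4 * C * Rpower x1 (sigma - 1) * (y - (2 * L - x1))).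
  { intros y Hy.
    replace (D y) with (u (2 * L - (2 * L - y)) - u (2 * L - x1) / x1 * (2 * L - y)).
    - replace (y - (2 * L - x1)) with (x1 - (2 * L - y)) by ring.
      apply (boundary_interpolation_error (fun t => u (2 * L - t)) (fun t => - u1 (2 * L - t)));
        auto; try lra.
      + apply Hout; lra.
      + intros t Ht'.
        replace (- u1 (2 * L - t)) with (scal (-1) (u1 (2 * L - t)))
          by (change (-1 * u1 (2 * L - t) = - u1 (2 * L - t)); ring).
        apply (is_derive_comp u (fun t => 2 * L - t)); [apply Hd1; lra|].
        auto_derive; [trivial | ring].
      + intros t Ht'. rewrite <- (bdist_left L t) at 2 by lra. rewrite <- bdist_mirror. apply Hb0; lra.
      + intros t Ht'. rewrite <- (bdist_left L t) at 2 by lra. rewrite <- bdist_mirror, Rabs_Ropp.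
        apply Hb1; lra.
    - rewrite (HD (2 * M)%nat); [|lia|]; rewrite grid_last, HxN by lia; [|lra].
      replace (2 * L - (2 * L - y)) with y by ring.
      rewrite (Hout (2 * L)) by lra. field. lra. }
  assert (Hinner : forall j y z, (2 <= j <= 2 * M - 1)%nat ->
    grid L kappa (2 * M) (j - 1) <= y <= grid L kappa (2 * M) j ->
    grid L kappa (2 * M) (j - 1) <= z <= grid L kappa (2 * M) j ->
    let B := C * K1 * K1 * / INR M * Rpower (bdist L z) (sigma - 1 - / kappa) in
    Rabs (D y) <= B * (y - grid L kappa (2 * M) (j - 1)) /\
    Rabs (D y) <= B * (grid L kappa (2 * M) j - y)).
  { intros j y z Hj Hy Hz B. rewrite (HD j y) by (auto; lia).
    assert (Hlow := grid_lt L kappa M 0 (j - 1) HL Hk HM ltac:(lia)).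
    assert (Hhigh := grid_lt L kappa M j (2 * M) HL Hk HM ltac:(lia)).
    rewrite grid_first in Hlow by lia. rewrite grid_last in Hhigh by lia.
    assert (Hab := grid_lt L kappa M (j - 1) j HL Hk HM ltac:(lia)).
    destruct (linear_interpolation_error u u1 u2 (grid L kappa (2 * M) (j - 1)) (grid L kappa (2 * M) j)
      (C * (K1 * Rpower (bdist L z) (sigma - 2)))) with (y := y) as [E1 E2]; auto.
    - intros t Ht'. apply Hd1. lra.
    - intros t Ht'. apply Hd2. lra.
    - intros t Ht'. eapply Rle_trans; [apply Hb2; lra|]. apply Rmult_le_compat_l; [lra|].
      apply (Hcell M j z t); auto.
    - assert (Hm := proj2 (Hcell M j z z HM Hj Hz Hz)). unfold mesh in Hm.
      set (h := grid L kappa (2 * M) j - grid L kappa (2 * M) (j - 1)) in *.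
      assert (HBh : C * (K1 * Rpower (bdist L z) (sigma - 2)) * h <= B).
      { apply Rle_trans with (C * (K1 * Rpower (bdist L z) (sigma - 2)) *
          (K1 * (/ INR M * Rpower (bdist L z) (1 - / kappa)))).
        - apply Rmult_le_compat_l; [|exact Hm].
          left; repeat apply Rmult_lt_0_compat; try apply Rpower_pos; lra.
        - unfold B. replace (sigma - 1 - / kappa) with ((sigma - 2) + (1 - / kappa)) by ring.
          rewrite Rpower_plus. right. ring. }
      split; eapply Rle_trans; [exact E1 | | exact E2 |]; apply Rmult_le_compat_r; auto; lra. }
  assert (Hzero : forall i, (i <= 2 * M)%nat -> D (grid L kappa (2 * M) i) = 0).
  { intros i Hi. destruct (Nat.eq_dec i 0) as [-> | Hne].
    - rewrite (HD 1%nat); simpl (1 - 1)%nat; [ring | lia|].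
      split; [lra | apply grid_le; auto; lia].
    - rewrite (HD i); [| lia | split; [apply grid_le; auto; lia | lra]].
      assert (Hab := grid_lt L kappa M (i - 1) i HL Hk HM ltac:(lia)). field. lra. }
  assert (Hx1p : 4 * C * Rpower x1 (sigma - 1) <= (Kb + Ki) * / INR M * Rpower x1 (sigma - 1 - / kappa)).
  { replace (sigma - 1) with ((sigma - 1 - / kappa) + / kappa) at 1 by ring.
    rewrite Rpower_plus. unfold x1 at 2. rewrite first_node_power by auto.
    replace (4 * C * (Rpower x1 (sigma - 1 - / kappa) * (Rpower L (/ kappa) * / INR M)))
      with (4 * C * Rpower L (/ kappa) * (/ INR M * Rpower x1 (sigma - 1 - / kappa))) by ring.
    rewrite (Rmult_assoc (Kb + Ki)). apply Rmult_le_compat_r; [|lra].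
    left; apply Rmult_lt_0_compat; [lra | apply Rpower_pos]. }
  assert (HB : forall z, C * K1 * K1 * / INR M * Rpower z (sigma - 1 - / kappa)
                <= (Kb + Ki) * / INR M * Rpower z (sigma - 1 - / kappa)).
  { intros z. do 2 (apply Rmult_le_compat_r; [left; apply Rpower_pos || lra|]). lra. }
  split.
  - intros t. apply continuous_Rminus; [apply Hcont | apply interp_continuous; auto].
  - intros y Hy. eapply Rle_trans; [apply (proj1 (Hfirst y Hy))|].
    apply Rmult_le_compat_r; [left; apply Rpower_pos | lra].
  - intros y Hy. eapply Rle_trans; [apply (proj1 (Hlast y Hy))|].
    apply Rmult_le_compat_r; [left; apply Rpower_pos | lra].
  - intros y Hy. fold x1 in Hy. fold v. change (Rabs (D y) <= (Kb + Ki) * (/ INR M) ^ 2 * Rpower (bdist L y) (sigma - 2 / kappa)).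
    assert (Hrhs : 0 <= (Kb + Ki) * (/ INR M) ^ 2 * Rpower (bdist L y) (sigma - 2 / kappa)).
    { left; repeat apply Rmult_lt_0_compat; try apply Rpower_pos; lra. }
    destruct (grid_cell L kappa M y HL Hk HM ltac:(lra)) as (j & Hj & Hyj).
    destruct (Nat.eq_dec j 1) as [-> | Hj1].
    { fold x1 in Hyj. replace y with (grid L kappa (2 * M) 1) at 1 by (fold x1; lra).
      rewrite Hzero, Rabs_R0 by lia. exact Hrhs. }
    destruct (Nat.eq_dec j (2 * M)) as [-> | HjN].
    { rewrite HxN in Hyj. replace y with (grid L kappa (2 * M) (2 * M - 1)) at 1 by (rewrite HxN; lra).
      rewrite Hzero, Rabs_R0 by lia. exact Hrhs. }
    destruct (Hinner j y y ltac:(lia) Hyj Hyj) as [E1 _].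
    eapply Rle_trans; [exact E1|].
    assert (Hm := proj2 (Hcell M j y y HM ltac:(lia) Hyj Hyj)). unfold mesh in Hm.
    set (B := C * K1 * K1 * / INR M * Rpower (bdist L y) (sigma - 1 - / kappa)).
    assert (0 <= B) by (unfold B; left; repeat apply Rmult_lt_0_compat; try apply Rpower_pos; lra).
    apply Rle_trans with (B * (K1 * (/ INR M * Rpower (bdist L y) (1 - / kappa)))).
    { apply Rmult_le_compat_l; [assumption | lra]. }
    replace (sigma - 2 / kappa) with ((sigma - 1 - / kappa) + (1 - / kappa)) by (field; lra).
    rewrite Rpower_plus.
    replace (B * (K1 * (/ INR M * Rpower (bdist L y) (1 - / kappa)))) with
      (Ki * ((/ INR M) ^ 2 * (Rpower (bdist L y) (sigma - 1 - / kappa) * Rpower (bdist L y) (1 - / kappa))))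
      by (unfold B, Ki; ring).
    rewrite Rmult_assoc. apply Rmult_le_compat_r; [|lra].
    left; repeat apply Rmult_lt_0_compat; try apply Rpower_pos; lra.
  - intros i Hi y Hy. fold v. set (xi := grid L kappa (2 * M) i).
    change (Rabs (D y) <= (Kb + Ki) * / INR M * Rpower (bdist L xi) (sigma - 1 - / kappa) * Rabs (y - xi)).
    destruct (Rle_dec y xi) as [Hle | Hgt].
    + rewrite (Rabs_left1 (y - xi)) by lra. replace (- (y - xi)) with (xi - y) by ring.
      destruct (Nat.eq_dec i 1) as [-> | Hi1].
      * simpl (1 - 1)%nat in Hy. rewrite grid_first in Hy by lia.
        change xi with x1 in *. rewrite bdist_left by exact Hx1L.
        eapply Rle_trans; [apply (proj2 (Hfirst y ltac:(lra)))|].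
        apply Rmult_le_compat_r; lra.
      * eapply Rle_trans; [apply (proj2 (Hinner i y xi ltac:(lia) ltac:(fold xi; lra) ltac:(fold xi; lra)))|].
        fold xi. apply Rmult_le_compat_r; [lra | apply HB].
    + rewrite (Rabs_pos_eq (y - xi)) by lra.
      destruct (Nat.eq_dec i (2 * M - 1)) as [-> | Hi1].
      * replace (2 * M - 1 + 1)%nat with (2 * M)%nat in Hy by lia. rewrite grid_last in Hy by lia.
        unfold xi in *. rewrite HxN in *. rewrite bdist_mirror, bdist_left by exact Hx1L.
        eapply Rle_trans; [apply (proj2 (Hlast y ltac:(lra)))|].
        apply Rmult_le_compat_r; lra.
      * assert (Hxx := grid_le L kappa M i (i + 1) HL Hk HM ltac:(lia)). fold xi in Hxx.
        assert (Ei : (i + 1 - 1)%nat = i) by lia.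
        eapply Rle_trans; [apply (proj1 (Hinner (i + 1)%nat y xi ltac:(lia) ltac:(rewrite Ei; fold xi; lra) ltac:(rewrite Ei; fold xi; lra)))|].
        rewrite Ei. fold xi. apply Rmult_le_compat_r; [lra | apply HB].
Qed.

(** * Contributions to the truncation error *)

Lemma first_node_eq L kappa M :
  (1 <= M)%nat -> grid L kappa (2 * M) 1 = L * Rpower (/ INR M) kappa.
Proof.
  intros HM. rewrite node_eq by lia. simpl INR at 1. do 2 f_equal. unfold Rdiv. ring.
Qed.

Lemma first_node_Rpower L kappa M e :
  0 < L -> (1 <= M)%nat ->
  Rpower (grid L kappa (2 * M) 1) e = Rpower L e * Rpower (/ INR M) (kappa * e).
Proof.
  intros HL HM. rewrite first_node_eq by exact HM.
  rewrite <- Rpower_mult_distr by (try apply Rpower_pos; exact HL).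
  rewrite Rpower_mult. reflexivity.
Qed.

Lemma later_node_ge L kappa M i :
  0 < L -> 1 <= kappa -> (2 <= i <= M)%nat ->
  2 * grid L kappa (2 * M) 1 <= grid L kappa (2 * M) i.
Proof.
  intros HL Hk Hi. rewrite first_node_eq, node_eq by lia.
  assert (H0 : 0 < INR M) by (apply lt_0_INR; lia).
  assert (Hv : 0 < / INR M) by (apply Rinv_0_lt_compat; exact H0).
  assert (H2 : 2 <= INR i) by (apply (le_INR 2); lia).
  replace (2 * (L * Rpower (/ INR M) kappa)) with (L * (2 * Rpower (/ INR M) kappa)) by ring.
  apply Rmult_le_compat_l; [lra|].
  apply Rle_trans with (Rpower 2 kappa * Rpower (/ INR M) kappa).
  - apply Rmult_le_compat_r; [left; apply Rpower_pos|].
    rewrite <- (Rpower_1 2) at 1 by lra. apply Rle_Rpower; lra.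
  - rewrite Rpower_mult_distr by lra. apply Rle_Rpower_l; [lra|].
    split; [apply Rmult_lt_0_compat; lra|]. unfold Rdiv. apply Rmult_le_compat_r; lra.
Qed.

(** [c * E M] bounds each of the three contributions to the error: the consistency
    error of order [2 - alpha] of the cells adjacent to a node, the error of the
    two cells at the boundary, and the total mass of the interpolation error
    between the boundary and [z], relative to [z].  Only the last one depends on
    the position of [kappa * (1 + sigma)] relative to [2]. *)
Record rate (alpha sigma kappa L c : R) (E : nat -> R) : Prop := {
  rate_consistency : forall M, (1 <= M)%nat -> Rpower (/ INR M) (2 - alpha) <= c * E M;
  rate_boundary : forall M, (1 <= M)%nat -> Rpower (/ INR M) (kappa * sigma) <= c * E M;
  rate_mass : forall M z, (1 <= M)%nat -> grid L kappa (2 * M) 1 <= z <= L ->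
    (/ INR M) ^ 2 * RInt (fun y => Rpower y (sigma - 2 / kappa)) (grid L kappa (2 * M) 1) z
    <= c * E M * z }.

Lemma RInt_abs_mirror (D : R -> R) x a b :
  a <= b -> (forall t, continuous D t) ->
  RInt (fun t => Rabs (D (x - t))) (x - b) (x - a) = RInt (fun t => Rabs (D t)) a b.
Proof.
  intros Hab HD. apply is_RInt_unique, (is_RInt_mirror (fun t => Rabs (D t))).
  apply (RInt_correct (fun t => Rabs (D t))), ex_RInt_cont; [exact Hab|].
  intros; apply continuous_Rabs_fun, HD.
Qed.

Lemma RInt_abs_translate (D : R -> R) x a b :
  a <= b -> (forall t, continuous D t) ->
  RInt (fun t => Rabs (D (x + t))) a b = RInt (fun t => Rabs (D t)) (x + a) (x + b).
Proof.
  intros Hab HD. symmetry. apply is_RInt_unique.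
  apply (is_RInt_ext (fun y => Rabs (D (x + (y - x))))).
  { intros y _. replace (x + (y - x)) with y by ring. reflexivity. }
  apply (is_RInt_translate (fun t => Rabs (D (x + t)))).
  apply (RInt_correct (fun t => Rabs (D (x + t)))), ex_RInt_cont; [exact Hab|].
  intros; apply continuous_Rabs_fun, continuous_shift_plus, HD.
Qed.

(** The first cell contributes [x_1 * x_1^sigma <= z * L^sigma * M^(-kappa*sigma)];
    the remaining cells are accounted for by [rate_mass]. *)
Lemma error_mass L kappa sigma alpha K c E :
  0 < L -> 1 <= kappa -> 0 < sigma -> 0 < K -> 0 < c -> rate alpha sigma kappa L c E ->
  exists C, 0 < C /\ forall M D z, (1 <= M)%nat -> interp_error L kappa sigma K M D ->
    grid L kappa (2 * M) 1 <= z <= L ->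
    RInt (fun y => Rabs (D y)) 0 z <= C * E M * z.
Proof.
  intros HL Hk Hs HK Hc [_ R2 R3].
  assert (PL := Rpower_pos L sigma).
  exists (K * Rpower L sigma * c + K * c). split.
  { assert (0 < K * Rpower L sigma * c) by (repeat apply Rmult_lt_0_compat; lra).
    assert (0 < K * c) by (apply Rmult_lt_0_compat; lra). lra. }
  intros M D z HM [HD H1 _ H2 _] Hz.
  specialize (R2 M HM). specialize (R3 M z HM Hz).
  assert (HDa : forall t, continuous (fun y => Rabs (D y)) t) by (intros; apply continuous_Rabs_fun, HD).
  assert (Hx := node_pos L kappa M 1 HL Hk HM ltac:(lia)).
  assert (Ex := first_node_Rpower L kappa M sigma HL HM).
  set (x1 := grid L kappa (2 * M) 1) in *.
  rewrite (RInt_split _ 0 x1 z) by (try lra; intros; apply HDa).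
  rewrite Rmult_plus_distr_r, Rmult_plus_distr_r. apply Rplus_le_compat.
  - apply Rle_trans with (x1 * (K * Rpower x1 sigma)).
    + eapply Rle_trans; [apply Rle_abs|].
      replace x1 with (x1 - 0) at 2 by ring.
      apply abs_RInt_le_const; [lra | apply ex_RInt_cont; [lra | auto]|].
      intros t Ht. rewrite Rabs_Rabsolu. apply H1, Ht.
    + rewrite Ex.
      assert (Hq : K * (Rpower L sigma * Rpower (/ INR M) (kappa * sigma)) <= K * Rpower L sigma * c * E M).
      { rewrite <- Rmult_assoc, (Rmult_assoc _ c). apply Rmult_le_compat_l; [|exact R2].
        left; apply Rmult_lt_0_compat; lra. }
      rewrite Rmult_comm.
      assert (P := Rpower_pos (/ INR M) (kappa * sigma)).
      apply Rmult_le_compat; try lra.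
      left; repeat apply Rmult_lt_0_compat; lra.
  - assert (Hi : ex_RInt (fun y => Rpower y (sigma - 2 / kappa)) x1 z).
    { apply ex_RInt_cont; [lra|]. intros; apply continuous_Rpower; lra. }
    apply Rle_trans with (K * (/ INR M) ^ 2 * RInt (fun y => Rpower y (sigma - 2 / kappa)) x1 z).
    + rewrite <- RInt_mult_const by exact Hi.
      apply RInt_le; [lra | apply ex_RInt_cont; [lra | auto] | apply ex_RInt_mult_const, Hi|].
      intros t Ht. eapply Rle_trans; [apply H2; lra|]. rewrite bdist_left by lra. lra.
    + replace (K * c * E M * z) with (K * (c * E M * z)) by ring. rewrite Rmult_assoc.
      apply Rmult_le_compat_l; lra.
Qed.

Lemma total_error_mass L kappa sigma alpha K c E :
  0 < L -> 1 <= kappa -> 0 < sigma -> 0 < K -> 0 < c -> rate alpha sigma kappa L c E ->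
  exists C, 0 < C /\ forall M D, (1 <= M)%nat -> interp_error L kappa sigma K M D ->
    RInt (fun y => Rabs (D y)) 0 (2 * L) <= C * E M.
Proof.
  intros HL Hk Hs HK Hc HR.
  destruct (error_mass L kappa sigma alpha K c E HL Hk Hs HK Hc HR) as (C & HC & H).
  exists (2 * C * L). split; [repeat apply Rmult_lt_0_compat; lra|].
  intros M D HM HD.
  assert (Hx := node_left_le L kappa M 1 HL Hk HM HM).
  assert (A1 := H M D L HM HD ltac:(lra)).
  assert (A2 := H M _ L HM (interp_error_mirror L kappa sigma K M D HM HD) ltac:(lra)).
  assert (E1 := RInt_abs_mirror D (2 * L) L (2 * L) ltac:(lra) (ie_cont _ _ _ _ _ _ HD)).
  replace (2 * L - 2 * L) with 0 in E1 by ring. replace (2 * L - L) with L in E1 by ring.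
  rewrite (RInt_split _ 0 L (2 * L));
    [|lra | intros; apply continuous_Rabs_fun, (ie_cont _ _ _ _ _ _ HD)].
  rewrite <- E1. lra.
Qed.

(** Since [x^w] is bounded by the sum of its values at [L] and at [x_1], and [x_1] is
    [L * M^(-kappa)], the product is at most a constant times the sum of
    [M^(alpha-2)] and [M^(-kappa*sigma)]. *)
Lemma weighted_power_rate L kappa sigma alpha c E :
  0 < L -> 1 <= kappa -> 0 < c -> rate alpha sigma kappa L c E ->
  exists C, 0 < C /\ forall M x, (1 <= M)%nat -> grid L kappa (2 * M) 1 <= x <= L ->
    Rpower (/ INR M) (2 - alpha) * Rpower x (sigma - (2 - alpha) / kappa) <= C * E M.
Proof.
  intros HL Hk Hc [R1 R2 _]. set (w := sigma - (2 - alpha) / kappa).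
  exists (2 * c * Rpower L w). assert (PL := Rpower_pos L w).
  split; [repeat apply Rmult_lt_0_compat; lra|].
  intros M x HM Hx. specialize (R1 M HM). specialize (R2 M HM).
  assert (H1 := node_pos L kappa M 1 HL Hk HM ltac:(lia)).
  assert (Hb := Rpower_between x w _ L (conj H1 (proj1 Hx)) (proj2 Hx)).
  rewrite first_node_Rpower in Hb by auto.
  assert (Pt := Rpower_pos (/ INR M) (2 - alpha)).
  apply Rle_trans with (Rpower (/ INR M) (2 - alpha) *
    (Rpower L w * Rpower (/ INR M) (kappa * w) + Rpower L w)).
  { apply Rmult_le_compat_l; lra. }
  replace (Rpower (/ INR M) (2 - alpha) * (Rpower L w * Rpower (/ INR M) (kappa * w) + Rpower L w))
    with (Rpower L w * (Rpower (/ INR M) (2 - alpha) * Rpower (/ INR M) (kappa * w) + Rpower (/ INR M) (2 - alpha))) by ring.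
  rewrite <- Rpower_plus.
  replace (2 - alpha + kappa * w) with (kappa * sigma) by (unfold w; field; lra).
  replace (2 * c * Rpower L w * E M) with (Rpower L w * (c * E M + c * E M)) by ring.
  apply Rmult_le_compat_l; lra.
Qed.

(** The first two terms of [singular_integral_bound] at a node [x], for a cell of
    length comparable to [h = x^(1-1/kappa) / M].  Collecting exponents, both are
    [x^(-alpha) * M^(alpha-2)] times [x^(sigma - (2-alpha)/kappa)] or a bounded
    factor. *)
Lemma local_terms_rate L kappa sigma alpha K c E c1 c2 cS :
  0 < alpha < 1 -> 0 < L -> 1 <= kappa -> 0 < K -> 0 < c -> 0 < c1 -> 0 < c2 -> 0 < cS ->
  rate alpha sigma kappa L c E ->
  exists C, 0 < C /\ forall M x rho, (1 <= M)%nat -> grid L kappa (2 * M) 1 <= x <= L ->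
    c1 * (/ INR M * Rpower x (1 - / kappa)) <= rho <= c2 * (/ INR M * Rpower x (1 - / kappa)) ->
    K * / INR M * Rpower x (sigma - 1 - / kappa) * Rpower rho (1 - alpha) / (1 - alpha)
    + K * (/ INR M) ^ 2 * (cS * (1 + Rpower x (sigma - 2 / kappa))) * Rpower rho (- alpha) / alpha
    <= C * E M * Rpower x (- alpha).
Proof.
  intros Ha HL Hk HK Hc Hc1 Hc2 HcS HR.
  destruct (weighted_power_rate L kappa sigma alpha c E HL Hk Hc HR) as (W & HW & HWb).
  destruct HR as [R1 _ _].
  set (k1 := K * Rpower c2 (1 - alpha) / (1 - alpha)).
  set (k2 := K * cS * Rpower c1 (- alpha) / alpha).
  assert (Hk1 : 0 < k1).
  { unfold k1. apply Rdiv_lt_0_compat; [|lra]. apply Rmult_lt_0_compat; [lra | apply Rpower_pos]. }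
  assert (Hk2 : 0 < k2).
  { unfold k2. apply Rdiv_lt_0_compat; [|lra]. repeat apply Rmult_lt_0_compat; try lra. apply Rpower_pos. }
  assert (PL := Rpower_pos L (alpha / kappa)).
  exists (k1 * W + k2 * (Rpower L (alpha / kappa) * c + W)). split.
  { assert (0 < k1 * W) by (apply Rmult_lt_0_compat; lra).
    assert (0 < Rpower L (alpha / kappa) * c) by (apply Rmult_lt_0_compat; lra).
    assert (0 < k2 * (Rpower L (alpha / kappa) * c + W)) by (apply Rmult_lt_0_compat; lra). lra. }
  intros M x rho HM Hx Hrho. specialize (HWb M x HM Hx). specialize (R1 M HM).
  assert (H1 := node_pos L kappa M 1 HL Hk HM ltac:(lia)).
  assert (Hx0 : 0 < x) by lra.
  assert (Ht : 0 < / INR M) by (apply Rinv_0_lt_compat, lt_0_INR; lia).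
  set (tau := / INR M) in *. set (h := tau * Rpower x (1 - / kappa)) in *.
  assert (Hh : 0 < h) by (unfold h; apply Rmult_lt_0_compat; [lra | apply Rpower_pos]).
  assert (Hc1h : 0 < c1 * h) by (apply Rmult_lt_0_compat; lra).
  assert (Hhp : forall e, Rpower h e = Rpower tau e * Rpower x ((1 - / kappa) * e)).
  { intros e. unfold h. rewrite <- Rpower_mult_distr by (try apply Rpower_pos; lra).
    rewrite Rpower_mult. reflexivity. }
  assert (Hrho1 : Rpower rho (1 - alpha) <= Rpower c2 (1 - alpha) * Rpower h (1 - alpha)).
  { rewrite Rpower_mult_distr by lra. apply Rle_Rpower_l; lra. }
  assert (Hrho2 : Rpower rho (- alpha) <= Rpower c1 (- alpha) * Rpower h (- alpha)).
  { rewrite Rpower_mult_distr by lra. apply Rpower_anti; lra. }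
  set (w := sigma - (2 - alpha) / kappa) in *.
  set (xa := Rpower x (- alpha)) in *. assert (Hxa : 0 < xa) by apply Rpower_pos.
  assert (T1 : tau * Rpower x (sigma - 1 - / kappa) * Rpower h (1 - alpha)
               = Rpower tau (2 - alpha) * Rpower x w * xa).
  { rewrite Hhp. replace (2 - alpha) with (1 + (1 - alpha)) by ring.
    rewrite Rpower_plus, Rpower_1 by exact Ht.
    unfold xa. rewrite !Rmult_assoc, <- Rpower_plus.
    replace (w + - alpha) with ((sigma - 1 - / kappa) + (1 - / kappa) * (1 - alpha))
      by (unfold w; field; lra).
    rewrite Rpower_plus. ring. }
  assert (T2 : tau ^ 2 * (1 + Rpower x (sigma - 2 / kappa)) * Rpower h (- alpha)
               = Rpower tau (2 - alpha) * (Rpower x (alpha / kappa) + Rpower x w) * xa).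
  { rewrite Hhp. replace (2 - alpha) with (INR 2 + - alpha) by (simpl; ring).
    rewrite Rpower_plus, Rpower_pow by exact Ht.
    replace ((1 - / kappa) * - alpha) with (alpha / kappa + - alpha) by (field; lra).
    replace w with ((sigma - 2 / kappa) + alpha / kappa) by (unfold w; field; lra).
    rewrite !Rpower_plus. unfold xa. ring. }
  assert (S1 : K * tau * Rpower x (sigma - 1 - / kappa) * Rpower rho (1 - alpha) / (1 - alpha)
     <= k1 * (Rpower tau (2 - alpha) * Rpower x w * xa)).
  { rewrite <- T1.
    replace (K * tau * Rpower x (sigma - 1 - / kappa) * Rpower rho (1 - alpha) / (1 - alpha))
      with (K / (1 - alpha) * (tau * Rpower x (sigma - 1 - / kappa)) * Rpower rho (1 - alpha))
      by (field; lra).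
    replace (k1 * (tau * Rpower x (sigma - 1 - / kappa) * Rpower h (1 - alpha)))
      with (K / (1 - alpha) * (tau * Rpower x (sigma - 1 - / kappa)) *
            (Rpower c2 (1 - alpha) * Rpower h (1 - alpha))) by (unfold k1; field; lra).
    apply Rmult_le_compat_l; [|exact Hrho1].
    left; repeat apply Rmult_lt_0_compat; try apply Rpower_pos; try lra.
    apply Rinv_0_lt_compat; lra. }
  assert (S2 : K * tau ^ 2 * (cS * (1 + Rpower x (sigma - 2 / kappa))) * Rpower rho (- alpha) / alpha
     <= k2 * (Rpower tau (2 - alpha) * (Rpower x (alpha / kappa) + Rpower x w) * xa)).
  { rewrite <- T2.
    assert (Pe := Rpower_pos x (sigma - 2 / kappa)).
    assert (Pt2 : 0 < tau ^ 2) by (apply pow_lt, Ht).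
    replace (K * tau ^ 2 * (cS * (1 + Rpower x (sigma - 2 / kappa))) * Rpower rho (- alpha) / alpha)
      with (K * cS / alpha * (tau ^ 2 * (1 + Rpower x (sigma - 2 / kappa))) * Rpower rho (- alpha))
      by (field; lra).
    replace (k2 * (tau ^ 2 * (1 + Rpower x (sigma - 2 / kappa)) * Rpower h (- alpha)))
      with (K * cS / alpha * (tau ^ 2 * (1 + Rpower x (sigma - 2 / kappa))) *
            (Rpower c1 (- alpha) * Rpower h (- alpha))) by (unfold k2; field; lra).
    apply Rmult_le_compat_l; [|exact Hrho2].
    left; repeat apply Rmult_lt_0_compat; try lra. apply Rinv_0_lt_compat; lra. }
  assert (S3 : Rpower tau (2 - alpha) * Rpower x (alpha / kappa) <= Rpower L (alpha / kappa) * c * E M).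
  { assert (Rpower x (alpha / kappa) <= Rpower L (alpha / kappa)).
    { apply Rle_Rpower_l; [|lra]. apply Rmult_le_pos; [lra | left; apply Rinv_0_lt_compat; lra]. }
    rewrite Rmult_comm, Rmult_assoc.
    apply Rmult_le_compat; try (left; apply Rpower_pos); auto. }
  assert (S4 : k1 * (Rpower tau (2 - alpha) * Rpower x w * xa) <= k1 * (W * E M * xa)).
  { apply Rmult_le_compat_l; [lra|]. apply Rmult_le_compat_r; lra. }
  assert (S5 : k2 * (Rpower tau (2 - alpha) * (Rpower x (alpha / kappa) + Rpower x w) * xa)
               <= k2 * ((Rpower L (alpha / kappa) * c + W) * E M * xa)).
  { apply Rmult_le_compat_l; [lra|]. apply Rmult_le_compat_r; lra. }
  lra.
Qed.

(** * The interpolation error against the kernel *)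

Lemma half_power_bound L e d x :
  0 < x -> x / 2 <= d <= L ->
  Rpower d e <= (Rpower (/ 2) e + Rpower L e) * (1 + Rpower x e).
Proof.
  intros Hx Hd.
  assert (H := Rpower_between d e (/ 2 * x) L ltac:(lra) ltac:(lra)).
  rewrite <- Rpower_mult_distr in H by lra.
  assert (P1 := Rpower_pos (/ 2) e). assert (P2 := Rpower_pos L e). assert (P3 := Rpower_pos x e).
  assert (0 < Rpower L e * Rpower x e) by (apply Rmult_lt_0_compat; lra).
  lra.
Qed.

(** For a node [x] in the left half, the far field starts at distance [x/2] on the
    left and [L/2] on the right.  On the left the mass of the error below [x] is at
    most [C * E * x], which compensates for the kernel [x^(-1-alpha)]; on the right
    the kernel is bounded.  In between, the distance to the boundary is at least
    [x/2], and [ie_inner] is a pointwise bound. *)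
Lemma half_grid_kernel_bound L kappa sigma alpha K c E :
  0 < alpha < 1 -> 0 < L -> 1 <= kappa -> 0 < sigma -> 0 < K -> 0 < c ->
  rate alpha sigma kappa L c E ->
  exists C, 0 < C /\ forall M D i, (1 <= M)%nat -> interp_error L kappa sigma K M D ->
    (1 <= i <= M)%nat -> let x := grid L kappa (2 * M) i in
    (forall eta, 0 < eta <= mesh L kappa (2 * M) i ->
       Rabs (RInt (fun t => Rpower t (- 1 - alpha) * D (x - t)) eta x)
       <= C * E M * Rpower x (- alpha)) /\
    (forall eta, 0 < eta <= mesh L kappa (2 * M) (i + 1) ->
       Rabs (RInt (fun t => Rpower t (- 1 - alpha) * D (x + t)) eta (2 * L - x))
       <= C * E M * Rpower x (- alpha)).
Proof.
  intros Ha HL Hk Hs HK Hc HR.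
  set (e := sigma - 2 / kappa). set (cS := Rpower (/ 2) e + Rpower L e).
  assert (HcS : 0 < cS) by (unfold cS; generalize (Rpower_pos (/ 2) e) (Rpower_pos L e); lra).
  set (c1 := Rpower L (/ kappa)). set (c2 := kappa * Rpower 2 kappa * Rpower L (/ kappa)).
  assert (Hc1 : 0 < c1) by apply Rpower_pos.
  assert (Hc2 : 0 < c2) by (unfold c2; repeat apply Rmult_lt_0_compat; try apply Rpower_pos; lra).
  destruct (local_terms_rate L kappa sigma alpha K c E c1 c2 cS) as (C1 & HC1 & Hloc); auto.
  destruct (error_mass L kappa sigma alpha K c E HL Hk Hs HK Hc HR) as (C2 & HC2 & Hmass).
  destruct (total_error_mass L kappa sigma alpha K c E HL Hk Hs HK Hc HR) as (C3 & HC3 & Htot).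
  set (k2 := Rpower (/ 2) (- 1 - alpha) * C2).
  set (k3 := Rpower (L / 2) (- 1 - alpha) * C3 * Rpower L alpha).
  assert (Hk2 : 0 < k2) by (unfold k2; apply Rmult_lt_0_compat; [apply Rpower_pos | lra]).
  assert (Hk3 : 0 < k3) by (unfold k3; repeat apply Rmult_lt_0_compat; try apply Rpower_pos; lra).
  exists (C1 + k2 + k3). split; [lra|].
  intros M D i HM HD Hi x.
  assert (H1 := node_pos L kappa M 1 HL Hk HM ltac:(lia)).
  assert (Hx : grid L kappa (2 * M) 1 <= x <= L).
  { split; [apply grid_le; auto; lia | apply node_left_le; auto; lia]. }
  assert (Hx0 : 0 < x) by lra.
  assert (HE : 0 < E M).
  { assert (P := Rpower_pos (/ INR M) (kappa * sigma)).
    assert (Hb := rate_boundary _ _ _ _ _ _ HR M HM).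
    apply Rmult_lt_reg_l with c; lra. }
  assert (Pxa := Rpower_pos x (- alpha)).
  assert (Ht : 0 < / INR M) by (apply Rinv_0_lt_compat, lt_0_INR; lia).
  destruct (interior_node L kappa M i HL Hk HM ltac:(lia)) as [Hm1 Hm2]. fold x in Hm1, Hm2.
  set (B1 := K * / INR M * Rpower x (sigma - 1 - / kappa)).
  set (B2 := K * (/ INR M) ^ 2 * (cS * (1 + Rpower x e))).
  assert (HB1 : 0 <= B1) by (unfold B1; left; repeat apply Rmult_lt_0_compat; try apply Rpower_pos; lra).
  assert (HB2 : 0 <= B2).
  { unfold B2. generalize (Rpower_pos x e). intros. left.
    repeat apply Rmult_lt_0_compat; lra. }
  assert (Hrho : forall j, j = i \/ j = (i + 1)%nat ->
     c1 * (/ INR M * Rpower x (1 - / kappa)) <= mesh L kappa (2 * M) j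
       <= c2 * (/ INR M * Rpower x (1 - / kappa))).
  { intros j Hj. assert (Hb := adjacent_mesh_bounds L kappa M i j HL Hk HM ltac:(lia) Hj).
    fold x in Hb. rewrite bdist_left in Hb by lra. exact Hb. }
  assert (Hnear : forall y, grid L kappa (2 * M) (i - 1) <= y <= grid L kappa (2 * M) (i + 1) ->
     Rabs (D y) <= B1 * Rabs (y - x)).
  { intros y Hy. assert (Hn := ie_near _ _ _ _ _ _ HD i ltac:(lia) y Hy).
    fold x in Hn. rewrite bdist_left in Hn by lra. exact Hn. }
  assert (Hxm : x - mesh L kappa (2 * M) i = grid L kappa (2 * M) (i - 1)) by (unfold mesh, x; ring).
  assert (Hxp : x + mesh L kappa (2 * M) (i + 1) = grid L kappa (2 * M) (i + 1)).
  { unfold mesh, x. replace (i + 1 - 1)%nat with i by lia. ring. }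
  assert (Hmid : forall y, grid L kappa (2 * M) 1 <= y <= 2 * L - grid L kappa (2 * M) 1 ->
     x / 2 <= bdist L y -> Rabs (D y) <= B2).
  { intros y Hy Hd. eapply Rle_trans; [apply (ie_inner _ _ _ _ _ _ HD y Hy)|].
    unfold B2. apply Rmult_le_compat_l.
    - left; repeat apply Rmult_lt_0_compat; lra.
    - apply half_power_bound; [lra|]. split; [exact Hd|]. apply bdist_pos; lra. }
  split; intros eta Heta.
  - eapply Rle_trans.
    + apply (singular_integral_bound alpha (mesh L kappa (2 * M) i) x (x / 2) B1 B2 (C2 * E M * x) eta
               (fun t => D (x - t))); try lra.
      * apply continuous_shift_minus, (ie_cont _ _ _ _ _ _ HD).
      * intros t Htt. eapply Rle_trans; [apply Hnear|].
        -- assert (Hg := grid_le L kappa M i (i + 1) HL Hk HM ltac:(lia)). fold x in Hg. lra.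
        -- replace (x - t - x) with (- t) by ring. rewrite Rabs_Ropp, Rabs_pos_eq by lra. lra.
      * intros t Htt Htd. apply Hmid; [|rewrite bdist_left; lra].
        destruct (Nat.eq_dec i 1) as [Ei | Ei].
        (* for the first node the near field already reaches the boundary *)
        { exfalso. rewrite Ei in Hxm. simpl (1 - 1)%nat in Hxm. rewrite grid_first in Hxm by lia.
          rewrite Ei in Htt. lra. }
        assert (Hl := later_node_ge L kappa M i HL Hk ltac:(lia)). fold x in Hl. lra.
      * assert (Em := RInt_abs_mirror D x 0 x ltac:(lra) (ie_cont _ _ _ _ _ _ HD)).
        rewrite Rminus_diag, Rminus_0_r in Em. rewrite Em. apply Hmass; auto.
    + assert (Hl := Hloc M x _ HM Hx (Hrho i (or_introl eq_refl))).
      fold B1 e B2 in Hl.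
      assert (Ed : Rpower (x / 2) (- 1 - alpha) * (C2 * E M * x) = k2 * E M * Rpower x (- alpha)).
      { unfold k2, Rdiv. rewrite Rmult_comm, (Rmult_comm x (/ 2)), <- Rpower_mult_distr by lra.
        replace (- alpha) with ((- 1 - alpha) + 1) by ring.
        rewrite Rpower_plus, Rpower_1 by lra. ring. }
      rewrite Ed.
      assert (0 <= k3 * E M * Rpower x (- alpha))
        by (left; apply Rmult_lt_0_compat; [apply Rmult_lt_0_compat|]; lra).
      lra.
  - eapply Rle_trans.
    + apply (singular_integral_bound alpha (mesh L kappa (2 * M) (i + 1)) (2 * L - x) (L / 2) B1 B2
               (C3 * E M) eta (fun t => D (x + t))); try lra.
      * apply continuous_shift_plus, (ie_cont _ _ _ _ _ _ HD).
      * intros t Htt. eapply Rle_trans; [apply Hnear|].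
        -- assert (Hg := grid_le L kappa M (i - 1) i HL Hk HM ltac:(lia)). fold x in Hg. lra.
        -- replace (x + t - x) with t by ring. rewrite Rabs_pos_eq by lra. lra.
      * intros t Htt Htd.
        (* with only two cells the near field reaches the boundary *)
        assert (HM2 : (2 <= M)%nat).
        { destruct (Nat.eq_dec M 1) as [EM | EM]; [|lia]. exfalso.
          assert (i = 1)%nat by lia. subst i M. unfold x in *.
          change (1 + 1)%nat with (2 * 1)%nat in Hxp at 2.
          rewrite grid_last, (grid_mid L kappa 1) in Hxp by lia. lra. }
        assert (Hl := later_node_ge L kappa M M HL Hk ltac:(lia)).
        rewrite grid_mid in Hl by lia.
        apply Hmid; [lra|].
        unfold bdist. apply Rmin_glb; lra.
      * rewrite RInt_abs_translate; [|lra | apply (ie_cont _ _ _ _ _ _ HD)].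
        eapply Rle_trans; [|apply (Htot M D HM HD)].
        apply RInt_nonneg_sub; try lra.
        -- intros; apply continuous_Rabs_fun, (ie_cont _ _ _ _ _ _ HD).
        -- intros; apply Rabs_pos.
    + assert (Hl := Hloc M x _ HM Hx (Hrho (i + 1)%nat (or_intror eq_refl))).
      fold B1 e B2 in Hl.
      assert (Ed : Rpower (L / 2) (- 1 - alpha) * (C3 * E M) <= k3 * E M * Rpower x (- alpha)).
      { assert (Hxl : Rpower L (- alpha) <= Rpower x (- alpha)) by (apply Rpower_anti; lra).
        assert (Hll : Rpower L alpha * Rpower L (- alpha) = 1).
        { rewrite <- Rpower_plus, Rplus_opp_r. apply Rpower_O, HL. }
        replace (Rpower (L / 2) (- 1 - alpha) * (C3 * E M)) with
          (k3 * E M * Rpower L (- alpha)).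
        - apply Rmult_le_compat_l; [|exact Hxl]. left; apply Rmult_lt_0_compat; lra.
        - unfold k3. transitivity (Rpower (L / 2) (- 1 - alpha) * C3 * E M * (Rpower L alpha * Rpower L (- alpha)));
            [ring | rewrite Hll; ring]. }
      assert (0 <= k2 * E M * Rpower x (- alpha))
        by (left; apply Rmult_lt_0_compat; [apply Rmult_lt_0_compat|]; lra).
      lra.
Qed.

Lemma kernel_bound L kappa sigma alpha K c E :
  0 < alpha < 1 -> 0 < L -> 1 <= kappa -> 0 < sigma -> 0 < K -> 0 < c ->
  rate alpha sigma kappa L c E ->
  exists C, 0 < C /\ forall M D i, (1 <= M)%nat -> interp_error L kappa sigma K M D ->
    (1 <= i <= 2 * M - 1)%nat -> let x := grid L kappa (2 * M) i in
    (forall eta, 0 < eta <= mesh L kappa (2 * M) i ->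
       Rabs (RInt (fun t => Rpower t (- 1 - alpha) * D (x - t)) eta x)
       <= C * E M * Rpower (bdist L x) (- alpha)) /\
    (forall eta, 0 < eta <= mesh L kappa (2 * M) (i + 1) ->
       Rabs (RInt (fun t => Rpower t (- 1 - alpha) * D (x + t)) eta (2 * L - x))
       <= C * E M * Rpower (bdist L x) (- alpha)).
Proof.
  intros Ha HL Hk Hs HK Hc HR.
  destruct (half_grid_kernel_bound L kappa sigma alpha K c E Ha HL Hk Hs HK Hc HR) as (C & HC & H).
  exists C. split; [exact HC|]. intros M D i HM HD Hi x.
  destruct (le_lt_dec i M) as [Hle | Hlt].
  - unfold x. rewrite bdist_left by (apply node_left_le; auto). apply H; auto; lia.
  - destruct (H M _ (2 * M - i)%nat HM (interp_error_mirror L kappa sigma K M D HM HD) ltac:(lia)) as [B1 B2].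
    rewrite grid_mirror in B1, B2 by lia. fold x in B1, B2.
    unfold x at 3 6. rewrite bdist_right by (apply node_right_ge; auto; lia). fold x.
    split; intros eta Heta.
    + replace (2 * M - i + 1)%nat with (2 * M + 1 - i)%nat in B2 by lia.
      rewrite mesh_mirror in B2 by lia.
      specialize (B2 eta Heta). replace (2 * L - (2 * L - x)) with x in B2 by ring.
      rewrite (RInt_ext _ (fun t => Rpower t (- 1 - alpha) * D (2 * L - (2 * L - x + t)))); [exact B2|].
      intros t _. do 2 f_equal. ring.
    + replace (2 * M - i)%nat with (2 * M + 1 - (i + 1))%nat in B1 by lia.
      rewrite mesh_mirror in B1 by lia.
      specialize (B1 eta Heta).
      rewrite (RInt_ext _ (fun t => Rpower t (- 1 - alpha) * D (2 * L - (2 * L - x - t)))); [exact B1|].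
      intros t _. do 2 f_equal. ring.
Qed.

(** * Convergence rates *)

Lemma Rpower_inv_half M p :
  (1 <= M)%nat -> Rpower (/ INR M) p = Rpower 2 p * Rpower (INR (2 * M)) (- p).
Proof.
  intros HM. assert (H0 : 0 < INR M) by (apply lt_0_INR; lia).
  rewrite INR_double, <- Rpower_mult_distr by lra.
  rewrite <- Rmult_assoc, <- Rpower_plus, Rplus_opp_r, Rpower_O, Rmult_1_l by lra.
  unfold Rpower. rewrite ln_Rinv by exact H0. f_equal. ring.
Qed.

Lemma Rpower_inv_INR_le M p q :
  (1 <= M)%nat -> q <= p -> Rpower (/ INR M) p <= Rpower (/ INR M) q.
Proof.
  intros HM Hpq. assert (H0 : 1 <= INR M) by (apply (le_INR 1); exact HM).
  assert (E : forall r, Rpower (/ INR M) r = Rpower (INR M) (- r)).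
  { intros r. unfold Rpower. rewrite ln_Rinv by lra. f_equal. ring. }
  rewrite !E. apply Rle_Rpower; lra.
Qed.

(** The integral is dominated by its lower end point, that is, by the cells close to
    the boundary. *)
Lemma mass_subcritical L kappa sigma M z :
  0 < L -> 1 <= kappa -> kappa * (1 + sigma) < 2 -> (1 <= M)%nat ->
  grid L kappa (2 * M) 1 <= z <= L ->
  let g := 1 + sigma - 2 / kappa in
  (/ INR M) ^ 2 * RInt (fun y => Rpower y (sigma - 2 / kappa)) (grid L kappa (2 * M) 1) z
  <= Rpower L g / (- g) / L * Rpower (/ INR M) (kappa * sigma) * z.
Proof.
  intros HL Hk Hcr HM Hz g.
  assert (Hg : kappa * g < 0) by (unfold g; replace (kappa * (1 + sigma - 2 / kappa)) with (kappa * (1 + sigma) - 2) by (field; lra); lra).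
  assert (Hg' : g < 0) by nra.
  assert (H1 := node_pos L kappa M 1 HL Hk HM ltac:(lia)).
  assert (Ht : 0 < / INR M) by (apply Rinv_0_lt_compat, lt_0_INR; lia).
  replace (sigma - 2 / kappa) with (g - 1) by (unfold g; ring).
  rewrite RInt_Rpower by lra.
  apply Rle_trans with ((/ INR M) ^ 2 * (Rpower (grid L kappa (2 * M) 1) g / - g)).
  - apply Rmult_le_compat_l; [apply pow_le; lra|].
    replace ((Rpower z g - Rpower (grid L kappa (2 * M) 1) g) / g)
      with ((Rpower (grid L kappa (2 * M) 1) g - Rpower z g) * / - g) by (field; lra).
    apply Rmult_le_compat_r; [left; apply Rinv_0_lt_compat; lra|].
    generalize (Rpower_pos z g); lra.
  - rewrite first_node_Rpower by auto.
    assert (E : (/ INR M) ^ 2 * Rpower (/ INR M) (kappa * g)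
       = Rpower (/ INR M) (kappa * sigma) * Rpower (/ INR M) kappa).
    { rewrite <- Rpower_pow, <- !Rpower_plus by exact Ht. f_equal. unfold g. simpl. field. lra. }
    replace ((/ INR M) ^ 2 * (Rpower L g * Rpower (/ INR M) (kappa * g) / - g)) with
      (Rpower L g / - g * ((/ INR M) ^ 2 * Rpower (/ INR M) (kappa * g))) by (field; split; [lra | apply not_0_INR; lia]).
    rewrite E.
    replace (Rpower L g / - g / L * Rpower (/ INR M) (kappa * sigma) * z) with
      (Rpower L g / - g * (Rpower (/ INR M) (kappa * sigma) * (z / L))) by (field; lra).
    apply Rmult_le_compat_l.
    { left; apply Rdiv_lt_0_compat; [apply Rpower_pos | lra]. }
    apply Rmult_le_compat_l; [left; apply Rpower_pos|].
    apply Rmult_le_reg_r with L; [lra|]. unfold Rdiv. rewrite Rmult_assoc, Rinv_l by lra.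
    rewrite first_node_eq in Hz by auto. lra.
Qed.

(** Here [sigma - 2/kappa = -1]: every dyadic range of distances to the boundary
    contributes equally, whence the logarithm. *)
Lemma mass_critical L kappa sigma M z :
  0 < L -> 1 <= kappa -> kappa * (1 + sigma) = 2 -> (1 <= M)%nat ->
  grid L kappa (2 * M) 1 <= z <= L ->
  (/ INR M) ^ 2 * RInt (fun y => Rpower y (sigma - 2 / kappa)) (grid L kappa (2 * M) 1) z
  <= kappa / L * (Rpower (/ INR M) (kappa * sigma) * ln (INR M)) * z.
Proof.
  intros HL Hk Hcr HM Hz.
  assert (He : sigma - 2 / kappa = Ropp 1).
  { rewrite <- Hcr. field. lra. }
  assert (H1 := node_pos L kappa M 1 HL Hk HM ltac:(lia)).
  assert (H0 : 1 <= INR M) by (apply (le_INR 1); exact HM).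
  assert (Ht : 0 < / INR M) by (apply Rinv_0_lt_compat; lra).
  assert (Hln : 0 <= ln (INR M)).
  { rewrite <- ln_1.
    destruct (Req_dec (INR M) 1) as [-> | Hne]; [lra | left; apply ln_increasing; lra]. }
  assert (EI : RInt (fun y => Rpower y (sigma - 2 / kappa)) (grid L kappa (2 * M) 1) z
     = ln z - ln (grid L kappa (2 * M) 1)).
  { apply is_RInt_unique.
    apply (is_RInt_ext (fun y => / y)).
    { intros y Hy. rewrite Rmin_left in Hy by lra.
      rewrite He, Rpower_Ropp, Rpower_1 by lra. reflexivity. }
    apply (is_RInt_derive ln).
    - intros y Hy. rewrite Rmin_left in Hy by lra. apply is_derive_Reals, derivable_pt_lim_ln; lra.
    - intros y Hy. rewrite Rmin_left in Hy by lra.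
      apply (continuous_Rinv y). lra. }
  assert (El : ln (grid L kappa (2 * M) 1) = ln L - kappa * ln (INR M)).
  { rewrite first_node_eq by auto. rewrite ln_mult by (try apply Rpower_pos; lra).
    unfold Rpower. rewrite ln_exp, ln_Rinv by lra. ring. }
  assert (Hzl : ln z <= ln L).
  { destruct (Req_dec z L) as [-> | Hne]; [lra | left; apply ln_increasing; lra]. }
  rewrite EI, El.
  apply Rle_trans with ((/ INR M) ^ 2 * (kappa * ln (INR M))).
  { apply Rmult_le_compat_l; [apply pow_le; lra | lra]. }
  assert (E2 : (/ INR M) ^ 2 = Rpower (/ INR M) (kappa * sigma) * Rpower (/ INR M) kappa).
  { rewrite <- Rpower_pow, <- Rpower_plus by exact Ht. f_equal. simpl. lra. }
  rewrite E2.
  replace (Rpower (/ INR M) (kappa * sigma) * Rpower (/ INR M) kappa * (kappa * ln (INR M)))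
    with (kappa * (Rpower (/ INR M) (kappa * sigma) * ln (INR M)) * Rpower (/ INR M) kappa) by ring.
  replace (kappa / L * (Rpower (/ INR M) (kappa * sigma) * ln (INR M)) * z) with
    (kappa * (Rpower (/ INR M) (kappa * sigma) * ln (INR M)) * (z / L)) by (field; lra).
  apply Rmult_le_compat_l.
  { repeat apply Rmult_le_pos; try lra. left; apply Rpower_pos. }
  apply Rmult_le_reg_r with L; [lra|]. unfold Rdiv. rewrite Rmult_assoc, Rinv_l by lra.
  rewrite first_node_eq in Hz by auto. lra.
Qed.

(** The integral is dominated by its upper end point. *)
Lemma mass_supercritical L kappa sigma alpha M z :
  0 < L -> 1 <= kappa -> 0 <= alpha -> 2 < kappa * (1 + sigma) -> (1 <= M)%nat ->
  grid L kappa (2 * M) 1 <= z <= L ->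
  let g := 1 + sigma - 2 / kappa in
  (/ INR M) ^ 2 * RInt (fun y => Rpower y (sigma - 2 / kappa)) (grid L kappa (2 * M) 1) z
  <= Rpower L (g - 1) / g * (Rpower (/ INR M) (kappa * sigma) + Rpower (/ INR M) (2 - alpha)) * z.
Proof.
  intros HL Hk Ha Hcr HM Hz g.
  assert (Hg : 0 < kappa * g) by (unfold g; replace (kappa * (1 + sigma - 2 / kappa)) with (kappa * (1 + sigma) - 2) by (field; lra); lra).
  assert (Hg' : 0 < g) by nra.
  assert (H1 := node_pos L kappa M 1 HL Hk HM ltac:(lia)).
  assert (Ht : 0 < / INR M) by (apply Rinv_0_lt_compat, lt_0_INR; lia).
  replace (sigma - 2 / kappa) with (g - 1) by (unfold g; ring).
  rewrite RInt_Rpower by lra.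
  assert (Hb := Rpower_between z (g - 1) _ L (conj H1 (proj1 Hz)) (proj2 Hz)).
  rewrite first_node_Rpower in Hb by auto.
  assert (P1 := Rpower_pos (grid L kappa (2 * M) 1) g).
  assert (Ez : Rpower z g = Rpower z (g - 1) * z).
  { rewrite <- (Rpower_1 z) at 3 by lra. rewrite <- Rpower_plus. f_equal; ring. }
  assert (Hi : 0 < / g) by (apply Rinv_0_lt_compat; lra).
  assert (Hp2 : 0 <= (/ INR M) ^ 2) by (apply pow_le; lra).
  apply Rle_trans with ((/ INR M) ^ 2 * (Rpower z g * / g)).
  { apply Rmult_le_compat_l; [exact Hp2|]. apply Rmult_le_compat_r; lra. }
  rewrite Ez.
  apply Rle_trans with ((/ INR M) ^ 2 * ((Rpower L (g - 1) * Rpower (/ INR M) (kappa * (g - 1)) + Rpower L (g - 1)) * z * / g)).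
  { apply Rmult_le_compat_l; [exact Hp2|]. apply Rmult_le_compat_r; [lra|].
    apply Rmult_le_compat_r; lra. }
  assert (E : (/ INR M) ^ 2 * Rpower (/ INR M) (kappa * (g - 1)) = Rpower (/ INR M) (kappa * sigma)).
  { rewrite <- Rpower_pow, <- !Rpower_plus by exact Ht. f_equal. unfold g. simpl. field. lra. }
  assert (E2 : (/ INR M) ^ 2 <= Rpower (/ INR M) (2 - alpha)).
  { rewrite <- Rpower_pow by exact Ht. apply Rpower_inv_INR_le; [exact HM | simpl; lra]. }
  replace ((/ INR M) ^ 2 * ((Rpower L (g - 1) * Rpower (/ INR M) (kappa * (g - 1)) + Rpower L (g - 1)) * z * / g))
    with (Rpower L (g - 1) / g * z * ((/ INR M) ^ 2 * Rpower (/ INR M) (kappa * (g - 1)) + (/ INR M) ^ 2))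
    by (field; split; [lra | apply not_0_INR; lia]).
  rewrite E.
  replace (Rpower L (g - 1) / g * (Rpower (/ INR M) (kappa * sigma) + Rpower (/ INR M) (2 - alpha)) * z)
    with (Rpower L (g - 1) / g * z * (Rpower (/ INR M) (kappa * sigma) + Rpower (/ INR M) (2 - alpha))) by ring.
  apply Rmult_le_compat_l; [|lra].
  left; apply Rmult_lt_0_compat; [apply Rdiv_lt_0_compat; [apply Rpower_pos | lra] | lra].
Qed.

Lemma rate_subcritical alpha sigma kappa L :
  0 < alpha < 1 -> 0 < L -> 1 <= kappa -> kappa * (1 + sigma) < 2 ->
  exists c, 0 < c /\
    rate alpha sigma kappa L c (fun M => Rpower (INR (2 * M)) (- (kappa * sigma))).
Proof.
  intros Ha HL Hk Hcr.
  set (g := 1 + sigma - 2 / kappa). set (k := Rpower L g / (- g) / L).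
  assert (Hg : kappa * g < 0) by (unfold g; replace (kappa * (1 + sigma - 2 / kappa)) with (kappa * (1 + sigma) - 2) by (field; lra); lra).
  assert (Hk0 : 0 < k) by (unfold k; repeat apply Rdiv_lt_0_compat; try apply Rpower_pos; nra).
  assert (P2 := Rpower_pos 2 (kappa * sigma)).
  set (c := Rpower 2 (kappa * sigma)) in *.
  assert (Hk1 : 0 < k * c) by (apply Rmult_lt_0_compat; lra).
  exists (c + k * c). split; [lra|].
  assert (Hb : forall M, (1 <= M)%nat ->
     Rpower (/ INR M) (kappa * sigma) <= (c + k * c) * Rpower (INR (2 * M)) (- (kappa * sigma))).
  { intros M HM. rewrite Rpower_inv_half by exact HM.
    apply Rmult_le_compat_r; [left; apply Rpower_pos | fold c; lra]. }
  split; auto.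
  - intros M HM. eapply Rle_trans; [|apply Hb, HM]. apply Rpower_inv_INR_le; [exact HM | lra].
  - intros M z HM Hz. eapply Rle_trans; [apply mass_subcritical; auto|].
    assert (H1 := node_pos L kappa M 1 HL Hk HM ltac:(lia)).
    apply Rmult_le_compat_r; [lra|]. rewrite Rpower_inv_half by exact HM. fold g k c.
    rewrite <- Rmult_assoc. apply Rmult_le_compat_r; [left; apply Rpower_pos | lra].
Qed.

Lemma rate_critical alpha sigma kappa L :
  0 < alpha < 1 -> 0 < L -> 1 <= kappa -> kappa * (1 + sigma) = 2 ->
  exists c, 0 < c /\
    rate alpha sigma kappa L c
      (fun M => Rpower (INR (2 * M)) (- (kappa * sigma)) * ln (INR (2 * M))).
Proof.
  intros Ha HL Hk Hcr.
  assert (P2 := Rpower_pos 2 (kappa * sigma)).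
  set (c := Rpower 2 (kappa * sigma)) in *.
  assert (Hl2 : 0 < ln 2) by (rewrite <- ln_1; apply ln_increasing; lra).
  assert (Hcl : 0 < c / ln 2) by (apply Rdiv_lt_0_compat; lra).
  assert (HkL : 0 < kappa / L * c).
  { apply Rmult_lt_0_compat; [apply Rdiv_lt_0_compat; lra | lra]. }
  exists (c / ln 2 + kappa / L * c). split; [lra|].
  assert (Hln : forall M, (1 <= M)%nat -> ln 2 <= ln (INR (2 * M)) /\ ln (INR M) <= ln (INR (2 * M))).
  { intros M HM. assert (H0 : 1 <= INR M) by (apply (le_INR 1); exact HM).
    rewrite INR_double, ln_mult by lra.
    assert (0 <= ln (INR M)); [|lra]. rewrite <- ln_1.
    destruct (Req_dec (INR M) 1) as [-> | Hne]; [lra | left; apply ln_increasing; lra]. }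
  assert (Hb : forall M, (1 <= M)%nat ->
     Rpower (/ INR M) (kappa * sigma) <= (c / ln 2 + kappa / L * c) *
       (Rpower (INR (2 * M)) (- (kappa * sigma)) * ln (INR (2 * M)))).
  { intros M HM. destruct (Hln M HM) as [Hln1 _].
    rewrite Rpower_inv_half by exact HM. fold c.
    set (r := Rpower (INR (2 * M)) (- (kappa * sigma))). assert (Hr : 0 < r) by apply Rpower_pos.
    apply Rle_trans with (c / ln 2 * (r * ln (INR (2 * M)))).
    - replace (c * r) with (c / ln 2 * (r * ln 2)) by (field; lra).
      apply Rmult_le_compat_l; [lra|]. apply Rmult_le_compat_l; lra.
    - apply Rmult_le_compat_r; [|lra]. apply Rmult_le_pos; lra. }
  split; auto.
  - intros M HM. eapply Rle_trans; [|apply Hb, HM]. apply Rpower_inv_INR_le; [exact HM | lra].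
  - intros M z HM Hz. eapply Rle_trans; [apply mass_critical; auto|].
    assert (H1 := node_pos L kappa M 1 HL Hk HM ltac:(lia)).
    destruct (Hln M HM) as [Hln1 Hln2].
    apply Rmult_le_compat_r; [lra|]. rewrite Rpower_inv_half by exact HM. fold c.
    set (r := Rpower (INR (2 * M)) (- (kappa * sigma))). assert (Hr : 0 < r) by apply Rpower_pos.
    apply Rle_trans with (kappa / L * c * (r * ln (INR (2 * M)))).
    + rewrite (Rmult_assoc c), <- (Rmult_assoc (kappa / L)). apply Rmult_le_compat_l; [lra|].
      apply Rmult_le_compat_l; lra.
    + apply Rmult_le_compat_r; [|lra]. apply Rmult_le_pos; lra.
Qed.

Lemma rate_supercritical alpha sigma kappa L :
  0 < alpha < 1 -> 0 < L -> 1 <= kappa -> 2 < kappa * (1 + sigma) ->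
  exists c, 0 < c /\
    rate alpha sigma kappa L c
      (fun M => Rpower (INR (2 * M)) (- Rmin (kappa * sigma) (2 - alpha))).
Proof.
  intros Ha HL Hk Hcr.
  set (g := 1 + sigma - 2 / kappa). set (k := Rpower L (g - 1) / g).
  assert (Hg : 0 < kappa * g) by (unfold g; replace (kappa * (1 + sigma - 2 / kappa)) with (kappa * (1 + sigma) - 2) by (field; lra); lra).
  assert (Hk0 : 0 < k) by (unfold k; apply Rdiv_lt_0_compat; try apply Rpower_pos; nra).
  set (p := Rmin (kappa * sigma) (2 - alpha)).
  assert (P2 := Rpower_pos 2 p).
  set (c := Rpower 2 p) in *.
  assert (Hk1 : 0 < k * c) by (apply Rmult_lt_0_compat; lra).
  exists (c + 2 * (k * c)). split; [lra|].
  assert (Hp : forall M, (1 <= M)%nat ->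
     Rpower (/ INR M) (kappa * sigma) <= c * Rpower (INR (2 * M)) (- p) /\
     Rpower (/ INR M) (2 - alpha) <= c * Rpower (INR (2 * M)) (- p)).
  { intros M HM. unfold c. rewrite <- Rpower_inv_half by exact HM.
    split; apply Rpower_inv_INR_le; auto; [apply Rmin_l | apply Rmin_r]. }
  assert (Hc : forall M, c * Rpower (INR (2 * M)) (- p) <= (c + 2 * (k * c)) * Rpower (INR (2 * M)) (- p)).
  { intros M. apply Rmult_le_compat_r; [left; apply Rpower_pos | lra]. }
  split.
  - intros M HM. destruct (Hp M HM) as [_ H]. specialize (Hc M). lra.
  - intros M HM. destruct (Hp M HM) as [H _]. specialize (Hc M). lra.
  - intros M z HM Hz.
    eapply Rle_trans; [apply (mass_supercritical L kappa sigma alpha); auto; lra|].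
    assert (H1 := node_pos L kappa M 1 HL Hk HM ltac:(lia)).
    destruct (Hp M HM) as [A1 A2].
    apply Rmult_le_compat_r; [lra|]. fold g k.
    set (r := Rpower (INR (2 * M)) (- p)) in *. assert (Hr : 0 < r) by apply Rpower_pos.
    apply Rle_trans with (k * (c * r + c * r)); [apply Rmult_le_compat_l; lra|].
    assert (0 < c * r) by (apply Rmult_lt_0_compat; lra). lra.
Qed.

(** The error equation: at each interior node the operator with the approximate
    kernel, applied to the error, equals the truncation error with the exact kernel
    plus the effect of replacing the kernel, of size [2 * L * eps * max |u|].  The
    first is controlled by [truncation_error] and [kernel_bound], and
    [two_sided_stability] turns the bound into one for the error itself. *)
Lemma error_of_rate alpha sigma kappa L C c u u1 u2 f E :
  0 < alpha < 1 -> 0 < L -> 1 <= kappa -> 0 < sigma < 1 -> 0 < C -> 0 < c ->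
  regular L sigma C u u1 u2 ->
  (forall x, 0 < x < 2 * L -> is_frac_laplacian alpha u x (f x)) ->
  rate alpha sigma kappa L c E ->
  exists c0 eps0, 0 < c0 /\ 0 < eps0 /\
    forall (M : nat) (eps dx X : R) (Ne : nat) (lambda theta U : nat -> R),
      (1 <= M)%nat -> 0 < eps <= eps0 -> 0 < dx ->
      (forall j, (1 <= j <= 2 * M)%nat -> dx <= mesh L kappa (2 * M) j) ->
      2 * L <= X -> is_SOE alpha eps dx X Ne lambda theta ->
      U 0%nat = 0 -> U (2 * M)%nat = 0 ->
      (forall i, (1 <= i <= 2 * M - 1)%nat ->
         fast_op alpha L kappa (2 * M) Ne lambda theta U i = f (grid L kappa (2 * M) i)) ->
      forall i, (1 <= i <= 2 * M - 1)%nat ->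
        Rabs (u (grid L kappa (2 * M) i) - U i) <= c0 * (E M + eps).
Proof.
  intros Ha HL Hk Hs HC Hc Hreg Hf HR.
  destruct (interpolation_error_bounds L kappa sigma C u u1 u2 HL Hk Hs HC Hreg) as (K & HK & HIE).
  destruct (kernel_bound L kappa sigma alpha K c E Ha HL Hk (proj1 Hs) HK Hc HR) as (CT & HCT & HKB).
  set (B := C * Rpower L sigma).
  assert (HB : 0 < B) by (apply Rmult_lt_0_compat; [lra | apply Rpower_pos]).
  assert (Hub : forall y, Rabs (u y) <= B).
  { intros y. destruct (classic (0 < y < 2 * L)) as [Hy | Hy].
    - eapply Rle_trans; [apply (reg_b0 _ _ _ _ _ _ Hreg), Hy|].
      apply Rmult_le_compat_l; [lra|]. apply Rle_Rpower_l; [lra|]. apply bdist_pos, Hy.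
    - rewrite (reg_out _ _ _ _ _ _ Hreg), Rabs_R0; [lra|].
      destruct (Rlt_dec 0 y); destruct (Rlt_dec y (2 * L)); lra. }
  (* the effect of the kernel carries no weight; as [bdist <= L], the factor
     [L^alpha * bdist^(-alpha)] is at least [1] and supplies it *)
  set (k1 := 2 * L * B * Rpower L alpha).
  assert (Hk1 : 0 < k1) by (unfold k1; repeat apply Rmult_lt_0_compat; try apply Rpower_pos; lra).
  (* this [eps0] makes [4 * L * eps] at most [L^(-alpha) / alpha], as stability requires *)
  exists (2 * alpha * (2 * CT + k1)), (Rpower L (- alpha) / (4 * L * alpha)).
  assert (PL := Rpower_pos L (- alpha)).
  split; [apply Rmult_lt_0_compat; lra|].
  split; [apply Rdiv_lt_0_compat; [lra | repeat apply Rmult_lt_0_compat; lra]|].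
  intros M eps dx X Ne lambda theta U HM Heps Hdx Hdxm HX HSOE HU0 HUN HU.
  assert (HKE := kernel_bounds_of_SOE alpha eps dx X Ne lambda theta HSOE).
  set (ke := soe Ne lambda theta) in *.
  set (w := grid_fun L kappa M u).
  assert (Hw0 : w 0%nat = 0).
  { unfold w, grid_fun. rewrite grid_first by lia. apply (reg_out _ _ _ _ _ _ Hreg). lra. }
  assert (HwN : w (2 * M)%nat = 0).
  { unfold w, grid_fun. rewrite grid_last by lia. apply (reg_out _ _ _ _ _ _ Hreg). lra. }
  assert (HE : 0 < E M).
  { assert (P := Rpower_pos (/ INR M) (kappa * sigma)).
    assert (Hb := rate_boundary _ _ _ _ _ _ HR M HM).
    apply Rmult_lt_reg_l with c; lra. }
  assert (Hmain : forall i, (1 <= i <= 2 * M - 1)%nat ->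
    Rabs (two_sided alpha L kappa (2 * M) ke (fun j => w j - U j) i)
    <= (2 * CT * E M + k1 * eps) * Rpower (bdist L (grid L kappa (2 * M) i)) (- alpha)).
  { intros i Hi.
    destruct (interior_node L kappa M i HL Hk HM Hi) as [Hm1 Hm2].
    set (x := grid L kappa (2 * M) i) in *.
    assert (Hx : 0 < x < 2 * L) by lra.
    destruct (Hf x Hx) as (p & HPV & Hp).
    assert (HUi : two_sided alpha L kappa (2 * M) ke U i = p).
    { specialize (HU i Hi). rewrite fast_op_two_sided in HU by auto. fold ke x in HU.
      rewrite Hp in HU. apply Rmult_eq_reg_l in HU; [exact HU|].
      apply Rgt_not_eq, C_frac_pos, Ha. }
    rewrite two_sided_minus, HUi by (auto; intros; apply soe_continuous).
    set (k0 := fun t => Rpower t (- 1 - alpha)).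
    assert (Hpw := fun t => interp_continuous L kappa M w t HL Hk HM).
    assert (HA : Rabs (two_sided alpha L kappa (2 * M) ke w i - two_sided alpha L kappa (2 * M) k0 w i)
        <= 2 * L * B * eps).
    { assert (Hbw := fun y => interp_bounded L kappa M w B y HL Hk HM Hw0 HwN (fun j _ => Hub _)).
      assert (Hdx1 := Hdxm i ltac:(lia)). assert (Hdx2 := Hdxm (i + 1)%nat ltac:(lia)).
      unfold two_sided. cbv zeta. fold x.
      match goal with |- Rabs (?a + ?b - (?c + ?d)) <= _ =>
        replace (a + b - (c + d)) with ((a - c) + (b - d)) by ring end.
      eapply Rle_trans; [apply Rabs_triang|].
      apply Rle_trans with (eps * B * (x - mesh L kappa (2 * M) i)
                            + eps * B * (2 * L - x - mesh L kappa (2 * M) (i + 1))).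
      - apply Rplus_le_compat.
        + apply side_kernel_diff.
          * lra.
          * intros; apply soe_continuous.
          * intros; apply continuous_Rpower; lra.
          * apply continuous_shift_minus; exact Hpw.
          * intros; apply HKE; lra.
          * intros; apply Hbw.
        + apply side_kernel_diff.
          * lra.
          * intros; apply soe_continuous.
          * intros; apply continuous_Rpower; lra.
          * apply continuous_shift_plus; exact Hpw.
          * intros; apply HKE; lra.
          * intros; apply Hbw.
      - rewrite <- Rmult_plus_distr_l. replace (2 * L * B * eps) with (eps * B * (2 * L)) by ring.
        apply Rmult_le_compat_l; [apply Rmult_le_pos; lra | lra]. }
    destruct (HKB M _ i HM (HIE M HM) Hi) as [HB1 HB2]. fold x w in HB1, HB2.
    assert (HT : Rabs (p - two_sided alpha L kappa (2 * M) k0 w i)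
       <= CT * E M * Rpower (bdist L x) (- alpha) + CT * E M * Rpower (bdist L x) (- alpha)).
    { unfold two_sided. cbv zeta. fold x. change (w i) with (u x).
      apply (truncation_error alpha x (2 * L) (mesh L kappa (2 * M) i) (mesh L kappa (2 * M) (i + 1))
        (w (i - 1)%nat) (w (i + 1)%nat) u (interp L kappa (2 * M) w)); auto.
      - apply (reg_cont _ _ _ _ _ _ Hreg).
      - apply (reg_out _ _ _ _ _ _ Hreg).
      - intros t Ht. assert (Em : mesh L kappa (2 * M) i = x - grid L kappa (2 * M) (i - 1)) by reflexivity.
        rewrite (interp_cell L kappa M w i) by (auto; try lia; fold x; lra).
        change (w i) with (u x).
        replace (grid L kappa (2 * M) (i - 1)) with (x - mesh L kappa (2 * M) i) by lra.
        match goal with |- ?a = ?b => change (@eq R a b) end. field. lra.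
      - intros t Ht. assert (Em : mesh L kappa (2 * M) (i + 1) = grid L kappa (2 * M) (i + 1) - x).
        { unfold mesh, x. do 2 f_equal. lia. }
        assert (Ei : (i + 1 - 1)%nat = i) by lia.
        rewrite (interp_cell L kappa M w (i + 1)) by (auto; try lia; rewrite Ei; fold x; lra).
        rewrite Ei. change (w i) with (u x). fold x.
        match goal with |- ?a = ?b => change (@eq R a b) end. field. lra. }
    set (Sw := two_sided alpha L kappa (2 * M) ke w i) in *.
    set (Kw := two_sided alpha L kappa (2 * M) k0 w i) in *.
    assert (Hd := bdist_pos L x Hx).
    assert (Hone : 1 <= Rpower L alpha * Rpower (bdist L x) (- alpha)).
    { assert (Rpower L (- alpha) <= Rpower (bdist L x) (- alpha)) by (apply Rpower_anti; lra).
      assert (Hll : Rpower L alpha * Rpower L (- alpha) = 1).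
      { rewrite <- Rpower_plus, Rplus_opp_r. apply Rpower_O, HL. }
      rewrite <- Hll. apply Rmult_le_compat_l; [left; apply Rpower_pos | assumption]. }
    set (rd := Rpower (bdist L x) (- alpha)) in *.
    replace (Sw - p) with ((Sw - Kw) - (p - Kw)) by ring.
    unfold Rminus at 1. eapply Rle_trans; [apply Rabs_triang|]. rewrite Rabs_Ropp.
    assert (Hk1e : 2 * L * B * eps <= k1 * eps * rd).
    { unfold k1. replace (2 * L * B * Rpower L alpha * eps * rd)
        with (2 * L * B * eps * (Rpower L alpha * rd)) by ring.
      rewrite <- (Rmult_1_r (2 * L * B * eps)) at 1. apply Rmult_le_compat_l; [|exact Hone].
      left; apply Rmult_lt_0_compat; [apply Rmult_lt_0_compat|]; lra. }
    lra. }
  intros i Hi.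
  assert (Hst := two_sided_stability alpha L kappa M ke eps (fun j => w j - U j) (2 * CT * E M + k1 * eps)
    Ha HL Hk HM (fun t => soe_continuous _ _ _ t) ltac:(lra)).
  change (u (grid L kappa (2 * M) i) - U i) with ((fun j => w j - U j) i).
  eapply Rle_trans; [apply Hst; auto|].
  - destruct Heps as [_ Heps].
    apply Rmult_le_compat_l with (r := 4 * L) in Heps; [|lra].
    eapply Rle_trans; [exact Heps|]. right. field. lra.
  - intros j t Hj Ht. apply HKE. specialize (Hdxm j Hj). lra.
  - rewrite Hw0, HU0. ring.
  - rewrite HwN, HUN. ring.
  - rewrite (Rmult_assoc (2 * alpha)). apply Rmult_le_compat_l; [lra|].
    assert (0 < k1 * E M) by (apply Rmult_lt_0_compat; lra).
    assert (0 < CT * eps) by (apply Rmult_lt_0_compat; lra). lra.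
Qed.

Theorem theorem3p5 (alpha sigma kappa L : R) (u f : R -> R)
  (Halpha : 0 < alpha < 1) (HL : 0 < L) (Hkappa : 1 <= kappa)
  (Hsigma : 0 < sigma <= alpha / 2)
  (Hu_eq : forall x, 0 < x < 2 * L -> is_frac_laplacian alpha u x (f x))
  (Hu_ext : forall x, x <= 0 \/ 2 * L <= x -> u x = 0)
  (Hu_C2 : C2_on u 0 (2 * L))
  (Hu_reg : exists M : R, 0 < M /\
     forall (l : nat) (x : R), (l <= 2)%nat -> 0 < x < 2 * L ->
       Rabs (Derive_n u l x) <= M * Rpower (x * (2 * L - x)) (sigma - INR l)) :
  exists c eps0 : R, 0 < c /\ 0 < eps0 /\
    forall (N : nat) (eps dx X : R) (Ne : nat) (lambda theta U : nat -> R),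
      (0 < N)%nat -> Nat.Even N ->
      0 < eps <= eps0 ->
      0 < dx -> (forall j, (1 <= j <= N)%nat -> dx <= mesh L kappa N j) ->
      2 * L <= X ->
      is_SOE alpha eps dx X Ne lambda theta ->
      U 0%nat = 0 -> U N = 0 ->
      (forall i, (1 <= i <= N - 1)%nat ->
         fast_op alpha L kappa N Ne lambda theta U i = f (grid L kappa N i)) ->
      forall i, (1 <= i <= N - 1)%nat ->
        let err := Rabs (u (grid L kappa N i) - U i) in
        (kappa * (1 + sigma) < 2 ->
           err <= c * (Rpower (INR N) (- (kappa * sigma)) + eps)) /\
        (kappa * (1 + sigma) = 2 ->
           err <= c * (Rpower (INR N) (- (kappa * sigma)) * ln (INR N) + eps)) /\
        (2 < kappa * (1 + sigma) ->
           err <= c * (Rpower (INR N) (- Rmin (kappa * sigma) (2 - alpha)) + eps)).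
Proof.
  destruct (regular_of_weighted_bounds u L sigma HL ltac:(lra) Hu_ext Hu_C2 Hu_reg)
    as (C & HC & Hreg).
  assert (Hfin : forall c E, 0 < c -> rate alpha sigma kappa L c E -> _)
    by exact (fun c E Hc => error_of_rate alpha sigma kappa L C c u _ _ f E
               Halpha HL Hkappa ltac:(lra) HC Hc Hreg Hu_eq).
  destruct (Rtotal_order (kappa * (1 + sigma)) 2) as [Hcr | [Hcr | Hcr]].
  - destruct (rate_subcritical alpha sigma kappa L Halpha HL Hkappa Hcr) as (c & Hc & HR).
    destruct (Hfin c _ Hc HR) as (c0 & eps0 & Hc0 & He0 & H).
    exists c0, eps0. split; [exact Hc0|]. split; [exact He0|].
    intros N eps dx X Ne lambda theta U HN [M ->] Heps Hdx Hdxm HX HSOE HU0 HUN HU i Hi err.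
    repeat split; intros Hcr'; [| lra | lra].
    apply (H M eps dx X Ne lambda theta U); auto. lia.
  - destruct (rate_critical alpha sigma kappa L Halpha HL Hkappa Hcr) as (c & Hc & HR).
    destruct (Hfin c _ Hc HR) as (c0 & eps0 & Hc0 & He0 & H).
    exists c0, eps0. split; [exact Hc0|]. split; [exact He0|].
    intros N eps dx X Ne lambda theta U HN [M ->] Heps Hdx Hdxm HX HSOE HU0 HUN HU i Hi err.
    repeat split; intros Hcr'; [lra | | lra].
    apply (H M eps dx X Ne lambda theta U); auto. lia.
  - destruct (rate_supercritical alpha sigma kappa L Halpha HL Hkappa Hcr) as (c & Hc & HR).
    destruct (Hfin c _ Hc HR) as (c0 & eps0 & Hc0 & He0 & H).
    exists c0, eps0. split; [exact Hc0|]. split; [exact He0|].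
    intros N eps dx X Ne lambda theta U HN [M ->] Heps Hdx Hdxm HX HSOE HU0 HUN HU i Hi err.
    repeat split; intros Hcr'; [lra | lra |].
    apply (H M eps dx X Ne lambda theta U); auto. lia.
Qed.
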